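(* Let $\mathbb{X}$ be a complex Banach space, let $\mathcal{F}\subset BC(\mathbb{R}^+,\mathbb{X})$ be a function space that satisfies Condition $F^{++}$, and let $A$ be a closed linear operator on $\mathbb{X}$ with domain $D(A)$. Let $f\in\mathcal{F}$, let $u\in BC(\mathbb{R}^+,\mathbb{X})$ be a mild solution on $\mathbb{R}^+$ of $$u'(t)=Au(t)+f(t),$$ and let $\phi\in L^1(\mathbb{R}^+)$ be of spectral synthesis with respect to the closed set $i\sigma(A)\cap\mathbb{R}$. Then $w\in\mathcal{F}$, where $$w(t):=\int_0^\infty \phi(s)u(t+s)\,ds,\qquad t\in\mathbb{R}^+.$$
   Context: $\mathbb{R}^+=[0,\infty)$, $\mathbb{R}^-=(-\infty,0]$. $BC(\mathbb{R}^+,\mathbb{X})$ is the Banach space (sup norm) of all bounded continuous functions $\mathbb{R}^+\to\mathbb{X}$; $C_0(\mathbb{R}^+,\mathbb{X})$ is its subspace of functions $g$ with $\lim_{t\to\infty}g(t)=0$. $L(\mathbb{X})$ is the space of bounded linear operators on $\mathbb{X}$; $\sigma(A)$ is the spectrum of $A$, and $i\sigma(A)=\{i\mu:\mu\in\sigma(A)\}$. $L^1(\mathbb{R})$, $L^1(\mathbb{R}^\pm)$ are the spaces of complex-valued integrable functions. Functions on $\mathbb{R}^+$ (resp. $\mathbb{R}^-$) are identified with functions on $\mathbb{R}$ by extending them by $0$ for $t<0$ (resp. $t>0$). The operator $A$ need not be bounded or generate a $C_0$-semigroup. Mild solution: a continuous function $u:\mathbb{R}^+\to\mathbb{X}$ is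 a mild solution of $u'=Au+f$ on $\mathbb{R}^+$ if for every $t\in\mathbb{R}^+$, $\int_0^t u(s)\,ds\in D(A)$ and $u(t)-u(0)=A\int_0^t u(s)\,ds+\int_0^t f(s)\,ds$. Spectral synthesis: $g\in L^1(\mathbb{R})$ is of spectral synthesis with respect to a closed set $E\subset\mathbb{R}$ if there is a sequence $(g_n)$ in $L^1(\mathbb{R})$ such that $\lim_{n\to\infty}\|g-g_n\|_1=0$ and the Fourier transform of each $g_n$ vanishes on a neighborhood of $E$. The Fourier transform of $g\in L^1(\mathbb{R})$ is $\xi\mapsto\int_{-\infty}^\infty e^{-i\xi t}g(t)\,dt$. Condition $F^{++}$: a linear subspace $\mathcal{F}\subset BC(\mathbb{R}^+,\mathbb{X})$ satisfies Condition $F^{++}$ if (i) $\mathcal{F}$ is closed and contains $C_0(\mathbb{R}^+,\mathbb{X})$; (ii) if $g\in\mathcal{F}$, then for all $\xi\in\mathbb{R}$ the function $t\mapsto e^{i\xi t}g(t)$ is in $\mathcal{F}$; (iii) for each $h\in\mathcal{F}$ and all complex $\lambda,\eta$ with $\mathrm{Re}\,\lambda>0$, $\mathrm{Re}\,\eta<0$, the functions $y(t)=\int_t^\infty e^{\lambda(t-s)}h(s)\,ds$ and $z(t)=\int_0^t e^{\eta(t-s)}h(s)\,ds$, $t\in\mathbb{R}^+$, are in $\mathcal{F}$; (iv) for each $B\in L(\mathbb{X})$ and $g\in\mathcal{F}$, the function $t\mapsto Bg(t)$ is in $\mathcal{F}$; (v) for each $\psi\in L^1(\mathbb{R}^-)$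 and $g\in\mathcal{F}$, the convolution $\psi*g$ (restricted to $\mathbb{R}^+$), i.e. $(\psi*g)(t)=\int_t^\infty\psi(t-s)g(s)\,ds$ for $t\in\mathbb{R}^+$, is in $\mathcal{F}$. *)

(* Defs.v *)
From HB Require Import structures.
From mathcomp Require Import all_boot all_order all_algebra.
From mathcomp Require Import all_classical all_reals all_analysis.
From mathcomp Require Export complex.

Set Implicit Arguments.
Unset Strict Implicit.
Unset Printing Implicit Defensive.

Import Order.TTheory GRing.Theory Num.Theory.
Import numFieldNormedType.Exports.

Local Open Scope classical_set_scope.
Local Open Scope ring_scope.
Local Open Scope complex_scope.

Section Basics.
Context {R : realType}.

Definition Rplus : set R := `[0, +oo[.
Definition Rminus : set R := `]-oo, 0].

Definition cexp (z : R[i]) : R[i] :=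
  (expR (complex.Re z) * cos (complex.Im z)) +i* (expR (complex.Re z) * sin (complex.Im z)).

(* In a normed space over R[i] the norm takes its values in R[i], with zero
   imaginary part. *)
Definition rnorm {V : normedModType R[i]} (x : V) : R := complex.Re `|x|.

Definition cabs (z : R[i]) : R := ComplexField.Normc.normc z.

(* The library's [f \_ D] extends by [point], which in an abstract normed space
   is not known to be 0. *)
Definition ext0 {V : nmodType} (D : set R) (f : R -> V) : R -> V :=
  patch (fun=> 0) D f.

End Basics.

Section L1.
Context {R : realType}.
Local Notation mu := (@lebesgue_measure R).

Definition L1 (D : set R) (g : R -> R[i]) : Prop :=
  mu.-integrable D (fun t => (complex.Re (g t))%:E) /\
  mu.-integrable D (fun t => (complex.Im (g t))%:E).

Definition cintegral (D : set R) (g : R -> R[i]) : R[i] :=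
  (\int[mu]_(t in D) complex.Re (g t)) +i* (\int[mu]_(t in D) complex.Im (g t)).

Definition fourier (g : R -> R[i]) (xi : R) : R[i] :=
  cintegral setT (fun t : R => cexp (- ('i%C * xi%:C * t%:C)) * g t).

Definition spectral_synthesis (g : R -> R[i]) (E : set R) : Prop :=
  exists gn : nat -> R -> R[i],
    [/\ forall n, L1 setT (gn n),
        (fun n => (\int[mu]_t (cabs (g t - gn n t))%:E)%E) @ \oo --> 0%E &
        forall n, exists U : set R,
          [/\ open U, E `<=` U & forall xi, U xi -> fourier (gn n) xi = 0]].

End L1.

Section Bochner.
Context {R : realType} {X : completeNormedModType R[i]}.
Local Notation mu := (@lebesgue_measure R).

Definition bochner_simple (D : set R) (s : R -> X) : Prop :=
  [/\ finite_set (range s),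
      forall x, measurable (s @^-1` [set x]) &
      forall x, x != 0 -> (mu (D `&` s @^-1` [set x]) < +oo)%E].

(* The term x = 0 vanishes whatever the measure of its level set is. *)
Definition simple_integral (D : set R) (s : R -> X) : X :=
  \sum_(x \in range s) (fine (mu (D `&` s @^-1` [set x])))%:C *: x.

Definition is_bochner (D : set R) (f : R -> X) (v : X) : Prop :=
  exists s : nat -> R -> X,
    [/\ forall n, bochner_simple D (s n),
        {ae mu, forall t : R, D t -> (fun n => s n t) @ \oo --> f t},
        (fun n => (\int[mu]_(t in D) (rnorm (f t - s n t))%:E)%E) @ \oo
          --> 0%E &
        (fun n => simple_integral D (s n)) @ \oo --> v].

(* The value is 0 when f is not Bochner integrable on D. *)
Definition bochner (D : set R) (f : R -> X) : X := xget 0 (is_bochner D f).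

End Bochner.

Section FunctionSpaces.
Context {R : realType} {X : completeNormedModType R[i]}.

(* Functions on the half-line are represented by their extensions by 0. *)
Definition BC (g : R -> X) : Prop :=
  [/\ {within Rplus, continuous g},
      exists M : R, forall t : R, 0 <= t -> rnorm (g t) <= M &
      forall t : R, t < 0 -> g t = 0].

Definition C0 (g : R -> X) : Prop := BC g /\ g t @[t --> +oo] --> (0 : X).

Definition bounded_operator (B : {linear X -> X}) : Prop :=
  exists M : R, forall x, rnorm (B x) <= M * rnorm x.

Record condition_Fpp (F : set (R -> X)) : Prop := ConditionFpp {
  Fpp_BC : F `<=` BC ;
  Fpp_zero : F (fun=> 0) ;
  Fpp_linear : forall (a : R[i]) g h, F g -> F h ->
    F (fun t => a *: g t + h t) ;
  (* F is closed in BC for the sup norm *)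
  Fpp_closed : forall h, BC h ->
    (forall e : R, 0 < e ->
       exists2 g, F g & forall t : R, 0 <= t -> rnorm (h t - g t) <= e) ->
    F h ;
  Fpp_C0 : C0 `<=` F ;
  Fpp_mod : forall g (xi : R), F g -> F (fun t : R => cexp ('i%C * xi%:C * t%:C) *: g t) ;
  Fpp_exp_right : forall h (lambda : R[i]), F h -> 0 < complex.Re lambda ->
    F (ext0 Rplus (fun t =>
      bochner `[t, +oo[ (fun s => cexp (lambda * (t - s)%:C) *: h s))) ;
  Fpp_exp_left : forall h (eta : R[i]), F h -> complex.Re eta < 0 ->
    F (ext0 Rplus (fun t =>
      bochner `[0, t] (fun s => cexp (eta * (t - s)%:C) *: h s))) ;
  Fpp_op : forall (B : {linear X -> X}) g, bounded_operator B -> F g ->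
    F (fun t => B (g t)) ;
  Fpp_conv : forall (psi : R -> R[i]) g, L1 Rminus psi -> F g ->
    F (ext0 Rplus (fun t =>
      bochner `[t, +oo[ (fun s => psi (t - s) *: g s)))
}.

End FunctionSpaces.

Section Operators.
Context {R : realType} {X : completeNormedModType R[i]}.

(* An unbounded operator is given by its domain D and a function A on X of which
   only the values on D are relevant. *)
Record closed_linear_operator (D : set X) (A : X -> X) : Prop :=
  ClosedLinearOperator {
  clo_dom0 : D 0 ;
  clo_domP : forall (a : R[i]) x y, D x -> D y -> D (a *: x + y) ;
  clo_linear : forall (a : R[i]) x y, D x -> D y ->
    A (a *: x + y) = a *: A x + A y ;
  clo_closed : closed [set p : X * X | D p.1 /\ p.2 = A p.1]
}.

Definition resolvent_set (D : set X) (A : X -> X) : set R[i] :=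
  [set lambda | exists B : {linear X -> X},
    [/\ bounded_operator B,
        forall x, D (B x) /\ lambda *: B x - A (B x) = x &
        forall x, D x -> B (lambda *: x - A x) = x]].

Definition spectrum (D : set X) (A : X -> X) : set R[i] :=
  ~` resolvent_set D A.

Definition real_i_spectrum (D : set X) (A : X -> X) : set R :=
  [set xi | exists2 lambda, spectrum D A lambda & 'i%C * lambda = xi%:C].

Definition mild_solution (D : set X) (A : X -> X) (f u : R -> X) : Prop :=
  {within Rplus, continuous u} /\
  forall t : R, 0 <= t ->
    D (bochner `[0, t] u) /\
    u t - u 0 = A (bochner `[0, t] u) + bochner `[0, t] f.

End Operators.

(* Main.v *)
(** Write [avg a h t] for the integral of [a s *: h (t + s)] over the line.
    Conditions (iii) and (v) together with closedness show that averaging by any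
    integrable kernel preserves membership in [F].

    Let [xi] be outside [i sigma(A)], let [B] be the resolvent at [- i xi], and let
    [v t = e^(i xi t) u t], [k t = e^(i xi t) f t].  Then the mean of [v] over [[t, t + 1]]
    plus [B (v (t + 1) - v t)] equals the mean of [B k], a function of [F].  If [x] is an
    average of [v] with frequencies in [[-r, r]], then [x = avg (vallee r) x] and, for [r]
    small, [x] is slowly varying, so [x] minus its unit mean minus [B (x (t + 1) - x t)] is a
    contraction of [x]; summing the geometric series inside [F] gives that [x] is in [F].

    Let the Fourier transform of [g] vanish on an open set containing the real points of
    [i sigma(A)], and let [w] be the average of [u] by [g].  Near a frequency in that open set
    [w] has no component; near any other frequency its component is in [F] by the above.
    The Fejer kernel of width [N d] is a finite combination of modulations of the one of
    width [d], so by compactness of [[-M, M]] all Fejer means of [w] are in [F], and they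
    converge uniformly to [w].  Spectral synthesis then passes from [g] to [phi]. *)
Require Import Defs.
From HB Require Import structures.
From mathcomp Require Import all_boot all_order all_algebra.
From mathcomp Require Import all_classical all_reals all_analysis.
From mathcomp Require Import measurable_realfun complex ring lra.

Set Implicit Arguments.
Unset Strict Implicit.
Unset Printing Implicit Defensive.

Import Order.TTheory GRing.Theory Num.Theory.
Import numFieldNormedType.Exports.

Local Open Scope classical_set_scope.
Local Open Scope ring_scope.
Local Open Scope complex_scope.

(** * Affine substitutions and real integrals *)

(** The sign: a component e^(i omega t) of [u] is multiplied in w by the transform of phi at -
    omega, so a zero of that transform at xi concerns the frequency - xi, which the factor e^(i xi
    t) moves to 0. Formally v = e^(i xi t) u satisfies v' = (A + i xi) v + k, and B = (- i xi -
    A)^-1 turns this into B v' = - v + B k; integrated over a unit interval, it involves no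
    derivative of v.

    The obstacle is that [u] is merely bounded, with values in an arbitrary Banach space, and is not
    known to lie in F. Spectral statements are therefore made about integrable kernels and never
    about functions: a component of [u] is an average of [u] by a modulated Fejer kernel. A kernel
    acts on such a component through its transform on a band, and two constant values occur: 1,
    which makes the component an average of itself and so slowly varying, and 0, which kills it.

    Vector identities are tested on real functionals, which reduces them to Fubini and substitution
    for real integrals. *)

Section Affine.
Context {R : realType}.
Notation mu := (@lebesgue_measure R).

Lemma measurable_affine (c d : R) : measurable_fun setT (fun x : R => c * x + d).
Proof.
apply: measurable_funD; last exact: measurable_cst.
exact: measurable_funM.
Qed.

(** For negative [c] the preimage of a half-open interval is closed at the other end. The end flags
    are existential because the length does not depend on them. *)
Lemma affine_preimage_ocitv (c d a b : R) : c != 0 ->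
  exists b0 b1 : bool, exists a' b' : R,
   [set x | `]a, b]%classic (c * x + d)] = [set` Interval (BSide b0 a') (BSide b1 b')]
   /\ `|c| * (b' - a') = b - a.
Proof.
move=> c0; have [cp|cn] := ltP 0 c.
  exists false, false, ((a - d) / c), ((b - d) / c); split.
    apply/seteqP; split=> x /=; rewrite !in_itv /= ltr_pdivrMr // ler_pdivlMr //;
      rewrite ltrBlDr lerBrDr mulrC //.
  rewrite gtr0_norm //; field; exact: c0.
have {}cn : c < 0 by rewrite lt_neqAle c0.
exists true, true, ((b - d) / c), ((a - d) / c); split.
  apply/seteqP; split=> x /=; rewrite !in_itv /= ltr_ndivlMr // ler_ndivrMr //;
    rewrite ltrBlDr lerBrDr mulrC andbC //.
rewrite ltr0_norm //; field; exact: c0.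
Qed.

(** The pushforward of Lebesgue measure under the affine map, scaled by |c|, agrees with Lebesgue
    measure on half-open intervals, hence everywhere by uniqueness. *)
Lemma lebesgue_measure_affine (c d : R) (A : set R) : c != 0 -> measurable A ->
  (`|c|%:E * mu [set x | A (c * x + d)%R])%E = mu A.
Proof.
move=> c0 mA.
have r0 : 0 <= `|c| by [].
pose phi : measurableTypeR R -> measurableTypeR R := fun x => c * x + d.
have mphi : measurable_fun [set: measurableTypeR R] phi by exact: measurable_affine.
pose nu : measure _ _ := mscale (NngNum r0) (pushforward mu phi).
have nuE B : nu mphi B = (`|c|%:E * mu [set x | B (c * x + d)%R])%E by [].
rewrite -nuE; apply/esym.
apply: (@lebesgue_measure_unique R (nu mphi)) => // _ [[a b] /= _ <-].
rewrite nuE.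
have [b0 [b1 [a' [b' [-> E]]]]] := affine_preimage_ocitv d a b c0.
rewrite !lebesgue_measure_itv /= !lte_fin.
have cp : 0 < `|c| by rewrite normr_gt0.
have -> : (a' < b') = (a < b).
  by rewrite -subr_gt0 -(subr_gt0 a) -E pmulr_rgt0.
by case: (a < b); rewrite ?mule0 // -!EFinB -EFinM E.
Qed.

Lemma ge0_integral_affine (c d : R) (f : R -> \bar R) : c != 0 ->
  measurable_fun setT f -> (forall x, 0 <= f x)%E ->
  (`|c|%:E * \int[mu]_x f (c * x + d)%R)%E = (\int[mu]_x f x)%E.
Proof.
move=> c0 mf f0.
have r0 : 0 <= `|c| by [].
pose phi : measurableTypeR R -> measurableTypeR R := fun x => c * x + d.
have mphi : measurable_fun [set: measurableTypeR R] phi by exact: measurable_affine.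
pose nu : measure _ _ := mscale (NngNum r0) (pushforward mu phi).
transitivity (\int[nu mphi]_x f x)%E.
  by rewrite ge0_integral_mscale //= ge0_integral_pushforward.
apply: eq_measure_integral => /= A mA _.
exact: (lebesgue_measure_affine d c0 mA).
Qed.

Lemma integrable_affine (c d : R) (f : R -> R) : c != 0 ->
  mu.-integrable setT (EFin \o f) ->
  mu.-integrable setT (EFin \o (fun x => f (c * x + d))).
Proof.
move=> c0 /integrableP[/measurable_EFinP mf fo]; apply/integrableP; split.
  apply/measurable_EFinP; apply: measurableT_comp => //; exact: measurable_affine.
move: fo; rewrite -(@ge0_integral_affine c d _ c0) //; last first.
  by do 2 apply: measurableT_comp => //.
move=> /= h; rewrite ltNge leye_eq; apply/negP => /eqP e.
by move: h; rewrite e gt0_muley ?ltxx // lte_fin normr_gt0.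
Qed.

Lemma Rintegral_affine (c d : R) (f : R -> R) : c != 0 ->
  mu.-integrable setT (EFin \o f) ->
  `|c| * \int[mu]_x f (c * x + d) = \int[mu]_x f x.
Proof.
move=> c0 fi.
have fi' := integrable_affine d c0 fi.
have mf : measurable_fun setT (EFin \o f) by case/integrableP: fi.
rewrite /Rintegral.
have -> := integralE mu setT (fun x => (f x)%:E).
have -> := integralE mu setT (fun x => (f (c * x + d))%:E).
have h1 := integrable_pos_fin_num measurableT fi.
have h2 := integrable_neg_fin_num measurableT fi.
have h3 := integrable_pos_fin_num measurableT fi'.
have h4 := integrable_neg_fin_num measurableT fi'.
rewrite (fineB h1 h2) (fineB h3 h4) mulrBr.
rewrite -[X in X * _ - _]/(fine `|c|%:E) -[X in _ - X * _]/(fine `|c|%:E) -!fineM //.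
congr (fine _ - fine _).
  transitivity (`|c|%:E * \int[mu]_x (EFin \o f)^\+%E (c * x + d)%R)%E.
  by congr (_ * _)%E; apply: eq_integral => x _; rewrite !funeposE.
  by rewrite ge0_integral_affine //; exact: measurable_funepos.
transitivity (`|c|%:E * \int[mu]_x (EFin \o f)^\-%E (c * x + d)%R)%E.
  by congr (_ * _)%E; apply: eq_integral => x _; rewrite !funenegE.
by rewrite ge0_integral_affine //; exact: measurable_funeneg.
Qed.

Lemma Rintegral_translate (d : R) (f : R -> R) :
  mu.-integrable setT (EFin \o f) -> \int[mu]_x f (x + d) = \int[mu]_x f x.
Proof.
move=> fi; rewrite -(Rintegral_affine d (oner_neq0 R) fi) normr1 mul1r.
by apply: eq_Rintegral => x _; rewrite mul1r.
Qed.

Lemma integrable_translate (d : R) (f : R -> R) :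
  mu.-integrable setT (EFin \o f) ->
  mu.-integrable setT (EFin \o (fun x => f (x + d))).
Proof.
move=> /(integrable_affine d (oner_neq0 R)); apply: eq_integrable => //.
by move=> x _ /=; rewrite mul1r.
Qed.

Lemma Rintegral_opp (d : R) (f : R -> R) :
  mu.-integrable setT (EFin \o f) -> \int[mu]_x f (d - x) = \int[mu]_x f x.
Proof.
move=> fi; have n0 : (-1 : R) != 0 by rewrite oppr_eq0 oner_neq0.
rewrite -(Rintegral_affine d n0 fi) normrN1 mul1r.
by apply: eq_Rintegral => x _; rewrite mulN1r addrC.
Qed.

Lemma integrable_opp (d : R) (f : R -> R) :
  mu.-integrable setT (EFin \o f) ->
  mu.-integrable setT (EFin \o (fun x => f (d - x))).
Proof.
have n0 : (-1 : R) != 0 by rewrite oppr_eq0 oner_neq0.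
move=> /(integrable_affine d n0); apply: eq_integrable => //.
by move=> x _ /=; rewrite mulN1r addrC.
Qed.

End Affine.

Section RealIntegral.
Context {R : realType}.
Notation mu := (@lebesgue_measure R).

Implicit Types a b g : R -> R.

Definition integrableR (a : R -> R) := mu.-integrable setT (EFin \o a).
Definition norm1 (a : R -> R) : R := \int[mu]_x `|a x|.

Lemma integrableR_measurable a : integrableR a -> measurable_fun setT a.
Proof. by move=> /integrableP[/measurable_EFinP]. Qed.

Lemma integrableR_norm a : integrableR a -> integrableR (fun x => `|a x|).
Proof. exact: integrable_norm. Qed.

Lemma integrableR_le a b : measurable_fun setT a -> integrableR b ->
  (forall x, `|a x| <= b x) -> integrableR a.
Proof.
move=> ma ib ab; apply: (le_integrable measurableT _ _ ib).
  exact/measurable_EFinP.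
by move=> x _ /=; rewrite lee_fin (le_trans (ab x))// ler_norm.
Qed.

Lemma integrableRD a b : integrableR a -> integrableR b ->
  integrableR (fun x => a x + b x).
Proof. by move=> ia ib; apply: (integrableD measurableT ia ib). Qed.

Lemma integrableRZ (k : R) a : integrableR a -> integrableR (fun x => k * a x).
Proof. by move=> ia; apply: (integrableZl measurableT _ ia). Qed.

Lemma integrableRN a : integrableR a -> integrableR (fun x => - a x).
Proof. by move=> ia; apply: (integrableN ia). Qed.

Lemma integrableRB a b : integrableR a -> integrableR b ->
  integrableR (fun x => a x - b x).
Proof. by move=> ia ib; apply: integrableRD => //; exact: integrableRN. Qed.

Lemma integrableRM a b (M : R) : integrableR a -> measurable_fun setT b ->
  (forall x, `|b x| <= M) -> integrableR (fun x => a x * b x).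
Proof.
move=> ia mb bM; apply: (@integrableR_le _ (fun x => M * `|a x|)).
- by apply: measurable_funM => //; exact: integrableR_measurable.
- exact/integrableRZ/integrableR_norm.
- by move=> x; rewrite normrM mulrC ler_wpM2r.
Qed.

Lemma integrableR_restrict a (D : set R) : measurable D -> integrableR a ->
  integrableR (a \_ D).
Proof.
move=> mD ia; apply: (@integrableR_le _ (fun x => `|a x|)).
- apply/(measurable_restrictT _ mD).
  by apply: measurable_funTS; exact: integrableR_measurable.
- exact: integrableR_norm.
- by move=> x; rewrite patchE; case: ifP => // _; rewrite normr0.
Qed.

Lemma RintD a b : integrableR a -> integrableR b ->
  \int[mu]_x (a x + b x) = \int[mu]_x a x + \int[mu]_x b x.
Proof. by move=> ia ib; exact: RintegralD. Qed.

Lemma RintB a b : integrableR a -> integrableR b ->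
  \int[mu]_x (a x - b x) = \int[mu]_x a x - \int[mu]_x b x.
Proof. by move=> ia ib; exact: RintegralB. Qed.

Lemma RintZ k a : integrableR a -> \int[mu]_x (k * a x) = k * \int[mu]_x a x.
Proof. by move=> ia; exact: RintegralZl. Qed.

Lemma Rint_le a b : integrableR a -> integrableR b -> (forall x, a x <= b x) ->
  \int[mu]_x a x <= \int[mu]_x b x.
Proof. by move=> ia ib h; exact: le_Rintegral. Qed.

Lemma Rint_norm_le a : integrableR a -> `|\int[mu]_x a x| <= norm1 a.
Proof. by move=> ia; exact: le_normr_Rintegral. Qed.

Lemma norm1_ge0 a : 0 <= norm1 a.
Proof. by apply: Rintegral_ge0. Qed.

Lemma norm1D a b : integrableR a -> integrableR b ->
  norm1 (fun x => a x + b x) <= norm1 a + norm1 b.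
Proof.
move=> ia ib; rewrite /norm1 -RintD; try exact: integrableR_norm.
apply: Rint_le; first exact/integrableR_norm/integrableRD.
  by apply: integrableRD; exact: integrableR_norm.
by move=> x; exact: ler_normD.
Qed.

Lemma integral_EFinR a : integrableR a ->
  (\int[mu]_x (a x)%:E)%E = (\int[mu]_x a x)%:E.
Proof.
move=> ia; rewrite /Rintegral fineK //.
exact: (integrable_fin_num measurableT ia).
Qed.

Lemma norm1_EFin a : integrableR a -> (\int[mu]_x `|(a x)%:E|)%E = (norm1 a)%:E.
Proof. by move=> ia; rewrite -integral_EFinR //; exact: integrableR_norm. Qed.

Lemma integrableR_indic (A : set R) : measurable A -> (mu A < +oo)%E -> integrableR \1_A.
Proof.
move=> mA Ao; apply/integrableP; split; first exact/measurable_EFinP.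
under eq_integral => t _.
  rewrite /= ger0_norm; last by rewrite indicE.
  over.
by rewrite integral_indic// setIT.
Qed.

Lemma Rint_indic (A : set R) : measurable A -> \int[mu]_x \1_A x = fine (mu A).
Proof. by move=> mA; rewrite /Rintegral integral_indic //= setIT. Qed.

Lemma Rint_sum (I : Type) (s : seq I) (f : I -> R -> R) :
  (forall i, integrableR (f i)) ->
  integrableR (fun x => \sum_(i <- s) f i x) /\
  \int[mu]_x (\sum_(i <- s) f i x) = \sum_(i <- s) \int[mu]_x f i x.
Proof.
move=> fi; elim: s => [|i s [IH1 IH2]].
  under eq_fun do rewrite big_nil.
  split; last by rewrite big_nil Rintegral_cst // mul0r.
  exact: integrable0.
under eq_fun do rewrite big_cons.
split; first exact: integrableRD.
by rewrite big_cons RintD // IH2.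
Qed.

Lemma Rint_dominated (a_ : nat -> R -> R) a g :
  (forall n, measurable_fun setT (a_ n)) -> measurable_fun setT a ->
  {ae mu, forall x, a_ ^~ x @ \oo --> a x} ->
  integrableR g -> (forall n x, `|a_ n x| <= g x) ->
  [/\ integrableR a, (fun n => norm1 (fun x => a_ n x - a x)) @ \oo --> (0 : R) &
   (fun n => \int[mu]_x a_ n x) @ \oo --> \int[mu]_x a x].
Proof.
move=> ma_ ma cv ig ag.
have ema_ n : measurable_fun setT (EFin \o a_ n) by exact/measurable_EFinP.
have ema : measurable_fun setT (EFin \o a) by exact/measurable_EFinP.
have [] := @dominated_convergence _ _ _ mu setT measurableT
   (fun n => EFin \o a_ n) (EFin \o a) (EFin \o g) _ _ _ ig.
- exact: ema_.
- exact: ema.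
- case: cv => N [mN N0 sub]; exists N; split => // x /= h; apply: sub => /= cx.
  by apply: h => _; apply/fine_cvgP; split; [exact: nearW|exact: cx].
- by apply: aeW => x n _; rewrite /= lee_fin.
move=> ia c1 c2; split => //.
- exact: (fine_cvg c1).
- by rewrite integral_EFinR // in c2; exact: (fine_cvg c2).
Qed.

(** The integrable bound [g] on the inner L1 norms gives integrability on the product by Tonelli.
    Integrability of both partial integrals is recorded because they are later added and
    compared. *)
Lemma Rint_fubini (f : R * R -> R) (g : R -> R) : measurable_fun setT f ->
  (forall x, integrableR (fun y => f (x, y))) ->
  (forall y, integrableR (fun x => f (x, y))) ->
  integrableR g -> (forall x, norm1 (fun y => f (x, y)) <= g x) ->
  [/\ \int[mu]_x \int[mu]_y f (x, y) = \int[mu]_y \int[mu]_x f (x, y),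
  integrableR (fun x => \int[mu]_y f (x, y)) &
  integrableR (fun y => \int[mu]_x f (x, y))].
Proof.
move=> mf i1 i2 ig fg.
have mF : measurable_fun setT (EFin \o f) by exact/measurable_EFinP.
have ifF : (mu \x mu)%E.-integrable setT (EFin \o f).
  apply/integrable12ltyP => //.
  apply: (@le_lt_trans _ _ (\int[mu]_x `|(g x)%:E|)%E); last first.
    by case/integrableP: ig.
  apply: ge0_le_integral => //.
  - by move=> x _; apply: integral_ge0.
  - apply: (@measurable_fun_fubini_tonelli_F _ _ _ _ _ mu (fun z => `|(EFin \o f) z|%E)) => //.
    exact: measurableT_comp.
  - by apply: measurableT_comp => //; case/integrableP: ig.
  - move=> x _ /=; rewrite (norm1_EFin (i1 x)) lee_fin.
    by rewrite (le_trans (fg x)) // ler_norm.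
have e1 : (fun x => (\int[mu]_y f (x, y))%:E) = (fun x => (\int[mu]_y (f (x, y))%:E)%E).
  by apply/funext => x; rewrite integral_EFinR.
have e2 : (fun y => (\int[mu]_x f (x, y))%:E) = (fun y => (\int[mu]_x (f (x, y))%:E)%E).
  by apply/funext => y; rewrite integral_EFinR.
split.
- have := Fubini ifF => /= E.
  rewrite /Rintegral -/(Rintegral _ _ _).
  congr fine.
  transitivity (\int[mu]_x \int[mu]_y (f (x, y))%:E)%E; first by congr (integral _ _ _).
  by rewrite E; congr (integral _ _ _).
- rewrite /integrableR /comp e1; exact: (integrable_fubini_F ifF).
- rewrite /integrableR /comp e2; apply/integrableP; split.
    exact: (measurable_fubini_G ifF).
  apply: (@le_lt_trans _ _ (\int[mu]_y \int[mu]_x `|(EFin \o f) (x, y)|)%E);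
    last by have [/(_ ifF)] := @integrable21ltyP _ _ _ _ R mu mu _ mF.
  apply: ge0_le_integral => //.
  + by apply: measurableT_comp => //; exact: (measurable_fubini_G ifF).
  + apply: (@measurable_fun_fubini_tonelli_G _ _ _ _ _ mu (fun z => `|(EFin \o f) z|%E)) => //.
    exact: measurableT_comp.
  + move=> y _ /=; apply: le_abse_integral => //.
    by case/integrableP: (i2 y).
Qed.

End RealIntegral.

(** * The Fejer kernel *)

Section Fejer.
Context {R : realType}.
Notation mu := (@lebesgue_measure R).
Implicit Types (x t d r xi theta : R) (N : nat).

Lemma sin_mvt (z : R) : exists2 c : R, `|c| <= `|z| & sin z = cos c * z.
Proof.
have cs (A : set R) : {within A, continuous (@sin R)}.
  by apply: continuous_subspaceT => x; exact: continuous_sin.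
have [z0|z0] := leP 0 z.
  have [c ci] := MVT_segment z0 (fun x _ => is_derive_sin x) (cs _).
  rewrite sin0 !subr0 => e; exists c => //.
  by move: ci; rewrite in_itv /= => /andP[c0 cz]; rewrite !ger0_norm.
have [c ci] := MVT_segment (ltW z0) (fun x _ => is_derive_sin x) (cs _).
rewrite sin0 !sub0r mulrN => /oppr_inj e; exists c => //.
move: ci; rewrite in_itv /= => /andP[cz c0]; rewrite !ler0_norm ?lerN2 //.
exact: ltW.
Qed.

Lemma oneBcos (y : R) : 1 - cos y = 2 * sin (y / 2) ^+ 2.
Proof.
have {1}-> : y = (y / 2) *+ 2 by rewrite mulr2n -splitr.
by rewrite cos_mulr2n sin2cos2; ring.
Qed.

(** An identity with an intermediate point carries more than an inequality: it gives a lower bound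
    for cos and also the limit of (1 - cos y) / y^2 at 0, on which [cvg_fejer_sum] rests. *)
Lemma oneBcos_mvt (y : R) :
  exists2 c : R, `|c| <= `|y| / 2 & 1 - cos y = cos c ^+ 2 * (y ^+ 2 / 2).
Proof.
have [c cy e] := sin_mvt (y / 2); exists c.
  by rewrite (le_trans cy)// normrM [X in _ * X]ger0_norm.
by rewrite oneBcos e; field.
Qed.

Lemma cos_ge (y : R) : 1 - y ^+ 2 / 2 <= cos y.
Proof.
have [c _ e] := oneBcos_mvt y.
have := cos2sin2 c; have := sqr_ge0 (sin c); have := sqr_ge0 y; move: e.
by nra.
Qed.

Lemma oneBcos_le (y : R) : 1 - cos y <= y ^+ 2 / 2.
Proof. by have := cos_ge y; lra. Qed.

Definition fejerQ (a t : R) : R :=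
  if t == 0 then a ^+ 2 / 2 else (1 - cos (a * t)) / t ^+ 2.

(** The Fejer kernel without normalisation: on [-d, d] its transform is the triangle [fejerC] (1 -
    |xi| / d), so its mass is [fejerC] for every width. The value of [fejerC] is pi; it enters only
    as a positive constant. *)
Definition fejer d t : R := fejerQ d t / d.

Lemma fejerQ_sqr (a t : R) : fejerQ a t * t ^+ 2 = 1 - cos (a * t).
Proof.
rewrite /fejerQ; case: eqP => [->|/eqP t0].
  by rewrite expr0n /= !mulr0 cos0 subrr.
by rewrite divfK // expf_neq0.
Qed.

Lemma fejerQ_ge0 (a t : R) : 0 <= fejerQ a t.
Proof.
rewrite /fejerQ; case: eqP => _; first by rewrite divr_ge0 // sqr_ge0.
by rewrite divr_ge0 ?sqr_ge0 // subr_ge0 cos_le1.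
Qed.

Lemma fejerQ_le (a t : R) : fejerQ a t <= a ^+ 2 / 2.
Proof.
rewrite /fejerQ; case: eqP => // /eqP t0.
rewrite ler_pdivrMr ?exprn_even_gt0 //.
by rewrite (le_trans (oneBcos_le _)) // exprMn mulrAC.
Qed.

(** The constant adds two bounds: a^2 / 2 for [fejerQ a t] itself and 2 for its product with t^2. *)
Lemma fejerQ_leV (a t : R) : fejerQ a t <= (a ^+ 2 / 2 + 2) * (1 + t ^+ 2)^-1.
Proof.
have p : 0 < 1 + t ^+ 2 by have := sqr_ge0 t; lra.
rewrite ler_pdivlMr // mulrDr mulr1 fejerQ_sqr.
by have := fejerQ_le a t; have := cos_geN1 (a * t); lra.
Qed.

Lemma measurable_invr : measurable_fun setT (fun y : R => y^-1).
Proof.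
rewrite -(setUv [set (0 : R)]); apply/measurable_funU => //.
  exact: measurableC.
split; first exact: measurable_fun_set1.
apply: open_continuous_measurable_fun; first
    exact/closed_openC/accessible_closed_set1/hausdorff_accessible/Rhausdorff.
by move=> y /[!inE] /= /eqP y0; exact: inv_continuous.
Qed.

Lemma measurable_fejerQ (a : R) : measurable_fun setT (fejerQ a).
Proof.
apply: measurable_fun_ifT => //.
  by apply: measurable_fun_eqr => //; exact: measurable_cst.
apply: measurable_funM.
  apply: measurable_funB => //.
  apply: measurableT_comp; last exact: measurable_funM.
  by apply: continuous_measurable_fun; exact: continuous_cos.
apply: (@measurableT_comp _ _ _ _ _ _ (fun y : R => y^-1)) => //.
exact: measurable_invr.
Qed.

Lemma integrable_oneDsqrV : integrableR (fun t : R => (1 + t ^+ 2)^-1).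
Proof.
set g := (X in integrableR X).
have mg : measurable_fun setT g.
  by apply: continuous_measurable_fun; exact: continuous_oneDsqrV.
have g0 t : 0 <= g t by rewrite invr_ge0; have := sqr_ge0 t; lra.
have mI : measurable `[0 : R, +oo[ by [].
pose h : R -> R := g \_ `[0, +oo[.
have mh : measurable_fun setT h.
  by apply/(measurable_restrictT _ mI); exact: measurable_funTS.
have ih : integrableR h.
  apply/integrableP; split; first exact/measurable_EFinP.
  under eq_integral => x _.
    rewrite /= ger0_norm; last by rewrite /h patchE; case: ifP.
    rewrite /h.
    over.
  have -> : (\int[mu]_x ((g \_ `[0%R, +oo[) x)%:E)%E = (\int[mu]_(x in `[0%R, +oo[) (g x)%:E)%E.
    rewrite [RHS]integral_mkcond; apply: eq_integral => x _.
    by rewrite /= !patchE; case: ifP.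
  by rewrite integral0y_oneDsqr ltry.
(* An even function is dominated by its restriction to the half-line plus the reflection of that
   restriction. *)
apply: (@integrableR_le _ _ (fun t => h t + h (0 - t))) => //.
  by apply: integrableRD => //; exact: integrable_opp.
move=> t; rewrite ger0_norm // sub0r /h !patchE.
have [t0|t0] := leP 0 t.
  rewrite ifT; last by rewrite inE /= in_itv /= t0.
  by rewrite lerDl; case: ifP.
rewrite [X in _ <= X + _]ifF; last first.
  by apply/negP; rewrite inE /= in_itv /= andbT leNgt t0.
rewrite ifT ?add0r; last by rewrite inE /= in_itv /= andbT oppr_ge0 ltW.
by rewrite /g sqrrN.
Qed.

Lemma integrable_fejerQ (a : R) : integrableR (fejerQ a).
Proof.
apply: (@integrableR_le _ _ (fun t => (a ^+ 2 / 2 + 2) * (1 + t ^+ 2)^-1)).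
- exact: measurable_fejerQ.
- exact/integrableRZ/integrable_oneDsqrV.
- by move=> t; rewrite ger0_norm ?fejerQ_ge0 // fejerQ_leV.
Qed.

Definition fejerC : R := \int[mu]_t fejerQ 1 t.

Lemma fejerC_gt0 : 0 < fejerC.
Proof.
(* For t in [0, 1] the intermediate point satisfies |c| <= 1/2, so cos c >= 7/8 and (1 - cos t) /
   t^2 = cos^2 c / 2 >= 49/128. *)
pose h : R -> R := fun t => 49 / 128 * \1_(`[0, 1]%classic) t.
have ih : integrableR h.
  apply: integrableRZ; have := @integrable_indic_itv R 0 1 true false.
  by apply.
apply: (@lt_le_trans _ _ (\int[mu]_t h t)).
  rewrite /h RintZ; last by have := @integrable_indic_itv R 0 1 true false; apply.
  apply: mulr_gt0; first by lra.
  rewrite /Rintegral integral_indic //= setIT lebesgue_measure_itv /= lte_fin ltr01.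
  by rewrite oppr0 adde0.
apply: Rint_le => //; first exact: integrable_fejerQ.
move=> t; rewrite /h indicE; case: (boolP (t \in _)); last by rewrite mulr0 fejerQ_ge0.
rewrite inE /= in_itv /= => /andP[t0 t1]; rewrite mulr1.
rewrite /fejerQ; case: eqP => [_|/eqP tn0]; first by rewrite expr1n; lra.
rewrite mul1r ler_pdivlMr ?exprn_even_gt0 //.
have [c ct ->] := oneBcos_mvt t.
rewrite (ger0_norm t0) in ct.
have c1 : c ^+ 2 <= 1 / 4 by have := real_normK (num_real c); have := normr_ge0 c; nra.
have c2 : 7 / 8 <= cos c by have := cos_ge c; lra.
have c3 : 49 / 64 <= cos c ^+ 2 by nra.
by have := sqr_ge0 t; nra.
Qed.

(** Scaling: [fejerQ a t] is a^2 times [fejerQ 1] at a t, and the substitution divides by |a|. This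
    absolute value is the origin of the triangle. *)
Lemma Rint_fejerQ (a : R) : \int[mu]_t fejerQ a t = fejerC * `|a|.
Proof.
have [->|a0] := eqVneq a 0.
  rewrite normr0 mulr0; under eq_Rintegral => t _.
    have -> : fejerQ 0 t = 0.
      by rewrite /fejerQ mul0r cos0 subrr mul0r expr0n mul0r; case: ifP.
    over.
  by rewrite Rintegral_cst // mul0r.
rewrite /fejerC -(Rintegral_affine 0 a0 (integrable_fejerQ 1)).
rewrite mulrAC -expr2 real_normK ?num_real // -RintZ; last first.
  exact: (integrable_affine 0 a0 (integrable_fejerQ 1)).
apply: eq_Rintegral => t _; rewrite addr0 /fejerQ mulf_eq0 (negbTE a0) /= mul1r.
case: eqP => [_|/eqP t0]; first by rewrite expr1n; field.
by field; rewrite a0 t0.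
Qed.

(** Multiplying by a cosine is a second difference in the frequency [a] of [fejerQ]. With
    [Rint_fejerQ], the transform of the kernel becomes a second difference of the absolute value. *)
Lemma fejerQ_cos xi d t :
  cos (xi * t) * fejerQ d t = (fejerQ (xi + d) t + fejerQ (xi - d) t) / 2 - fejerQ xi t.
Proof.
rewrite /fejerQ; case: eqP => [->|/eqP t0]; first by rewrite mulr0 cos0; field.
by rewrite [(xi + d) * t]mulrDl [(xi - d) * t]mulrBl cosD cosB; field.
Qed.

Lemma integrableR_fejer d : integrableR (fejer d).
Proof.
have := integrableRZ d^-1 (integrable_fejerQ d).
by congr (integrableR _); apply/funext => t; rewrite mulrC.
Qed.

Lemma fejer_ge0 d t : 0 <= d -> 0 <= fejer d t.
Proof. by move=> d0; rewrite divr_ge0 // fejerQ_ge0. Qed.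

Lemma Rint_fejer_cos xi d : 0 < d -> `|xi| <= d ->
  \int[mu]_t (fejer d t * cos (xi * t)) = fejerC * (1 - `|xi| / d).
Proof.
move=> d0 xd.
transitivity (\int[mu]_t (d^-1 * ((2^-1 * (fejerQ (xi + d) t + fejerQ (xi - d) t)) - fejerQ xi t))).
  by apply: eq_Rintegral => t _; rewrite [2^-1 * _]mulrC -fejerQ_cos /fejer; ring.
have i1 := integrable_fejerQ (xi + d); have i2 := integrable_fejerQ (xi - d).
have i3 := integrable_fejerQ xi.
have i12 : integrableR (fun t => 2^-1 * (fejerQ (xi + d) t + fejerQ (xi - d) t)).
  exact/integrableRZ/integrableRD.
rewrite RintZ; last exact: integrableRB.
rewrite RintB // RintZ; last exact: integrableRD.
rewrite RintD // !Rint_fejerQ.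
move: xd; rewrite ler_norml => /andP[x1 x2].
rewrite (@ger0_norm _ (xi + d)) ?(@ler0_norm _ (xi - d)); [|lra..].
by field; rewrite gt_eqF.
Qed.

Lemma fejer_even d t : fejer d (- t) = fejer d t.
Proof. by rewrite /fejer /fejerQ oppr_eq0 mulrN cosN sqrrN. Qed.

Lemma measurable_cos_lin xi : measurable_fun setT (fun t => cos (xi * t)).
Proof.
apply: measurableT_comp; last exact: measurable_funM.
by apply: continuous_measurable_fun; exact: continuous_cos.
Qed.

Lemma measurable_sin_lin xi : measurable_fun setT (fun t => sin (xi * t)).
Proof.
apply: measurableT_comp; last exact: measurable_funM.
by apply: continuous_measurable_fun; exact: continuous_sin.
Qed.

Lemma integrableR_cos (a : R -> R) xi : integrableR a ->
  integrableR (fun t => a t * cos (xi * t)).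
Proof.
move=> ia; apply: (integrableRM ia (measurable_cos_lin xi)) => t.
exact: cos_max.
Qed.

Lemma integrableR_sin (a : R -> R) xi : integrableR a ->
  integrableR (fun t => a t * sin (xi * t)).
Proof.
move=> ia; apply: (integrableRM ia (measurable_sin_lin xi)) => t.
exact: sin_max.
Qed.

Lemma Rint_fejer_sin xi d : \int[mu]_t (fejer d t * sin (xi * t)) = 0.
Proof.
have := Rintegral_opp 0 (integrableR_sin xi (integrableR_fejer d)).
under eq_Rintegral => t _ do rewrite sub0r fejer_even mulrN sinN mulrN.
rewrite -[X in _ = X -> _]opprK.
set I := \int[mu]_x (fejer _ _ * _).
have -> : \int[mu]_x - (fejer d x * sin (xi * x)) = - I.
  under eq_Rintegral => t _ do rewrite -mulN1r.
  by rewrite RintZ ?mulN1r //; exact/integrableR_sin/integrableR_fejer.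
lra.
Qed.

(** The de la Vallee-Poussin kernel: 2 (1 - |xi| / (2r)) - (1 - |xi| / r) = 1, so its transform is 1
    on [-r, r]. *)
Definition vallee r t : R := fejerC^-1 * (2 * fejer (2 * r) t - fejer r t).

Lemma integrableR_vallee r : integrableR (vallee r).
Proof.
apply: integrableRZ; apply: integrableRB; last exact: integrableR_fejer.
exact/integrableRZ/integrableR_fejer.
Qed.

Lemma Rint_vallee_cos r xi : 0 < r -> `|xi| <= r ->
  \int[mu]_t (vallee r t * cos (xi * t)) = 1.
Proof.
move=> r0 xr; have c0 := fejerC_gt0.
have i1 := integrableR_cos xi (integrableR_fejer (2 * r)).
have i2 := integrableR_cos xi (integrableR_fejer r).
transitivity (\int[mu]_t (fejerC^-1 * (2 * (fejer (2 * r) t * cos (xi * t))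
     - fejer r t * cos (xi * t)))).
  by apply: eq_Rintegral => t _; rewrite /vallee; ring.
rewrite RintZ; last by apply: integrableRB => //; exact: integrableRZ.
rewrite RintB //; last exact: integrableRZ.
rewrite RintZ // !Rint_fejer_cos //; [|lra..].
by field; rewrite !gt_eqF.
Qed.

Lemma Rint_vallee_sin r xi : \int[mu]_t (vallee r t * sin (xi * t)) = 0.
Proof.
have i1 := integrableR_sin xi (integrableR_fejer (2 * r)).
have i2 := integrableR_sin xi (integrableR_fejer r).
transitivity (\int[mu]_t (fejerC^-1 * (2 * (fejer (2 * r) t * sin (xi * t))
     - fejer r t * sin (xi * t)))).
  by apply: eq_Rintegral => t _; rewrite /vallee; ring.
rewrite RintZ; last by apply: integrableRB => //; exact: integrableRZ.
rewrite RintB //; last exact: integrableRZ.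
by rewrite RintZ // !Rint_fejer_sin mulr0 subrr mulr0.
Qed.

Lemma fejer_scale d t : 0 < d -> fejer d t = d * fejer 1 (d * t).
Proof.
move=> d0; rewrite /fejer /fejerQ mulf_eq0 (gt_eqF d0) /= mul1r.
case: eqP => [_|/eqP t0]; first by rewrite expr1n; field; rewrite gt_eqF.
by field; rewrite t0 gt_eqF.
Qed.

Lemma vallee_scale r t : 0 < r -> vallee r t = r * vallee 1 (r * t).
Proof.
move=> r0; rewrite /vallee fejer_scale ?mulr_gt0 // (fejer_scale t r0) mulr1.
rewrite (@fejer_scale 2) // -!mulrA; ring.
Qed.

(** Together with [dirichlet_im]: the real and imaginary parts of the geometric sum (1 - e^(ix))
    sum_(k < N) e^(ikx) = 1 - e^(iNx). *)
Lemma dirichlet_re N x :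
  (1 - cos x) * (\sum_(k < N) cos (k%:R * x)) + sin x * (\sum_(k < N) sin (k%:R * x))
  = 1 - cos (N%:R * x).
Proof.
elim: N => [|N IH]; first by rewrite !big_ord0 mul0r cos0 !mulr0 addr0 subrr.
rewrite !big_ord_recr /= -natr1 [(_ + 1) * x]mulrDl mul1r cosD.
move: IH; set C := \sum_(k < N) _; set S := \sum_(k < N) _ => IH.
by have := IH; nra.
Qed.

Lemma dirichlet_im N x :
  (1 - cos x) * (\sum_(k < N) sin (k%:R * x)) - sin x * (\sum_(k < N) cos (k%:R * x))
  = - sin (N%:R * x).
Proof.
elim: N => [|N IH]; first by rewrite !big_ord0 mul0r sin0 !mulr0 subrr oppr0.
rewrite !big_ord_recr /= -natr1 [(_ + 1) * x]mulrDl mul1r sinD.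
move: IH; set C := \sum_(k < N) sin _; set S := \sum_(k < N) cos _ => IH.
by have := IH; nra.
Qed.

(** The squared modulus of sum_(k < N) e^(ikx), expanded so that its frequencies, all of size less
    than N, are visible. *)
Definition trigsum N x : R := \sum_(k < N) \sum_(l < N) cos ((k%:R - l%:R) * x).

Lemma trigsumE N x : trigsum N x =
  (\sum_(k < N) cos (k%:R * x)) ^+ 2 + (\sum_(k < N) sin (k%:R * x)) ^+ 2.
Proof.
rewrite !expr2 !big_distrl /= -big_split /=; apply: eq_bigr => k _.
rewrite !big_distrr /= -big_split /=; apply: eq_bigr => l _.
by rewrite mulrBl cosB.
Qed.

(** The squared modulus of the geometric sum, because |1 - e^(ix)|^2 = 2 (1 - cos x). *)
Lemma trigsum_fejer N x : (1 - cos x) * trigsum N x = 1 - cos (N%:R * x).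
Proof.
have [c1|c1] := eqVneq (1 - cos x) 0.
  have s0 : sin x = 0 by apply: cos1sin0; rewrite -[cos x](subKr 1) c1 subr0 normr1.
  by have := dirichlet_re N x; rewrite c1 s0 !mul0r addr0.
have n2 : (2 * (1 - cos x)) != 0 by rewrite mulf_neq0 // pnatr_eq0.
rewrite trigsumE.
have := dirichlet_re N x; have := dirichlet_im N x.
set C := \sum_(k < N) cos _; set S := \sum_(k < N) sin _.
set p := N%:R * x => e1 e2.
have h1 := cos2Dsin2 x; have h2 := cos2Dsin2 p.
have : ((1 - cos x) * C + sin x * S) ^+ 2 + ((1 - cos x) * S - sin x * C) ^+ 2
   = (1 - cos p) ^+ 2 + (- sin p) ^+ 2 by rewrite e1 e2.
have -> : ((1 - cos x) * C + sin x * S) ^+ 2 + ((1 - cos x) * S - sin x * C) ^+ 2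
   = (1 - 2 * cos x + (cos x ^+ 2 + sin x ^+ 2)) * (C ^+ 2 + S ^+ 2) by ring.
have -> : (1 - cos p) ^+ 2 + (- sin p) ^+ 2 = 1 - 2 * cos p + (cos p ^+ 2 + sin p ^+ 2) by ring.
rewrite h1 h2; lra.
Qed.

Lemma trigsum_le N x : `|trigsum N x| <= N%:R ^+ 2.
Proof.
rewrite /trigsum (le_trans (ler_norm_sum _ _ _)) //.
apply: (@le_trans _ _ (\sum_(k < N) N%:R)); last first.
  by rewrite sumr_const card_ord -[_ *+ N]mulr_natl expr2.
apply: ler_sum => k _; rewrite (le_trans (ler_norm_sum _ _ _)) //.
apply: (@le_trans _ _ (\sum_(l < N) 1)); last by rewrite sumr_const card_ord.
by apply: ler_sum => l _; exact: cos_max.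
Qed.

(** Both kernels have t^2 in the denominator, and [trigsum_fejer] at d t compares the numerators. *)
Lemma fejer_trigsum N d t : (0 < N)%N -> 0 < d ->
  fejer (N%:R * d) t = N%:R^-1 * trigsum N (d * t) * fejer d t.
Proof.
move=> N0 d0; have Nn : (N%:R : R) != 0 by rewrite pnatr_eq0 -lt0n.
rewrite /fejer /fejerQ; case: eqP => [->|/eqP t0].
  have -> : trigsum N (d * 0) = N%:R ^+ 2.
    rewrite /trigsum; under eq_bigr => k _.
      under eq_bigr => l _ do rewrite mulr0 mulr0 cos0.
      rewrite sumr_const card_ord; over.
    by rewrite sumr_const card_ord -[_ *+ N]mulr_natl expr2.
  by field; rewrite Nn gt_eqF.
by rewrite -mulrA -trigsum_fejer; field; rewrite t0 Nn gt_eqF.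
Qed.

(** The Fejer kernel with t^2 replaced by the periodic 2 (N/d)^2 (1 - cos (d t / N)), which tends to
    t^2. The result is a trigonometric polynomial with frequencies in [-d, d]. *)
Definition fejer_sum N d t : R := d / (2 * N%:R ^+ 2) * trigsum N (d / N%:R * t).

Lemma fejer_sum_le N d t : 0 < d -> `|fejer_sum N d t| <= d / 2.
Proof.
move=> d0; have [->|N0] := eqVneq N 0%N.
  by rewrite /fejer_sum /trigsum big_ord0 mulr0 normr0 divr_ge0 // ltW.
have Np : 0 < N%:R ^+ 2 :> R by rewrite exprn_gt0 // ltr0n lt0n.
rewrite /fejer_sum normrM ger0_norm; last by rewrite divr_ge0 ?mulr_ge0 // ltW.
apply: (@le_trans _ _ (d / (2 * N%:R ^+ 2) * N%:R ^+ 2)).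
  by rewrite ler_wpM2l ?trigsum_le // divr_ge0 ?mulr_ge0 // ltW.
by rewrite le_eqVlt; apply/orP; left; apply/eqP; field; rewrite pnatr_eq0.
Qed.

Lemma cvg_cos_sqr (y c : nat -> R) : y @ \oo --> (0 : R) ->
  (forall n, `|c n| <= `|y n|) -> (fun n => cos (c n) ^+ 2) @ \oo --> (1 : R).
Proof.
move=> y0 cy.
have c0 : c @ \oo --> (0 : R).
  apply/norm_cvg0P; apply: (@squeeze_cvgr _ _ _ _ (fun=> 0) (fun n => `|y n|)).
  - by apply: nearW => n; rewrite normr_ge0 cy.
  - exact: cvg_cst.
  - exact/norm_cvg0P.
have cc : (fun n => cos (c n)) @ \oo --> (1 : R).
  by rewrite -cos0; apply: continuous_cvg => //; exact: continuous_cos.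
by rewrite -[X in _ --> X](mulr1 (1 : R)); under eq_fun do rewrite expr2; exact: cvgM.
Qed.

Lemma cvg_fejer_sum d t : 0 < d -> (fun n => fejer_sum n.+1 d t) @ \oo --> fejer d t.
Proof.
move=> d0.
pose y n := (d * t) * n.+1%:R^-1.
have yc : y @ \oo --> (0 : R).
  rewrite -[X in _ --> X](mulr0 (d * t)).
  by apply: cvgMl_tmp; exact: (@cvg_harmonic R).
have [t0|t0] := eqVneq t 0.
  apply: (@cvg_trans _ ((fun=> fejer d t) @ \oo)); last exact: cvg_cst.
  apply: near_eq_cvg; apply: nearW => n.
  rewrite /fejer_sum t0 mulr0.
  have -> : trigsum n.+1 0 = n.+1%:R ^+ 2.
    rewrite /trigsum; under eq_bigr => k _.
      under eq_bigr => l _ do rewrite mulr0 cos0.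
      rewrite sumr_const card_ord; over.
    by rewrite sumr_const card_ord -[_ *+ n.+1]mulr_natl expr2.
  have : n.+1%:R != 0 :> R by rewrite pnatr_eq0.
  rewrite /fejer /fejerQ eqxx; move: (n.+1%:R : R) => m m0; field.
  by rewrite m0 gt_eqF.
pose c n := sval (cid2 (oneBcos_mvt (y n))).
have cy n : `|c n| <= `|y n|.
  rewrite /c; case: cid2 => /= z zy _; rewrite (le_trans zy)//.
  by rewrite ler_pdivrMr // ler_peMr // ler1n.
have ce n : 1 - cos (y n) = cos (c n) ^+ 2 * (y n ^+ 2 / 2).
  by rewrite /c; case: cid2.
have cc := cvg_cos_sqr yc cy.
(* Off t = 0, [fejer_sum] equals [fejer] divided by [cos (c n) ^+ 2] as soon as this cosine is
   nonzero. *)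
have lim : (fun n => fejer d t / cos (c n) ^+ 2) @ \oo --> fejer d t * 1^-1.
  by apply: cvgM; [exact: cvg_cst|apply: cvgV => //; exact: oner_neq0].
rewrite invr1 mulr1 in lim.
apply: cvg_trans lim; apply: near_eq_cvg.
have : \forall n \near \oo, 0 < cos (c n) ^+ 2.
  by apply: (cvgr_gt _ cc); exact: ltr01.
apply: filterS => n cn0.
have yn0 : y n != 0.
  by rewrite /y !mulf_neq0 ?invr_eq0 ?pnatr_eq0 // gt_eqF.
have e1 := trigsum_fejer n.+1 (y n).
have e2 : n.+1%:R * y n = d * t by rewrite /y; field; rewrite addrC natr1 pnatr_eq0.
rewrite e2 ce in e1.
rewrite /fejer_sum (_ : d / n.+1%:R * t = y n); last by rewrite /y; ring.
have n0 : n.+1%:R != 0 :> R by rewrite pnatr_eq0.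
rewrite /fejer /fejerQ (negbTE t0) -e1.
have cnn : cos (c n) != 0 by move: cn0; rewrite exprn_even_gt0.
rewrite {1}/y.
move: (trigsum n.+1 (y n)) (cos (c n)) cnn (n.+1%:R : R) n0 => T C cnn m m0.
by field; rewrite ?cnn ?t0 ?m0 ?(gt_eqF d0).
Qed.

End Fejer.

(** * Band-limited convolution and L1 moduli of continuity *)

Section Scalar.
Context {R : realType}.
Notation mu := (@lebesgue_measure R).
Implicit Types (x t d r xi theta : R) (N : nat) (e h : R) (a b : R -> R).

Definition trigpoly r (p : R -> R) := exists s : seq (R * R * R),
  (forall z, z \in s -> `|z.2| <= r) /\
  p = fun x => \sum_(z <- s) (z.1.1 * cos (z.2 * x) + z.1.2 * sin (z.2 * x)).

Lemma trigpolyD r p q : trigpoly r p -> trigpoly r q -> trigpoly r (fun x => p x + q x).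
Proof.
move=> [s [hs ->]] [s' [hs' ->]]; exists (s ++ s'); split.
  by move=> z; rewrite mem_cat => /orP[/hs|/hs'].
by apply/funext => x; rewrite big_cat.
Qed.

Lemma trigpolyZ r k p : trigpoly r p -> trigpoly r (fun x => k * p x).
Proof.
move=> [s [hs ->]]; exists [seq ((k * z.1.1, k * z.1.2), z.2) | z <- s]; split.
  by move=> z /mapP[w ws ->] /=; exact: hs.
apply/funext => x; rewrite big_map big_distrr /=; apply: eq_bigr => z _; ring.
Qed.

Lemma trigpoly_sum r (I : Type) (s : seq I) (f : I -> R -> R) :
  (forall i, trigpoly r (f i)) -> trigpoly r (fun x => \sum_(i <- s) f i x).
Proof.
move=> h; elim: s => [|i s IH].
  by exists [::]; split => //; apply/funext => x; rewrite !big_nil.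
under eq_fun do rewrite big_cons.
exact: trigpolyD.
Qed.

Lemma trigpoly_cos r xi : `|xi| <= r -> trigpoly r (fun x => cos (xi * x)).
Proof.
move=> h; exists [:: ((1, 0), xi)]; split.
  by move=> z; rewrite inE => /eqP ->.
by apply/funext => x; rewrite big_seq1 /= mul1r mul0r addr0.
Qed.

Lemma trigpoly_sin r xi : `|xi| <= r -> trigpoly r (fun x => sin (xi * x)).
Proof.
move=> h; exists [:: ((0, 1), xi)]; split.
  by move=> z; rewrite inE => /eqP ->.
by apply/funext => x; rewrite big_seq1 /= mul1r mul0r add0r.
Qed.

Lemma measurable_trigpoly r p : trigpoly r p -> measurable_fun setT p.
Proof.
move=> [s [_ ->]]; elim: s => [|z s IH].
  by under eq_fun do rewrite big_nil; exact: measurable_cst.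
under eq_fun do rewrite big_cons.
apply: measurable_funD => //.
by apply: measurable_funD; apply: measurable_funM => //;
  [exact: measurable_cos_lin|exact: measurable_sin_lin].
Qed.

Lemma trigpoly_cosM r theta xi : `|theta| + `|xi| <= r ->
  trigpoly r (fun x => cos (theta * x) * cos (xi * x)).
Proof.
move=> h.
have -> : (fun x => cos (theta * x) * cos (xi * x)) =
  (fun x => 2^-1 * (cos ((theta + xi) * x) + cos ((theta - xi) * x))).
  by apply/funext => x; rewrite mulrDl mulrBl cosD cosB; field.
apply/trigpolyZ/trigpolyD; apply: trigpoly_cos; apply: le_trans h.
  exact: ler_normD.
exact: ler_normB.
Qed.

Lemma trigpoly_sinM r theta xi : `|theta| + `|xi| <= r ->
  trigpoly r (fun x => sin (theta * x) * cos (xi * x)).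
Proof.
move=> h.
have -> : (fun x => sin (theta * x) * cos (xi * x)) =
  (fun x => 2^-1 * (sin ((theta + xi) * x) + sin ((theta - xi) * x))).
  by apply/funext => x; rewrite mulrDl mulrBl sinD sinB; field.
apply/trigpolyZ/trigpolyD; apply: trigpoly_sin; apply: le_trans h.
  exact: ler_normD.
exact: ler_normB.
Qed.

Lemma fejer_sum_freq N d (k l : 'I_N) : 0 < d ->
  `|(k%:R - l%:R) * (d / N%:R)| <= d.
Proof.
move=> d0; have N0 : (0 < N)%N by apply: leq_ltn_trans (ltn_ord k).
have Np : 0 < N%:R :> R by rewrite ltr0n.
have dN : 0 <= d / N%:R by rewrite divr_ge0 // ltW.
rewrite normrM [X in _ * X]ger0_norm // mulrA ler_pdivrMr // mulrC ler_pM2l //.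
rewrite ler_norml; have := ltn_ord k; have := ltn_ord l.
rewrite -!(ltr_nat R) => h1 h2.
have := ler0n R k; have := ler0n R l; lra.
Qed.

Lemma trigpoly_fejer_sum N d theta r : 0 < d -> `|theta| + d <= r ->
  trigpoly r (fun x => cos (theta * x) * fejer_sum N d x) /\
  trigpoly r (fun x => sin (theta * x) * fejer_sum N d x).
Proof.
move=> d0 h.
have E (c : R -> R) : (fun x => c x * fejer_sum N d x) = (fun x => d / (2 * N%:R ^+ 2) *
   (\sum_(k <- enum 'I_N) \sum_(l <- enum 'I_N) (c x * cos ((k%:R - l%:R) * (d / N%:R) * x)))).
  apply/funext => x; rewrite /fejer_sum /trigsum mulrCA; congr (_ * _).
  rewrite big_distrr /= big_enum /=; apply: eq_bigr => k _.
  rewrite big_distrr /= big_enum /=; apply: eq_bigr => l _.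
  by rewrite mulrA.
rewrite !E; split; apply: trigpolyZ; apply: trigpoly_sum => k; apply: trigpoly_sum => l.
  by apply: trigpoly_cosM; apply: le_trans h; rewrite lerD2l fejer_sum_freq.
by apply: trigpoly_sinM; apply: le_trans h; rewrite lerD2l fejer_sum_freq.
Qed.

Lemma integrableR_trigpoly a r p : integrableR a -> trigpoly r p -> forall x,
  integrableR (fun s => a s * p (x - s)).
Proof.
move=> ia [s [_ ->]] x.
have -> : (fun t => a t * (\sum_(z <- s) (z.1.1 * cos (z.2 * (x - t)) + z.1.2 * sin (z.2 * (x - t))))) =
   (fun t => \sum_(z <- s) ((z.1.1 * cos (z.2 * x) + z.1.2 * sin (z.2 * x)) * (a t * cos (z.2 * t))
       + (z.1.1 * sin (z.2 * x) - z.1.2 * cos (z.2 * x)) * (a t * sin (z.2 * t)))).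
  apply/funext => t; rewrite big_distrr /=; apply: eq_bigr => z _.
  by rewrite mulrBr cosB sinB; ring.
apply: (Rint_sum _ _).1 => z; apply: integrableRD; apply: integrableRZ.
  exact: integrableR_cos.
exact: integrableR_sin.
Qed.

Lemma conv_trigpoly a r p : integrableR a -> trigpoly r p ->
  trigpoly r (fun x => \int[mu]_s (a s * p (x - s))).
Proof.
move=> ia [s [hs ->]].
pose A xi := \int[mu]_s (a s * cos (xi * s)).
pose B xi := \int[mu]_s (a s * sin (xi * s)).
exists [seq ((z.1.1 * A z.2 - z.1.2 * B z.2, z.1.1 * B z.2 + z.1.2 * A z.2), z.2) | z <- s].
split; first by move=> z /mapP[w ws ->] /=; exact: hs.
apply/funext => x; rewrite big_map /=.
transitivity (\int[mu]_t (\sum_(z <- s) ((z.1.1 * cos (z.2 * x) + z.1.2 * sin (z.2 * x)) * (a t *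
    cos (z.2 * t))
       + (z.1.1 * sin (z.2 * x) - z.1.2 * cos (z.2 * x)) * (a t * sin (z.2 * t))))).
  apply: eq_Rintegral => t _; rewrite big_distrr /=; apply: eq_bigr => z _.
  by rewrite mulrBr cosB sinB; ring.
have ic := fun xi => integrableR_cos xi ia; have iS := fun xi => integrableR_sin xi ia.
have [_ ->] := Rint_sum s (fun z : R * R * R => integrableRD
  (integrableRZ (z.1.1 * cos (z.2 * x) + z.1.2 * sin (z.2 * x)) (ic z.2))
  (integrableRZ (z.1.1 * sin (z.2 * x) - z.1.2 * cos (z.2 * x)) (iS z.2))).
apply: eq_bigr => z _; rewrite RintD; try exact: integrableRZ.
by rewrite !RintZ // -/(A _) -/(B _); ring.
Qed.

(** The two hypotheses say that the transform of [a] is the constant [kappa] on [-r, r], so each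
    frequency of [p] is multiplied by [kappa]. *)
Lemma conv_trigpoly_eq a r (kappa : R) p : integrableR a ->
  (forall xi, `|xi| <= r -> \int[mu]_s (a s * cos (xi * s)) = kappa) ->
  (forall xi, `|xi| <= r -> \int[mu]_s (a s * sin (xi * s)) = 0) ->
  trigpoly r p -> forall x, \int[mu]_s (a s * p (x - s)) = kappa * p x.
Proof.
move=> ia hc hS [s [hs ->]] x.
transitivity (\int[mu]_t (\sum_(z <- s) ((z.1.1 * cos (z.2 * x) + z.1.2 * sin (z.2 * x)) * (a t *
    cos (z.2 * t))
       + (z.1.1 * sin (z.2 * x) - z.1.2 * cos (z.2 * x)) * (a t * sin (z.2 * t))))).
  apply: eq_Rintegral => t _; rewrite big_distrr /=; apply: eq_bigr => z _.
  by rewrite mulrBr cosB sinB; ring.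
have ic := fun xi => integrableR_cos xi ia; have iS := fun xi => integrableR_sin xi ia.
have [_ ->] := Rint_sum s (fun z : R * R * R => integrableRD
  (integrableRZ (z.1.1 * cos (z.2 * x) + z.1.2 * sin (z.2 * x)) (ic z.2))
  (integrableRZ (z.1.1 * sin (z.2 * x) - z.1.2 * cos (z.2 * x)) (iS z.2))).
rewrite big_distrr /= big_seq [RHS]big_seq; apply: eq_bigr => z /hs zr.
rewrite RintD; try exact: integrableRZ.
by rewrite !RintZ // hc // hS //; ring.
Qed.

Lemma measurable_fejer d : measurable_fun setT (fejer d).
Proof. exact: (integrableR_measurable (integrableR_fejer d)). Qed.

Lemma fejer_le d t : 0 < d -> `|fejer d t| <= d / 2.
Proof.
move=> d0; rewrite ger0_norm; last exact: fejer_ge0 (ltW d0).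
rewrite ler_pdivrMr //.
by rewrite (le_trans (fejerQ_le _ _)) // expr2 mulrAC.
Qed.

Lemma cvg_conv_fejer_sum a d (c : R -> R) x : integrableR a -> 0 < d ->
  measurable_fun setT c -> (forall t, `|c t| <= 1) ->
  (fun n => \int[mu]_s (a s * (c (x - s) * fejer_sum n.+1 d (x - s)))) @ \oo -->
  \int[mu]_s (a s * (c (x - s) * fejer d (x - s))).
Proof.
move=> ia d0 mc c1.
have maff : measurable_fun setT (fun s : R => x - s).
  by apply: measurable_funB => //; exact: measurable_cst.
have ma := integrableR_measurable ia.
have mfs n : measurable_fun setT (fejer_sum n d).
  apply: (@measurable_trigpoly d).
  have [] := @trigpoly_fejer_sum n d 0 d d0; first by rewrite normr0 add0r.
  by under eq_fun do rewrite mul0r cos0 mul1r.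
have [] := @Rint_dominated R (fun n s => a s * (c (x - s) * fejer_sum n.+1 d (x - s)))
  (fun s => a s * (c (x - s) * fejer d (x - s))) (fun s => d / 2 * `|a s|).
- move=> n; apply: measurable_funM => //; apply: measurable_funM.
    exact: (measurableT_comp mc).
  exact: (measurableT_comp (mfs n.+1)).
- apply: measurable_funM => //; apply: measurable_funM.
    exact: (measurableT_comp mc).
  exact: (measurableT_comp (@measurable_fejer d)).
- apply: aeW => s; apply: cvgMl_tmp; apply: cvgMl_tmp; exact: cvg_fejer_sum.
- exact/integrableRZ/integrableR_norm.
- move=> n s; rewrite normrM mulrC ler_wpM2r // normrM -[d / 2]mul1r ler_pM //.
  exact: fejer_sum_le.
by [].
Qed.

(* Convolving with [a] acts on [c * fejer d] through the values of the Fourier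
   transform of [a] on the band only, because [c * fejer d] is a boundedly
   pointwise limit of trigonometric polynomials with frequencies in the band. *)
Lemma conv_fejer a r (kappa : R) d theta : integrableR a -> 0 < d -> `|theta| + d <= r ->
  (forall xi, `|xi| <= r -> \int[mu]_s (a s * cos (xi * s)) = kappa) ->
  (forall xi, `|xi| <= r -> \int[mu]_s (a s * sin (xi * s)) = 0) ->
  forall x,
  \int[mu]_s (a s * (cos (theta * (x - s)) * fejer d (x - s))) = kappa * (cos (theta * x) * fejer d x)
  /\ \int[mu]_s (a s * (sin (theta * (x - s)) * fejer d (x - s))) = kappa * (sin (theta * x) * fejer d x).
Proof.
move=> ia d0 hr hc hS x; split.
- have := @cvg_conv_fejer_sum a d (fun t => cos (theta * t)) x ia d0 (measurable_cos_lin theta)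
    (fun t => cos_max _).
  have -> : (fun n => \int[mu]_s (a s * (cos (theta * (x - s)) * fejer_sum n.+1 d (x - s)))) =
     (fun n => kappa * (cos (theta * x) * fejer_sum n.+1 d x)).
    apply/funext => n; have [h _] := trigpoly_fejer_sum n.+1 d0 hr.
    exact: (conv_trigpoly_eq ia hc hS h).
  move/cvg_lim => <- //; apply/cvg_lim => //; apply: cvgMl_tmp; apply: cvgMl_tmp.
  exact: cvg_fejer_sum.
- have := @cvg_conv_fejer_sum a d (fun t => sin (theta * t)) x ia d0 (measurable_sin_lin theta)
    (fun t => sin_max _).
  have -> : (fun n => \int[mu]_s (a s * (sin (theta * (x - s)) * fejer_sum n.+1 d (x - s)))) =
     (fun n => kappa * (sin (theta * x) * fejer_sum n.+1 d x)).
    apply/funext => n; have [_ h] := trigpoly_fejer_sum n.+1 d0 hr.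
    exact: (conv_trigpoly_eq ia hc hS h).
  move/cvg_lim => <- //; apply/cvg_lim => //; apply: cvgMl_tmp; apply: cvgMl_tmp.
  exact: cvg_fejer_sum.
Qed.

(** Substituting s / (n + 1) for s turns the kernel into the fixed [fejer 1] and moves n into the
    argument of [w], where dominated convergence applies. *)
Lemma cvg_fejer_identity (w : R -> R) (W : R) : measurable_fun setT w ->
  (forall s, `|w s| <= W) -> w @ 0 --> 0 ->
  (fun n => \int[mu]_s (fejer n.+1%:R s * w s)) @ \oo --> (0 : R).
Proof.
move=> mw wW w0.
have ik n : integrableR (fun s => fejer n.+1%:R s * w s).
  exact: (integrableRM (integrableR_fejer _) mw wW).
have E n : \int[mu]_s (fejer n.+1%:R s * w s) = \int[mu]_s (fejer 1 s * w (s / n.+1%:R)).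
  have n0 : (n.+1%:R : R)^-1 != 0 by rewrite invr_eq0 pnatr_eq0.
  rewrite -(Rintegral_affine 0 n0 (ik n)) -RintZ; last first.
    exact: (integrable_affine 0 n0 (ik n)).
  apply: eq_Rintegral => s _; rewrite addr0 ger0_norm // mulrA; congr (_ * _); last by rewrite mulrC.
  by rewrite fejer_scale ?ltr0n // !mulrA mulVf ?mulfV ?pnatr_eq0 // !mul1r.
under eq_fun do rewrite E.
have -> : (0 : R) = \int[mu]_s 0 by rewrite Rintegral_cst // mul0r.
have [] := @Rint_dominated R (fun n s => fejer 1 s * w (s / n.+1%:R)) (fun=> 0) (fun s => W * fejer 1 s).
- move=> n; apply: measurable_funM; first exact: measurable_fejer.
  by apply: measurableT_comp => //; exact: measurable_funM.
- exact: measurable_cst.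
- apply: aeW => s; rewrite -[X in _ --> X](mulr0 (fejer 1 s)); apply: cvgMl_tmp.
  apply: (@cvg_comp _ _ _ (fun n : nat => s / n.+1%:R) w _ (nbhs (0 : R))) => //.
  suff : (fun n : nat => s / n.+1%:R) @ \oo --> s * 0 by rewrite mulr0.
  by apply: cvgMl_tmp; exact: (@cvg_harmonic R).
- exact/integrableRZ/integrableR_fejer.
- move=> n s; rewrite normrM mulrC; rewrite (ger0_norm (fejer_ge0 _ _)) //.
  by rewrite ler_wpM2r // fejer_ge0.
by [].
Qed.

Definition omega1 a s : R := norm1 (fun t => a (t + s) - a t).

Lemma integrableR_omega a s : integrableR a -> integrableR (fun t => a (t + s) - a t).
Proof. by move=> ia; apply: integrableRB => //; exact: integrable_translate. Qed.

Lemma norm1_translate a s : integrableR a -> norm1 (fun t => a (t + s)) = norm1 a.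
Proof.
by move=> ia; rewrite /norm1; apply: (Rintegral_translate s (integrableR_norm ia)).
Qed.

Lemma norm1N a : norm1 (fun t => - a t) = norm1 a.
Proof. by rewrite /norm1; apply: eq_Rintegral => t _; rewrite normrN. Qed.

Lemma omega1D a b s : integrableR a -> integrableR b ->
  omega1 a s <= omega1 b s + 2 * norm1 (fun t => a t - b t).
Proof.
move=> ia ib; have iab := integrableRB ia ib.
rewrite /omega1.
have -> : (fun t => a (t + s) - a t) =
   (fun t => (b (t + s) - b t) + (((a (t + s) - b (t + s))) + - (a t - b t))).
  by apply/funext => t; ring.
apply: le_trans (norm1D _ _) _.
- exact: integrableR_omega.
- by apply: integrableRD; [exact: (integrable_translate s iab)|exact: integrableRN].
rewrite lerD2l; apply: le_trans (norm1D _ _) _.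
- exact: (integrable_translate s iab).
- exact: integrableRN.
by rewrite norm1N (norm1_translate s iab) mulr_natl mulr2n.
Qed.

Lemma omega1_le a s : integrableR a -> omega1 a s <= 2 * norm1 a.
Proof.
move=> ia; apply: le_trans (norm1D _ _) _; first exact: integrable_translate.
  exact: integrableRN.
by rewrite norm1N norm1_translate // mulr_natl mulr2n.
Qed.

(** Passes from sequences of shifts, which dominated convergence handles, to a uniform threshold: if
    there were none, some bad shift of size at most 1 / (n + 1) could be chosen for each n. *)
Lemma omega1_small_seq a : integrableR a ->
  (forall s : nat -> R, (forall n, `|s n| <= n.+1%:R^-1) ->
     (fun n => omega1 a (s n)) @ \oo --> (0 : R)) ->
  forall e : R, 0 < e -> exists2 h : R, 0 < h & forall s, `|s| <= h -> omega1 a s <= e.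
Proof.
move=> ia H e e0; apply: contrapT => nh.
have P n : exists s, `|s| <= n.+1%:R^-1 /\ e < omega1 a s.
  apply: contrapT => Q; apply: nh; exists n.+1%:R^-1; first by rewrite invr_gt0 ltr0n.
  by move=> s hs; rewrite leNgt; apply/negP => es; apply: Q; exists s.
have [s hs] := choice P.
have := H s (fun n => (hs n).1).
move=> /cvgrPdist_lt /(_ e e0) [n _ /(_ n (leqnn n))] /=.
rewrite sub0r normrN ger0_norm ?norm1_ge0 // => lt1.
by have := lt_trans lt1 (hs n).2; rewrite ltxx.
Qed.

Lemma omega1_continuous_itv (g : R -> R) (n : nat) : continuous g ->
  let b := g \_ `[- n%:R, n%:R] in
  integrableR b /\
  forall s : nat -> R, (forall k, `|s k| <= k.+1%:R^-1) ->
     (fun k => omega1 b (s k)) @ \oo --> (0 : R).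
Proof.
move=> cg b.
have mI (u v : R) : measurable `[u, v] by [].
have ib0 (u v : R) : integrableR ((fun=> 1 : R) \_ `[u, v]).
  have := @integrable_indic_itv R u v true false.
  by congr (_.-integrable _ _); apply/funext => t; rewrite /= patchE indicE; case: ifP.
have mb : measurable_fun setT b.
  apply/(measurable_restrictT _ (mI _ _)); apply: measurable_funTS.
  exact: continuous_measurable_fun.
have [M bM] : exists M, forall t, `|b t| <= M.
  have cK : compact (`[- n%:R, n%:R] : set R) by exact: segment_compact.
  have := continuous_compact (continuous_subspaceT cg) cK.
  move=> /compact_bounded [M [_ hM]]; exists (`|M| + 1) => t.
  rewrite /b patchE; case: ifPn => [/set_mem tn|_]; last by rewrite normr0 addr_ge0.
  apply: (hM (`|M| + 1)); first by rewrite (le_lt_trans (ler_norm _)) // ltrDl.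
  by exists t.
have bE t : ~ (- n%:R <= t <= n%:R) -> b t = 0.
  by move=> h; rewrite /b patchE ifF //; apply/negP => /set_mem; rewrite /= in_itv.
have ib : integrableR b.
  apply: (integrableR_le mb (integrableRZ M (ib0 (- n%:R) n%:R))) => t.
  rewrite patchE; case: ifPn => [_|h]; first by rewrite mulr1.
  rewrite mulr0 /b patchE (negbTE h) normr0 //.
split => // s hs.
have s0 : s @ \oo --> (0 : R).
  apply/norm_cvg0P; apply: (@squeeze_cvgr _ _ _ _ (fun=> 0) (@harmonic R)).
  - by apply: nearW => k; rewrite normr_ge0 hs.
  - exact: cvg_cst.
  - exact: cvg_harmonic.
(* All shifts have size at most 1, so both terms vanish outside [-n - 1, n + 1]. *)
have [] := @Rint_dominated R (fun k t => b (t + s k) - b t) (fun=> 0)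
   (fun t => 2 * M * ((fun=> 1 : R) \_ `[- n.+1%:R, n.+1%:R]) t).
- move=> k; apply: measurable_funB => //; apply: measurableT_comp => //.
  by apply: measurable_funD => //; exact: measurable_cst.
- exact: measurable_cst.
(* Truncation makes [b] discontinuous at most at the two ends of the interval, a null set. *)
- exists [set - n%:R; n%:R]; split => //.
  + by apply: measurableU.
  + apply: countable_lebesgue_measure0; exact: finite_set_countable.
  move=> t /=; apply: contra_notP => /not_orP[t1 t2].
  rewrite -(subrr (b t)); apply: cvgB; last exact: cvg_cst.
  have ts : (fun k => t + s k) @ \oo --> t.
    by rewrite -[X in _ --> X]addr0; apply: cvgD => //; exact: cvg_cst.
  have [tn|/negP tn] := boolP ((- n%:R <= t) && (t <= n%:R)).
    move: tn => /andP[n1 n2].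
    have l1 : - n%:R < t by rewrite lt_neqAle n1 andbT; apply/eqP => /esym.
    have l2 : t < n%:R by rewrite lt_neqAle n2 andbT; apply/eqP.
    have -> : b t = g t by rewrite /b patchE mem_set //= in_itv /= n1 n2.
    apply: (@cvg_trans _ ((fun k => g (t + s k)) @ \oo)); last first.
      by apply: continuous_cvg => //; exact: cg.
    apply: near_eq_cvg; near=> k.
    rewrite /b patchE mem_set //= in_itv /= ltW ?ltW //; near: k.
      exact: (cvgr_lt _ ts).
    exact: (cvgr_gt _ ts).
  have tt : t < - n%:R \/ n%:R < t.
    have [h|h] := ltP t (- n%:R); first by left.
    by right; rewrite ltNge; apply/negP => h'; apply: tn; rewrite h h'.
  rewrite (bE t tn); apply: (@cvg_trans _ ((fun=> 0 : R) @ \oo)); last exact: cvg_cst.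
  apply: near_eq_cvg; case: tt => h.
    apply: (filterS _ (cvgr_lt _ ts _ h)) => k hk; rewrite bE // => /andP[h1 _].
    by move: hk; rewrite ltNge h1.
  apply: (filterS _ (cvgr_gt _ ts _ h)) => k hk; rewrite bE // => /andP[_ h1].
  by move: hk; rewrite ltNge h1.
- exact/integrableRZ/ib0.
- move=> k t; rewrite patchE; case: ifPn => [_|].
    by rewrite mulr1 (le_trans (ler_normB _ _)) // mulr_natl mulr2n lerD.
  move=> /negP h.
  have h' : ~ (- n.+1%:R <= t <= n.+1%:R) by move=> q; apply: h; rewrite inE /= in_itv.
  have sk : `|s k| <= 1 by rewrite (le_trans (hs k)) // invf_le1 // ler1n.
  move: sk; rewrite ler_norml => /andP[s1 s2].
  rewrite mulr0 !bE ?subrr ?normr0 // => /andP[q1 q2]; apply: h'; rewrite -natr1; apply/andP; split; lra.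
move=> _ + _; apply: cvg_trans; apply: near_eq_cvg; apply: nearW => k.
by rewrite /omega1; congr norm1; apply/funext => t; rewrite subr0.
Unshelve. all: by end_near.
Qed.

Lemma truncate_norm1 a (e : R) : integrableR a -> 0 < e ->
  exists n : nat, norm1 (fun t => a t - (a \_ `[- n%:R, n%:R]) t) <= e.
Proof.
move=> ia e0; have ma := integrableR_measurable ia.
have mr n : measurable_fun setT (a \_ `[- (n : nat)%:R : R, n%:R]).
  have mI : measurable `[- n%:R : R, n%:R] by [].
  by apply/(measurable_restrictT _ mI); exact: measurable_funTS.
have [] := @Rint_dominated R (fun n => a \_ `[- (n : nat)%:R, n%:R]) a (fun t => `|a t|) mr ma.
- apply: aeW => t.
  apply: (@cvg_trans _ ((fun=> a t) @ \oo)); last exact: cvg_cst.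
  apply: near_eq_cvg; near=> n; rewrite patchE mem_set //= in_itv /=.
  rewrite -ler_norml; near: n; exact: nbhs_infty_ger.
- exact: integrableR_norm.
- by move=> n t; rewrite patchE; case: ifP => // _; rewrite normr0.
move=> _ /cvgrPdist_le /(_ e e0) [n _ /(_ n (leqnn n))] /= h _; exists n.
move: h; rewrite sub0r normrN ger0_norm ?norm1_ge0 // => h.
rewrite -norm1N; apply: le_trans h; rewrite le_eqVlt; apply/orP; left; apply/eqP.
by congr norm1; apply/funext => t; rewrite opprB.
Unshelve. all: by end_near.
Qed.

Lemma omega1_small a (e : R) : integrableR a -> 0 < e ->
  exists2 h : R, 0 < h & forall s, `|s| <= h -> omega1 a s <= e.
Proof.
move=> ia e0.
(* Truncation and continuous approximation cost e/8 each; [omega1D] doubles their sum to e/2, and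
   the continuous truncated function uses the other e/2. *)
have e8 : 0 < e / 8 by rewrite divr_gt0.
have [n hn] := truncate_norm1 ia e8.
have mI : measurable `[- n%:R : R, n%:R] by [].
have ir := integrableR_restrict mI ia.
have [||g_ [cg ig cvg0]] := @approximation_continuous_integrable R `[- n%:R, n%:R]%classic a mI.
- by apply: compact_finite_measure; exact: segment_compact.
- by apply: integrableS ia.
have [k hk] : exists k, (\int[mu]_(z in `[(- n%:R)%R, n%:R]) `|(a z - g_ k z)%:E| <= (e / 8)%:E)%E.
  have /fine_cvgP[fn c0] := cvg0.
  have c1 : \forall k \near \oo, (fine \o (fun n0 => (\int[mu]_(z in `[(- n%:R)%R, n%:R]) `|(a z -
      g_ n0 z)%:E|)%E)) k < e / 8
    by exact: (cvgr_lt _ c0 _ e8).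
  have [k [h1 h2]] : exists k, ((\int[mu]_(z in `[(- n%:R)%R, n%:R]) `|(a z - g_ k z)%:E|)%E \is a
      fin_num) /\ 
     fine (\int[mu]_(z in `[(- n%:R)%R, n%:R]) `|(a z - g_ k z)%:E|)%E < e / 8.
    near \oo => k; exists k; split; near: k; [exact: fn|exact: c1].
  by exists k; rewrite -(fineK h1) lee_fin ltW.
have [ib hb] := omega1_continuous_itv n (cg k).
have ab : norm1 (fun t => a t - (g_ k \_ `[- n%:R, n%:R]) t) <= e / 4.
  pose D := `[- n%:R, n%:R]%classic : set R.
  have idiff := integrableRB ir ib.
  have -> : (fun t => a t - (g_ k \_ D) t) =
    (fun t => (a t - (a \_ D) t) + ((a \_ D) t - (g_ k \_ D) t)).
    by apply/funext => t; ring.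
  apply: le_trans (norm1D _ _) _ => //; first exact: integrableRB.
  suff : norm1 (fun t => (a \_ D) t - (g_ k \_ D) t) <= e / 8 by move: hn; rewrite -/D; lra.
  rewrite -lee_fin -norm1_EFin //; apply: le_trans hk.
  rewrite [X in (_ <= X)%E]integral_mkcond le_eqVlt; apply/orP; left; apply/eqP; apply: eq_integral => t _.
  by rewrite /D !patchE; case: ifP => // _; rewrite subr0 abse0.
have [h h0 hh] := omega1_small_seq ib hb (divr_gt0 e0 (ltr0n R 2)).
exists h => // s sh; apply: (le_trans (omega1D s ia ib)).
by have := hh s sh; lra.
Unshelve. all: by end_near.
Qed.

(** Continuity makes the modulus measurable in the shift, so that it can be integrated against
    [fejer], and makes it small near the shift 0. *)
Lemma omega1_continuous a : integrableR a -> continuous (omega1 a).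
Proof.
move=> ia s; apply/cvgrPdist_le => e e0.
have [h h0 hh] := omega1_small ia e0.
(* The modulus is subadditive in the shift, by translation invariance of the L1 norm. *)
have key u v : omega1 a u <= omega1 a v + omega1 a (u - v).
  rewrite /omega1 addrC -(norm1_translate v (integrableR_omega (u - v) ia)).
  apply: le_trans (norm1D _ _).
  - rewrite le_eqVlt; apply/orP; left; apply/eqP; congr norm1; apply/funext => t.
    rewrite (_ : t + v + (u - v) = t + u); last by ring.
    by ring.
  - exact: (integrable_translate v (integrableR_omega (u - v) ia)).
  - exact: integrableR_omega.
near=> t.
have ts : `|s - t| <= h by near: t; apply: cvgr_dist_le.
rewrite ler_norml; have := key s t; have := key t s.
have := hh _ ts; have := hh (t - s); rewrite distrC => /(_ ts); lra.
Unshelve. all: by end_near.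
Qed.

Lemma omega1_0 a : omega1 a 0 = 0.
Proof.
rewrite /omega1 /norm1; under eq_Rintegral => t _ do rewrite addr0 subrr normr0.
by rewrite Rintegral_cst // mul0r.
Qed.

Lemma integrableR_conv a b (M : R) t : integrableR a -> measurable_fun setT b ->
  (forall x, `|b x| <= M) -> integrableR (fun s => a s * b (t - s)).
Proof.
move=> ia mb bM; apply: (@integrableRM _ _ (fun s => b (t - s)) M) => //.
apply: measurableT_comp => //.
by apply: measurable_funB => //; exact: measurable_cst.
Qed.

Lemma conv_comm a b t : integrableR (fun s => a s * b (t - s)) ->
  \int[mu]_s (a s * b (t - s)) = \int[mu]_s (b s * a (t - s)).
Proof.
move=> ia; rewrite -(Rintegral_opp t ia); apply: eq_Rintegral => s _.
by rewrite subKr mulrC.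
Qed.

Lemma fejer_conv_diff a d t : integrableR a -> 0 < d ->
  integrableR (fun s => fejer d s * (a (t - s) - a t)) /\
  \int[mu]_s (a s * fejer d (t - s)) - fejerC * a t =
  \int[mu]_s (fejer d s * (a (t - s) - a t)).
Proof.
move=> ia d0; have ik := @integrableR_fejer R d.
have i1 := integrableR_conv t ia (@measurable_fejer d) (fun x => fejer_le x d0).
have i2 : integrableR (fun s => fejer d s * a (t - s)).
  have := integrable_opp t i1; apply: eq_integrable => // s _ /=.
  by rewrite subKr mulrC.
have i3 := integrableRZ (a t) ik.
have E : (fun s => fejer d s * (a (t - s) - a t)) =
   (fun s => fejer d s * a (t - s) - a t * fejer d s) by apply/funext => s; ring.
rewrite E; split; first exact: integrableRB.
rewrite RintB // RintZ // conv_comm //; congr (_ - _); rewrite mulrC; congr (_ * _).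
have := @Rint_fejer_cos R 0 d d0; rewrite normr0 => /(_ (ltW d0)).
by rewrite mul0r subr0 mulr1 => <-; apply: eq_Rintegral => s _; rewrite mul0r cos0 mulr1.
Qed.

(* Tonelli: the L1 distance is at most the Fejer average of the L1 modulus of continuity. *)
Lemma fejer_conv_norm1_le a d : integrableR a -> 0 < d ->
  integrableR (fun t => \int[mu]_s (a s * fejer d (t - s)) - fejerC * a t) /\
  norm1 (fun t => \int[mu]_s (a s * fejer d (t - s)) - fejerC * a t)
    <= \int[mu]_s (fejer d s * omega1 a (- s)).
Proof.
move=> ia d0.
have ma := integrableR_measurable ia; have mk := @measurable_fejer d.
pose f : R * R -> R := fun z => fejer d z.1 * (a (z.2 - z.1) - a z.2).
have mf : measurable_fun setT f.
  apply: measurable_funM; first exact: (measurableT_comp mk).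
  apply: measurable_funB; last exact: (measurableT_comp ma).
  by apply: (measurableT_comp ma); exact: measurable_funB.
have i1 s : integrableR (fun t => f (s, t)).
  exact: (integrableRZ (fejer d s) (integrableR_omega (- s) ia)).
have i2 t : integrableR (fun s => f (s, t)) by exact: (fejer_conv_diff t ia d0).1.
have n1 s : norm1 (fun t => f (s, t)) = fejer d s * omega1 a (- s).
  rewrite /omega1 /norm1 -RintZ; last by apply: integrableR_norm; exact: (integrableR_omega (- s)).
  by apply: eq_Rintegral => t _; rewrite /f /= normrM ger0_norm // fejer_ge0 // ltW.
have mo : measurable_fun setT (fun s : R => omega1 a (- s)).
  apply: measurableT_comp => //.
  by apply: continuous_measurable_fun; exact: omega1_continuous.
have ig : integrableR (fun s => fejer d s * omega1 a (- s)).
  apply: (@integrableRM _ _ _ (2 * norm1 a)) => //; first exact: integrableR_fejer.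
  by move=> s; rewrite ger0_norm ?norm1_ge0 // omega1_le.
have mN : measurable_fun setT (fun z => `|f z|) by exact: measurableT_comp.
have iN1 s : integrableR (fun t => `|f (s, t)|) by exact: integrableR_norm.
have iN2 t : integrableR (fun s => `|f (s, t)|) by exact: integrableR_norm.
have le1 s : norm1 (fun t => `|f (s, t)|) <= fejer d s * omega1 a (- s).
  by rewrite -n1 /norm1; under eq_Rintegral do rewrite normr_id.
have [eN _ iG] := @Rint_fubini R (fun z => `|f z|) (fun s => fejer d s * omega1 a (- s)) mN iN1 iN2 ig le1.
have E : (fun t => \int[mu]_s (a s * fejer d (t - s)) - fejerC * a t) = (fun t => \int[mu]_s f (s, t)).
  by apply/funext => t; exact: (fejer_conv_diff t ia d0).2.
rewrite E.
have le2 s : norm1 (fun t => f (s, t)) <= fejer d s * omega1 a (- s) by rewrite n1.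
have [_ _ iF] := @Rint_fubini R f (fun s => fejer d s * omega1 a (- s)) mf i1 i2 ig le2.
split; first exact: iF.
apply: (@le_trans _ _ (\int[mu]_t \int[mu]_s `|f (s, t)|)).
  apply: (Rint_le (integrableR_norm iF) iG) => t; exact: (Rint_norm_le (i2 t)).
rewrite -eN le_eqVlt; apply/orP; left; apply/eqP.
by apply: eq_Rintegral => s _; rewrite -n1.
Qed.

Lemma fejer_conv_norm1 a : integrableR a ->
  (fun n => norm1 (fun t => \int[mu]_s (a s * fejer n.+1%:R (t - s)) - fejerC * a t))
    @ \oo --> (0 : R).
Proof.
move=> ia.
have mo : measurable_fun setT (fun s : R => omega1 a (- s)).
  apply: measurableT_comp => //.
  by apply: continuous_measurable_fun; exact: omega1_continuous.
apply: (@squeeze_cvgr _ _ _ _ (fun=> 0) (fun n => \int[mu]_s (fejer n.+1%:R s * omega1 a (- s)))).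
- apply: nearW => n; rewrite norm1_ge0 /=.
  by apply: (fejer_conv_norm1_le ia _).2; rewrite ltr0n.
- exact: cvg_cst.
- apply: (@cvg_fejer_identity _ (2 * norm1 a)) => //.
    by move=> s; rewrite ger0_norm ?norm1_ge0 // omega1_le.
  have : (fun s : R => omega1 a (- s)) @ (0 : R) --> omega1 a (- (0 : R)).
    apply: continuous_cvg; first exact: omega1_continuous.
    by apply: cvgN; exact: cvg_id.
  by rewrite oppr0 omega1_0.
Qed.

End Scalar.

(** * Functionals and Bochner integrals *)

Section Rnorm.
Context {R : realType} {X : normedModType R[i]}.
Implicit Types (x y : X) (t : R) (c : R[i]).

Lemma rnormE x : `|x| = (rnorm x)%:C.
Proof.
have h := normr_ge0 x; rewrite /rnorm.
apply/eqP; rewrite eq_complex /= eqxx /=.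
by move: h; rewrite lecE => /andP[/eqP -> _].
Qed.

Lemma rnorm_ge0 x : 0 <= rnorm x.
Proof. by have := normr_ge0 x; rewrite rnormE lecR. Qed.

Lemma rnorm0 : rnorm (0 : X) = 0.
Proof. by rewrite /rnorm normr0. Qed.

Lemma rnorm_eq0 x : rnorm x = 0 -> x = 0.
Proof. by move=> h; apply/normr0_eq0; rewrite rnormE h. Qed.

Lemma rnormN x : rnorm (- x) = rnorm x.
Proof. by rewrite /rnorm normrN. Qed.

Lemma rnormB x y : rnorm (x - y) = rnorm (y - x).
Proof. by rewrite -rnormN opprB. Qed.

Lemma ler_rnormD x y : rnorm (x + y) <= rnorm x + rnorm y.
Proof. by have := ler_normD x y; rewrite !rnormE -rmorphD lecR. Qed.

Lemma ler_rnormB x y : rnorm (x - y) <= rnorm x + rnorm y.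
Proof. by rewrite -(rnormN y) ler_rnormD. Qed.

Lemma rnorm_dist x y : `|rnorm x - rnorm y| <= rnorm (x - y).
Proof.
have h1 := ler_rnormD (x - y) y; have h2 := ler_rnormD (y - x) x.
rewrite subrK in h1; rewrite subrK rnormB in h2.
by rewrite ler_norml; apply/andP; split; lra.
Qed.

Lemma cabsE c : `|c| = (cabs c)%:C.
Proof. by rewrite /cabs; case: c. Qed.

Lemma rnormZ c x : rnorm (c *: x) = cabs c * rnorm x.
Proof. by rewrite /rnorm normrZ cabsE rnormE -rmorphM. Qed.

Lemma cabsR t : cabs t%:C = `|t|.
Proof. by rewrite /cabs /= expr0n /= addr0 sqrtr_sqr. Qed.

Lemma rnormZr t x : rnorm (t%:C *: x) = `|t| * rnorm x.
Proof. by rewrite rnormZ cabsR. Qed.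

Lemma cvg_rnormP {T} (F : set_system T) {FF : Filter F} (f : T -> X) y :
  f @ F --> y <-> (forall e : R, 0 < e -> \forall x \near F, rnorm (y - f x) <= e).
Proof.
split=> [/cvgrPdist_le h e e0|h].
  have e0' : 0 < e%:C by rewrite ltcR.
  by apply: filterS (h _ e0') => x; rewrite rnormE lecR.
apply/cvgrPdist_le => e e0.
have [e1 e2] : e = (complex.Re e)%:C /\ 0 < complex.Re e.
  move: e0; case: e => a b; rewrite ltcE /= => /andP[/eqP -> ?]; split => //.
by rewrite e1; apply: filterS (h _ e2) => x; rewrite rnormE lecR.
Qed.

Lemma cvg_rnorm {T} (F : set_system T) {FF : Filter F} (f : T -> X) y :
  f @ F --> y -> (fun z => rnorm (f z)) @ F --> rnorm y.
Proof.
move=> /cvg_rnormP h; apply/cvgrPdist_le => e /h; apply: filterS => x.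
by apply: le_trans; exact: rnorm_dist.
Qed.

Lemma cvg_rnorm0P {T} (F : set_system T) {FF : Filter F} (f : T -> X) y :
  f @ F --> y <-> (fun z => rnorm (y - f z)) @ F --> (0 : R).
Proof.
split=> [/cvg_rnormP h|/cvgrPdist_le h].
  apply/cvgrPdist_le => e /h; apply: filterS => z.
  by rewrite sub0r normrN ger0_norm ?rnorm_ge0.
by apply/cvg_rnormP => e /h; apply: filterS => z; rewrite sub0r normrN ger0_norm ?rnorm_ge0.
Qed.

Lemma cvg_scale_real (a : nat -> R) (f : nat -> X) t y :
  a @ \oo --> t -> f @ \oo --> y -> (fun n => (a n)%:C *: f n) @ \oo --> t%:C *: y.
Proof.
move=> at_ fy; apply/cvg_rnorm0P.
apply: (@squeeze_cvgr _ _ _ _ (fun=> 0) (fun n => `|t - a n| * rnorm (f n) + `|t| * rnorm (y - f n))).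
- apply: nearW => n; rewrite rnorm_ge0 /= -!rnormZr.
  have -> : t%:C *: y - (a n)%:C *: f n = (t - a n)%:C *: f n + t%:C *: (y - f n).
    by rewrite rmorphB scalerBl scalerBr addrAC addrCA [X in _ = X]addrC addrCA subrr addr0 addrC.
  exact: ler_rnormD.
- exact: cvg_cst.
- have at0 : (fun n => `|t - a n|) @ \oo --> (0 : R).
    by apply/norm_cvg0P; rewrite -(subrr t); apply: cvgB => //; exact: cvg_cst.
  have fn : (fun n => rnorm (f n)) @ \oo --> rnorm y by exact: cvg_rnorm.
  have f0 : (fun n => rnorm (y - f n)) @ \oo --> (0 : R) by exact/cvg_rnorm0P.
  have : (fun n => `|t - a n| * rnorm (f n) + `|t| * rnorm (y - f n)) @ \oo --> 0 * rnorm y + `|t| * 0.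
    by apply: cvgD; apply: cvgM => //; exact: cvg_cst.
  by rewrite mul0r mulr0 addr0.
Qed.

End Rnorm.

(** * The Hahn-Banach theorem for real functionals *)

Section HahnBanach.
Context {R : realType} {X : normedModType R[i]}.
Implicit Types (x y : X) (t : R) (p q : X -> R).

(** Homogeneity is an inequality because that is what infima inherit directly; [sublinearZ] recovers
    the equality. *)
Definition sublinear p := (forall x y, p (x + y) <= p x + p y) /\
  (forall t x, 0 < t -> p (t%:C *: x) <= t * p x).

Lemma sublinear0 p : sublinear p -> p 0 = 0.
Proof.
move=> [pD pZ]; have := pD 0 0; rewrite addr0.
by have := pZ 2^-1 0; rewrite scaler0 invr_gt0 ltr0n => /(_ isT); lra.
Qed.

Lemma sublinearZ p t x : sublinear p -> 0 <= t -> p (t%:C *: x) = t * p x.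
Proof.
move=> sp; rewrite le_eqVlt => /orP[/eqP <-|t0]; first by rewrite scale0r mul0r sublinear0.
apply/eqP; rewrite eq_le (sp.2 _ _ t0) /=.
have := sp.2 t^-1 (t%:C *: x); rewrite invr_gt0 scalerA -rmorphM mulVf ?gt_eqF // scale1r.
by move=> /(_ t0) h; rewrite mulrC -ler_pdivlMr // mulrC.
Qed.

Lemma sublinear_opp p x : sublinear p -> - p (- x) <= p x.
Proof. by move=> sp; have := sp.1 x (- x); rewrite subrr sublinear0 //; lra. Qed.

(** Serves two infima: over the shifts in [lower_sublinear] and over a chain in Zorn's lemma. The
    family absorbs sums and positive multiples up to domination, and [c] keeps the infima finite. *)
Lemma sublinear_inf (I : Type) (i0 : I) (f : I -> X -> R) (c : X -> R) :
  (forall i x, c x <= f i x) ->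
  (forall i j x y, exists k, f k (x + y) <= f i x + f j y) ->
  (forall i t x, 0 < t -> exists k, f k (t%:C *: x) <= t * f i x) ->
  sublinear (fun x => inf (range (fun i => f i x))) /\
  forall i x, inf (range (fun i => f i x)) <= f i x.
Proof.
move=> fc fD fZ.
have lb x : has_lbound (range (fun i => f i x)) by exists (c x) => _ [i _ <-].
have le i x : inf (range (fun i => f i x)) <= f i x.
  by apply: ge_inf => //; exists i.
have ne x : range (fun i => f i x) !=set0 by exists (f i0 x), i0.
split => //; split => [x y|t x t0].
  rewrite -lerBlDr; apply: lb_le_inf => // _ [i _ <-].
  rewrite lerBlDr -lerBlDl; apply: lb_le_inf => // _ [j _ <-].
  rewrite lerBlDl; have [k hk] := fD i j x y.
  by apply: le_trans hk; exact: le.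
rewrite mulrC -ler_pdivrMr //; apply: lb_le_inf => // _ [i _ <-].
rewrite ler_pdivrMr // mulrC; have [k hk] := fZ i t x t0.
by apply: le_trans hk; exact: le.
Qed.

(* The largest sublinear functional below [p] whose value at [- y] is [- p y]. *)
Definition lower_sublinear p y x : R :=
  inf (range (fun z : {t : R | 0 <= t} => p (x + (sval z)%:C *: y) - sval z * p y)).

Lemma lower_sublinearP p y : sublinear p ->
  [/\ sublinear (lower_sublinear p y), forall x, lower_sublinear p y x <= p x &
   forall x, lower_sublinear p y x <= p (x + y) - p y].
Proof.
move=> sp.
pose I := {t : R | 0 <= t}.
have z0 : I by exists 0.
have [] := @sublinear_inf I z0 (fun z x => p (x + (sval z)%:C *: y) - sval z * p y) (fun x => - p (- x)).
- move=> [t t0] x /=.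
  rewrite -(sublinearZ _ sp t0).
  have := sp.1 (x + t%:C *: y) (- x); rewrite addrAC subrr add0r; lra.
- move=> [t t0] [s s0] x x' /=; exists (exist _ (t + s) (addr_ge0 t0 s0)) => /=.
  have := sp.1 (x + t%:C *: y) (x' + s%:C *: y).
  rewrite rmorphD scalerDl /= addrACA; lra.
- move=> [t t0] s x sp0 /=; exists (exist _ (s * t) (mulr_ge0 (ltW sp0) t0)) => /=.
  rewrite rmorphM -scalerA -scalerDr (sublinearZ _ sp (ltW sp0)); lra.
move=> h1 h2; split => //.
- move=> x; have := h2 (exist _ 0 (lexx 0)) x => /=.
  by rewrite scale0r addr0 mul0r subr0.
- move=> x; have := h2 (exist _ 1 ler01) x => /=.
  by rewrite scale1r mul1r.
Qed.

(** Zorn's lemma for the reversed pointwise order: a nonempty chain is bounded by its infimum, the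
    empty one by [q]. *)
Lemma exists_minimal_sublinear q : sublinear q ->
  exists p, [/\ sublinear p, forall x, p x <= q x &
    forall p', sublinear p' -> (forall x, p' x <= p x) -> p' = p].
Proof.
move=> sq.
pose T := {p | sublinear p /\ forall x, p x <= q x}.
pose Rl (s t : T) : bool := `[< forall x, sval t x <= sval s x >].
have [] := @Zorn T Rl.
- by move=> t; apply/asboolP.
- by move=> r s t /asboolP h1 /asboolP h2; apply/asboolP => x; exact: le_trans (h2 x) (h1 x).
- move=> [s ps] [t pt] /asboolP /= h1 /asboolP /= h2; apply: eq_exist.
  by apply/funext => x; apply/eqP; rewrite eq_le h2 h1.
- move=> C tot.
  have [[a Ca]|nC] := pselect (exists a, C a); last first.
    exists (exist _ q (conj sq (fun x => lexx (q x)))) => s Cs.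
    by exfalso; apply: nC; exists s.
  pose I := {s : T | C s}.
  have [] := @sublinear_inf I (exist _ a Ca) (fun z x => sval (sval z) x) (fun x => - q (- x)).
  + move=> [[s [ss sle]] Cs] x /=; have := sublinear_opp x ss; have := sle (- x); lra.
  + move=> [s Cs] [t Ct] x y /=.
    have [/asboolP h|/asboolP h] := tot s t Cs Ct.
      exists (exist _ t Ct) => /=; have := (proj1 (svalP t)).1 x y; have := h x; lra.
    exists (exist _ s Cs) => /=; have := (proj1 (svalP s)).1 x y; have := h y; lra.
  + move=> [s Cs] t x t0 /=; exists (exist _ s Cs) => /=; exact: (proj1 (svalP s)).2.
  move=> h1 h2.
  set m := (fun x => _) in h1.
  have mq x : m x <= q x by apply: le_trans (h2 (exist _ a Ca) x) _; exact: (proj2 (svalP a)).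
  exists (exist _ m (conj h1 mq)) => s Cs; apply/asboolP => x /=.
  exact: (h2 (exist _ s Cs) x).
move=> [p [sp pq]] min; exists p; split => // p' sp' p'p.
have p'q x : p' x <= q x by apply: le_trans (pq x).
have := min (exist _ p' (conj sp' p'q)).
by move=> /(_ (introT (asboolP _) p'p)) [].
Qed.

(** Functionals are real-valued so that every tested identity concerns real integrals. Complex
    scalars are reached by testing with [l] and with x |-> l (i x) as well. *)
Definition bounded_real_linear (l : X -> R) :=
  [/\ forall x y, l (x + y) = l x + l y, forall t x, l (t%:C *: x) = t * l x &
   exists M, forall x, `|l x| <= M * rnorm x].

(** A minimal sublinear [l] coincides with [lower_sublinear l z] for every [z], which forces
    additivity. Minimising below [lower_sublinear] of the norm at [y] gives l (- y) <= - rnorm y,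
    hence the value at [y]. *)
Lemma norming_functional y : exists l, [/\ bounded_real_linear l,
  forall x, `|l x| <= rnorm x & l y = rnorm y].
Proof.
have sn : sublinear (@rnorm R X).
  split; first exact: ler_rnormD.
  by move=> t x t0; rewrite rnormZr gtr0_norm.
have [sq qn qy] := lower_sublinearP y sn.
have [l [sl lq lmin]] := exists_minimal_sublinear sq.
have lD x z : l (x + z) = l x + l z.
  apply/eqP; rewrite eq_le sl.1 /=.
  have [s1 s2 s3] := lower_sublinearP z sl.
  by have := s3 x; rewrite (lmin _ s1 s2); lra.
have lN x : l (- x) = - l x.
  by have := lD x (- x); rewrite subrr sublinear0 //; lra.
have ln x : l x <= rnorm x by exact: le_trans (lq x) (qn x).
have lb x : `|l x| <= rnorm x.
  by rewrite ler_norml ln andbT; have := ln (- x); rewrite lN rnormN; lra.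
exists l; split => //.
  split => //; last by exists 1 => x; rewrite mul1r.
  move=> t x; have [t0|t0] := leP 0 t; first exact: sublinearZ.
  rewrite -[t in LHS]opprK rmorphN scaleNr lN sublinearZ ?oppr_ge0 ?ltW //.
  by rewrite mulNr opprK.
apply/eqP; rewrite eq_le ln /=.
by have := le_trans (lq (- y)) (qy (- y)); rewrite lN addNr rnorm0; lra.
Qed.

Lemma functional_separation x y :
  (forall l, bounded_real_linear l -> l x = l y) -> x = y.
Proof.
move=> h; have [l [bl _ ly]] := norming_functional (x - y).
apply/eqP; rewrite -subr_eq0; apply/eqP/rnorm_eq0; rewrite -ly.
have [lD lZ _] := bl.
have := lD (x - y) y; rewrite subrK (h _ bl); lra.
Qed.

Lemma rnorm_le_functional x (c : R) :
  (forall l, bounded_real_linear l -> (forall y, `|l y| <= rnorm y) -> l x <= c) -> rnorm x <= c.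
Proof. by move=> h; have [l [bl lb <-]] := norming_functional x; exact: h. Qed.

End HahnBanach.

(** * Strong measurability *)

Section StronglyMeasurable.
Context {R : realType} {X : completeNormedModType R[i]}.
Notation mu := (@lebesgue_measure R).
Implicit Types (h : R -> X) (x : X).

(* The countably-valued approximants are encoded by an index function [i n] and its
   values [c n], since [X] carries no sigma-algebra and need not be separable. *)
Definition strongly_measurable h := exists (I : countType) (i : nat -> R -> I) (c : nat -> I -> X),
  (forall n m, measurable [set t | i n t = m]) /\
  forall t, (fun n => c n (i n t)) @ \oo --> h t.

Lemma measurable_countable_comp (I : countType) (i : R -> I) (g : I -> R) :
  (forall m, measurable [set t | i t = m]) -> measurable_fun setT (g \o i).
Proof.
move=> mi _ Y mY; rewrite setTI.
have -> : (g \o i) @^-1` Y = \bigcup_(n in [set n | exists m, unpickle n = Some m /\ Y (g m)])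
    [set t | unpickle n = Some (i t)].
  apply/seteqP; split=> t /=.
    move=> Yt; exists (pickle (i t)); last by rewrite /= pickleK.
    by exists (i t); rewrite pickleK.
  move=> [n [m [e Ym]] /=]; rewrite e => -[<-] //.
apply: bigcup_measurable => n [m [e _]].
rewrite e; have := mi m; congr measurable; apply/seteqP; split => t /=; congruence.
Qed.

Lemma strongly_measurable_real h (phi : X -> R) : strongly_measurable h ->
  continuous phi -> measurable_fun setT (phi \o h).
Proof.
move=> [I [i [c [mi cv]]]] cphi.
apply: (@measurable_fun_cvg _ _ _ _ (fun n => (fun m => phi (c n m)) \o i n)).
  by move=> n; exact: measurable_countable_comp.
by move=> t _; apply: continuous_cvg; [exact: cphi|exact: cv].
Qed.

Lemma strongly_measurable_comp h (phi : X -> X) : strongly_measurable h ->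
  continuous phi -> strongly_measurable (phi \o h).
Proof.
move=> [I [i [c [mi cv]]]] cphi; exists I, i, (fun n m => phi (c n m)); split => // t.
by apply: continuous_cvg; [exact: cphi|exact: cv].
Qed.

Lemma strongly_measurable_cst x : strongly_measurable (fun=> x).
Proof.
exists unit, (fun _ _ => tt), (fun _ _ => x); split=> [n []|t]; last exact: cvg_cst.
by rewrite (_ : [set _ | _] = setT) //; apply/seteqP; split.
Qed.

Lemma strongly_measurableD h1 h2 : strongly_measurable h1 -> strongly_measurable h2 ->
  strongly_measurable (fun t => h1 t + h2 t).
Proof.
move=> [I [i [c [mi cv]]]] [J [j [d [mj cw]]]].
exists (I * J)%type, (fun n t => (i n t, j n t)), (fun n m => c n m.1 + d n m.2); split.
  move=> n [m1 m2].
  rewrite (_ : [set _ | _] = [set t | i n t = m1] `&` [set t | j n t = m2]).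
    exact: measurableI.
  by apply/seteqP; split => t /= [-> ->].
by move=> t; apply: cvgD; [exact: cv|exact: cw].
Qed.

Lemma strongly_measurable_affine h (k d : R) : strongly_measurable h ->
  strongly_measurable (fun t => h (k * t + d)).
Proof.
move=> [I [i [c [mi cv]]]].
exists I, (fun n t => i n (k * t + d)), c; split=> [n m|t]; last exact: cv.
have := @measurable_affine R k d measurableT _ (mi n m).
by rewrite setTI.
Qed.

Lemma measurable_floor_fiber (a : R -> R) (n : R) (m : int) : measurable_fun setT a ->
  measurable [set t | Num.floor (n * a t) = m].
Proof.
move=> ma.
have mna : measurable_fun setT (fun t => n * a t) by exact: measurable_funM.
have := mna measurableT `[m%:~R, (m + 1)%:~R[%classic; rewrite setTI => /(_ (measurable_itv _)).
congr measurable; apply/seteqP; split => t /=.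
  by rewrite in_itv /= => /floor_def.
by move=> <-; rewrite in_itv /= floor_le floorD1_gt.
Qed.

Lemma cvg_floor (a : R) : (fun n => (Num.floor (n.+1%:R * a))%:~R / n.+1%:R) @ \oo --> a.
Proof.
apply/cvgrPdist_le => e e0.
have [N hN] : exists N : nat, forall n, (N <= n)%N -> n.+1%:R^-1 <= e.
  have /cvgrPdist_le/(_ e e0) [N _ hN] := @cvg_harmonic R.
  exists N => n nN; have := hN n nN; rewrite /= sub0r normrN ger0_norm //.
exists N => // n /= nN.
have n0 : 0 < n.+1%:R :> R by rewrite ltr0n.
have f1 := @floor_le R (n.+1%:R * a).
have f2 := @floorD1_gt R (n.+1%:R * a).
rewrite intrD in f2.
apply: le_trans (hN n nN).
have -> : a - (Num.floor (n.+1%:R * a))%:~R / n.+1%:R =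
   (n.+1%:R * a - (Num.floor (n.+1%:R * a))%:~R) / n.+1%:R by field; rewrite gt_eqF.
rewrite normrM (@ger0_norm _ n.+1%:R^-1) // ler_piMl //.
by rewrite ger0_norm; lra.
Qed.

(** The scalar factor is discretised by [floor], so the pair of this integer and the index still
    ranges over a countable type. *)
Lemma strongly_measurableZ h (a : R -> R) : measurable_fun setT a -> strongly_measurable h ->
  strongly_measurable (fun t => (a t)%:C *: h t).
Proof.
move=> ma [I [i [c [mi cv]]]].
exists (int * I)%type, (fun n t => (Num.floor (n.+1%:R * a t), i n t)),
  (fun n m => (m.1%:~R / n.+1%:R)%:C *: c n m.2); split.
  move=> n [m1 m2].
  rewrite (_ : [set _ | _] = [set t | Num.floor (n.+1%:R * a t) = m1] `&` [set t | i n t = m2]).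
    by apply: measurableI => //; exact: measurable_floor_fiber.
  by apply/seteqP; split => t /= [-> ->].
move=> t.
exact: (cvg_scale_real (@cvg_floor (a t)) (cv t)).
Qed.

Lemma strongly_measurableZc h (c : R[i]) : strongly_measurable h ->
  strongly_measurable (fun t => c *: h t).
Proof.
move=> mh; apply: (@strongly_measurable_comp h (fun x => c *: x)) => // x.
exact: scaler_continuous.
Qed.

Lemma ext0E (D : set R) h t : ext0 D h t = if t \in D then h t else 0.
Proof. by []. Qed.

Lemma strongly_measurable_ext0 h (D : set R) : measurable D -> strongly_measurable h ->
  strongly_measurable (ext0 D h).
Proof.
move=> mD mh.
have -> : ext0 D h = (fun t => (\1_D t : R)%:C *: h t).
  apply/funext => t; rewrite ext0E indicE; case: ifP => _.
    by rewrite scale1r.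
  by rewrite scale0r.
by apply: strongly_measurableZ => //; exact: measurable_indic.
Qed.

(** The extension by 0 may jump at 0, so [h] is sampled only at nonnegative points: both the
    argument and the sample points are clamped to the half-line, where [h] is continuous. *)
Lemma strongly_measurable_halfline h : {within Rplus, continuous h} ->
  (forall t, t < 0 -> h t = 0) -> strongly_measurable h.
Proof.
move=> ch h0.
pose p (t : R) : R := Num.max 0 t.
have mp : measurable_fun setT p by apply: measurable_maxr => //; exact: measurable_cst.
have -> : h = ext0 Rplus h.
  apply/funext => t; rewrite ext0E; case: ifPn => // /negP; rewrite inE /Rplus /= in_itv /= andbT.
  by move=> /negP; rewrite -ltNge => /h0.
have -> : ext0 Rplus h = ext0 Rplus (fun t => h (p t)).
  apply/funext => t; rewrite !ext0E; case: ifPn => //.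
  rewrite inE /Rplus /= in_itv /= andbT => t0.
  by rewrite /p max_r.
apply: strongly_measurable_ext0; first exact: measurable_itv.
exists int, (fun n t => Num.floor (n.+1%:R * p t)), (fun n m => h (Num.max 0 (m%:~R / n.+1%:R))); split.
  by move=> n m; exact: measurable_floor_fiber.
move=> t.
have pt0 : 0 <= p t by rewrite /p le_max lexx.
have cw : h @ within Rplus (nbhs (p t)) --> h (p t).
  have := ch (p t); rewrite /prop_for /continuous_at.
  by rewrite nbhs_subspace_in // /Rplus /= in_itv /= pt0.
apply: (@cvg_comp _ _ _ (fun n => Num.max 0 ((Num.floor (n.+1%:R * p t))%:~R / n.+1%:R)) h _
    (within Rplus (nbhs (p t)))) => //.
move=> U; rewrite /within /= => wU.
have cv : (fun n => Num.max 0 ((Num.floor (n.+1%:R * p t))%:~R / n.+1%:R : R)) @ \oo --> p t.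
  apply/cvgrPdist_le => e e0; have /cvgrPdist_le/(_ e e0) := @cvg_floor (p t).
  apply: filterS => n; apply: le_trans; move: (_ / _ : R) => z.
  rewrite /Num.max; case: ltP => // z0.
  by rewrite subr0 !ger0_norm //; lra.
have := cv _ wU; rewrite /= /nbhs /=; apply: filterS => n; apply.
by rewrite /Rplus /= in_itv /= le_max lexx.
Qed.

Lemma rnorm_continuous : continuous (@rnorm R X).
Proof. by move=> x; apply: cvg_rnorm; exact: cvg_id. Qed.

Lemma real_linear_continuous (l : X -> R) : bounded_real_linear l -> continuous l.
Proof.
move=> [lD lZ [M lM]] x.
have lB y z : l y - l z = l (y - z).
  by have := lD (y - z) z; rewrite subrK => ->; rewrite addrK.
apply/cvgrPdist_le => e e0.
have M0 : 0 < `|M| + 1 by rewrite ltr_wpDl.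
have h : (id : X -> X) @ x --> x by exact: cvg_id.
have /cvg_rnormP/(_ (e / (`|M| + 1)) (divr_gt0 e0 M0)) := h.
apply: filterS => y; rewrite /= lB ler_pdivlMr // => h1.
apply: (le_trans (lM _)); apply: le_trans h1; rewrite mulrC ler_wpM2l ?rnorm_ge0 //.
by rewrite (le_trans (ler_norm _)) // lerDl.
Qed.

Lemma measurable_rnorm h : strongly_measurable h -> measurable_fun setT (fun t => rnorm (h t)).
Proof. by move=> mh; exact: (strongly_measurable_real mh rnorm_continuous). Qed.

Lemma measurable_functional h (l : X -> R) : bounded_real_linear l -> strongly_measurable h ->
  measurable_fun setT (fun t => l (h t)).
Proof. by move=> bl mh; exact: (strongly_measurable_real mh (real_linear_continuous bl)). Qed.

End StronglyMeasurable.

(** * Existence of Bochner integrals and their values under functionals *)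

Section Bochner.
Context {R : realType} {X : completeNormedModType R[i]}.
Notation mu := (@lebesgue_measure R).
Implicit Types (f h : R -> X) (x : X) (D : set R) (l : X -> R).

Definition vintegrable f := strongly_measurable f /\ integrableR (fun t => rnorm (f t)).

Lemma functional_dom l : bounded_real_linear l -> exists2 M, 0 <= M & forall x, `|l x| <= M * rnorm x.
Proof.
move=> [_ _ [M lM]]; exists `|M| => // x; apply: (le_trans (lM x)).
by rewrite ler_wpM2r ?rnorm_ge0 // ler_norm.
Qed.

Lemma vintegrable_functional f l : vintegrable f -> bounded_real_linear l ->
  integrableR (fun t => l (f t)).
Proof.
move=> [mf nf] bl; have [M M0 lM] := functional_dom bl.
apply: (integrableR_le _ (integrableRZ M nf)) => //.
exact: measurable_functional.
Qed.

Lemma functional0 l : bounded_real_linear l -> l 0 = 0.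
Proof. by move=> [lD _ _]; have := lD 0 0; rewrite addr0; lra. Qed.

Lemma functional_sum l (I : Type) (s : seq I) (F : I -> X) : bounded_real_linear l ->
  l (\sum_(i <- s) F i) = \sum_(i <- s) l (F i).
Proof.
move=> bl; elim: s => [|i s IH]; first by rewrite !big_nil functional0.
by have [lD _ _] := bl; rewrite !big_cons lD IH.
Qed.

Lemma simple_integral_functional D (s : R -> X) l : measurable D -> bochner_simple D s ->
  bounded_real_linear l ->
  integrableR (fun t => l (ext0 D s t)) /\
  l (simple_integral D s) = \int[mu]_t l (ext0 D s t).
Proof.
move=> mD [fs ms mus] bl.
pose L x := D `&` s @^-1` [set x].
have mL x : measurable (L x) by apply: measurableI => //; exact: ms.
pose e x t : R := l x * \1_(L x) t.
have ie x : integrableR (e x).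
  have [->|x0] := eqVneq x 0.
    have -> : e 0 = fun=> 0 by apply/funext => t; rewrite /e functional0 // mul0r.
    exact: integrable0.
  by apply/integrableRZ/integrableR_indic => //; exact: mus.
have Ie x : \int[mu]_t e x t = fine (mu (L x)) * l x.
  have [->|x0] := eqVneq x 0.
    rewrite functional0 // mulr0 /e; under eq_Rintegral => t _ do rewrite functional0 // mul0r.
    by rewrite Rintegral_cst // mul0r.
  rewrite /e RintZ; last by apply: integrableR_indic => //; exact: mus.
  by rewrite Rint_indic // mulrC.
pose r : seq X := finmap.enum_fset (fset_set (range s)).
have rs t : s t \in r by have := in_fset_set fs (s t) => ->; rewrite inE; exists t.
have E : (fun t => l (ext0 D s t)) = fun t => \sum_(x <- r) e x t.
  apply/funext => t; rewrite ext0E; case: ifPn => [/set_mem Dt|/negP nD].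
    rewrite (bigD1_seq (s t)) //=; last exact: finmap.fset_uniq.
    rewrite big1 ?addr0 => [|x xst].
      by rewrite /e indicE mem_set ?mulr1.
    rewrite /e indicE memNset ?mulr0 // => -[_ /= h].
    by rewrite h eqxx in xst.
  rewrite functional0 // big1 // => x _.
  by rewrite /e indicE memNset ?mulr0 // => -[Dt _]; apply: nD; rewrite inE.
have [i1 i2] := Rint_sum r ie.
rewrite E i2; split => //.
rewrite /simple_integral fsbig_finite // functional_sum //; apply: eq_bigr => x _.
by have [_ lZ _] := bl; rewrite lZ Ie.
Qed.

Lemma bochner_simple_measurable D (s : R -> X) : bochner_simple D s -> strongly_measurable s.
Proof.
move=> [fs ms _].
pose e : seq X := finmap.enum_fset (fset_set (range s)).
have se t : s t \in e by have := in_fset_set fs (s t) => ->; rewrite inE; exists t.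
exists nat, (fun _ t => index (s t) e), (fun _ n => nth 0 e n); split.
  move=> _ n.
  have [ne|ne] := ltnP n (size e); last first.
    rewrite (_ : [set _ | _] = set0) //; apply/seteqP; split => t //= h.
    by have := se t; rewrite -index_mem h ltnNge ne.
  rewrite (_ : [set _ | _] = s @^-1` [set nth 0 e n]) //.
  apply/seteqP; split => t /= h; first by rewrite -h nth_index.
  by rewrite h index_uniq //; exact: finmap.fset_uniq.
by move=> t; rewrite nth_index //; exact: cvg_cst.
Qed.

Lemma vintegrableB f g : strongly_measurable f -> strongly_measurable g ->
  strongly_measurable (fun t => f t - g t).
Proof.
move=> mf mg; apply: strongly_measurableD => //.
have -> : (fun t => - g t) = (fun t => (-1 : R[i]) *: g t).
  by apply/funext => t; rewrite scaleN1r.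
exact: strongly_measurableZc.
Qed.

(** The numbers [l (simple_integral D (s n))] have two limits: l v by continuity of [l], and the
    real integral because the simple functions converge in L1. *)
Lemma is_bochner_functional D f v l : measurable D -> vintegrable (ext0 D f) ->
  is_bochner D f v -> bounded_real_linear l -> l v = \int[mu]_t l (ext0 D f t).
Proof.
move=> mD vf [s [ss _ sf sv]] bl.
have [M M0 lM] := functional_dom bl.
have il := vintegrable_functional vf bl.
have c1 : (fun n => l (simple_integral D (s n))) @ \oo --> l v.
  by apply: continuous_cvg => //; exact: real_linear_continuous.
have c2 : (fun n => l (simple_integral D (s n))) @ \oo --> \int[mu]_t l (ext0 D f t).
  apply/cvgrPdist_le => e e0.
  have [fn sf0] := (fine_cvgP _ _).1 sf.
  (* The bound [M] may be 0, hence the division by M + 1. *)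
  have e1 : 0 < e / (M + 1) by rewrite divr_gt0 // ltr_wpDl.
  have sfe : \forall n \near \oo, (fine \o (fun n => (\int[mu]_(t in D) (rnorm (f t - s n
      t))%:E)%E)) n < e / (M + 1).
    by exact: (cvgr_lt _ sf0).
  near=> n.
  have hn1 : (\int[mu]_(t in D) (rnorm (f t - s n t))%:E)%E \is a fin_num by near: n; exact: fn.
  have hn2 : fine (\int[mu]_(t in D) (rnorm (f t - s n t))%:E)%E < e / (M + 1) by near: n; exact: sfe.
  have [i1 i2] := simple_integral_functional mD (ss n) bl.
  have mg : strongly_measurable (fun t => ext0 D f t - ext0 D (s n) t).
    apply: vintegrableB; first by case: vf.
    by apply: strongly_measurable_ext0 => //; exact: bochner_simple_measurable (ss n).
  have gE : (\int[mu]_t (rnorm (ext0 D f t - ext0 D (s n) t))%:E)%E = (\int[mu]_(t in D) (rnorm (f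
      t - s n t))%:E)%E.
    rewrite [RHS]integral_mkcond; apply: eq_integral => t _.
    by rewrite patchE !ext0E; case: ifP => // _; rewrite subr0 rnorm0.
  have ig : integrableR (fun t => rnorm (ext0 D f t - ext0 D (s n) t)).
    apply/integrableP; split; first by apply/measurable_EFinP; exact: measurable_rnorm.
    under eq_integral => t _ do rewrite /= ger0_norm ?rnorm_ge0 //.
    by rewrite gE ltey_eq hn1.
  rewrite i2 -RintB //.
  apply: (le_trans (Rint_norm_le (integrableRB il i1))).
  apply: (@le_trans _ _ (\int[mu]_t (M * rnorm (ext0 D f t - ext0 D (s n) t)))).
    apply: Rint_le; [exact/integrableR_norm/integrableRB|exact: integrableRZ|].
    move=> t; apply: le_trans (lM _).
    have [lD lZ _] := bl.
    have := lD (ext0 D f t - ext0 D (s n) t) (ext0 D (s n) t); rewrite subrK => ->.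
    by rewrite addrK.
  rewrite RintZ // {1}/Rintegral gE.
  apply: (@le_trans _ _ (M * (e / (M + 1)))); first by rewrite ler_wpM2l // ltW.
  have M1 : 0 < M + 1 by rewrite ltr_wpDl.
  by rewrite mulrA ler_pdivrMr // mulrC ler_pM2l // lerDl.
exact: (cvg_unique _ c1 c2).
Unshelve. all: by end_near.
Qed.

Section Approximation.
Context (D : set R) (f : R -> X).
Context (mD : measurable D) (vf : vintegrable (ext0 D f)).
Let g := ext0 D f.

(** The values of the countably valued approximants accumulate at every value of [g], which replaces
    separability of X. The first term 0 makes a nearest-point approximation never farther from [g t]
    than 0 is. *)
Let dense_seq : exists x_ : nat -> X, x_ 0%N = 0 /\
  forall t (e : R), 0 < e -> exists k, rnorm (g t - x_ k) < e.
Proof.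
have [[I [i [c [_ cv]]]] _] := vf.
exists (fun k => if k is k'.+1 then
    (if @unpickle (nat * I)%type k' is Some z then c z.1 z.2 else 0) else 0); split => // t e e0.
have /cvg_rnormP /(_ (e / 2) (divr_gt0 e0 (ltr0n _ 2))) [N _ /(_ N (leqnn N)) /= h] := cv t.
exists (pickle (N, i N t)).+1; rewrite pickleK /=; apply: le_lt_trans h _; lra.
Qed.

Let x_ := sval (cid dense_seq).
Let x0 : x_ 0%N = 0. Proof. exact: (svalP (cid dense_seq)).1. Qed.
Let xd t (e : R) : 0 < e -> exists k, rnorm (g t - x_ k) < e.
Proof. exact: (svalP (cid dense_seq)).2. Qed.

(* [approx n t] is a closest point to [ext0 D f t] among the first [n + 1] terms
   of a sequence that starts with 0 and accumulates at every value of [ext0 D f]. *)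
Let approx : nat -> R -> X := fix approx n t := if n is n'.+1 then
  (if rnorm (g t - x_ n) < rnorm (g t - approx n' t) then x_ n else approx n' t) else 0.

Let approx_le n k t : (k <= n)%N -> rnorm (g t - approx n t) <= rnorm (g t - x_ k).
Proof.
elim: n k => [|n IH] k /=; first by rewrite leqn0 => /eqP ->; rewrite x0.
rewrite leq_eqVlt => /orP[/eqP ->|]; first by case: ltP => // /ltW.
rewrite ltnS => /IH h; case: ltP => // h'.
exact: le_trans (ltW h') h.
Qed.

Let approx_dom n t : rnorm (g t - approx n t) <= rnorm (g t).
Proof. by have := approx_le t (leq0n n); rewrite x0 subr0. Qed.

Let mg : strongly_measurable g. Proof. by case: vf. Qed.

Let measurable_dist x : measurable_fun setT (fun t => rnorm (g t - x)).
Proof. by apply: measurable_rnorm; apply: vintegrableB => //; exact: strongly_measurable_cst. Qed.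

Let approx_simple n : [/\ finite_set (range (approx n)),
  forall x, measurable (approx n @^-1` [set x]) &
  measurable_fun setT (fun t => rnorm (g t - approx n t))].
Proof.
elim: n => [|n [fin ms md]].
  split.
  - by apply: (@sub_finite_set _ _ [set 0]); [move=> _ [t _ <-]|exact: finite_set1].
  - move=> x; have [e|e] := pselect (x = 0).
      by rewrite (_ : _ @^-1` _ = setT) //; apply/seteqP; split => // t _ /=.
    by rewrite (_ : _ @^-1` _ = set0) //; apply/seteqP; split => // t /= h; apply: e.
  - exact: measurable_dist.
pose A := [set t | rnorm (g t - x_ n.+1) < rnorm (g t - approx n t)].
have mA : measurable A.
  have := measurable_fun_ltr (measurable_dist (x_ n.+1)) md measurableT (I : measurable [set true]).
  by rewrite setTI.
have E t : approx n.+1 t = if rnorm (g t - x_ n.+1) < rnorm (g t - approx n t) then x_ n.+1 else approx n t.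
  by [].
split.
- apply: (@sub_finite_set _ _ ([set x_ n.+1] `|` range (approx n))).
    move=> _ [t _ <-]; rewrite E; case: ifP => _; first by left.
    by right; exists t.
  by rewrite finite_setU.
- move=> x; rewrite (_ : _ @^-1` _ = (A `&` [set t | x_ n.+1 = x]) `|` (~` A `&` approx n @^-1` [set x])).
    apply: measurableU; apply: measurableI => //; last exact: measurableC.
    have [e|e] := pselect (x_ n.+1 = x).
      by rewrite (_ : [set _ | _] = setT) //; apply/seteqP; split.
    by rewrite (_ : [set _ | _] = set0) //; apply/seteqP; split.
  apply/seteqP; split => t.
    move=> h; have {h} : (if rnorm (g t - x_ n.+1) < rnorm (g t - approx n t) then x_ n.+1 else
        approx n t) = x := h.
    by case: ifP => h hx; [left|right; split => //; rewrite /A /= h].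
  move=> h; suff : (if rnorm (g t - x_ n.+1) < rnorm (g t - approx n t) then x_ n.+1 else approx n
      t) = x by [].
  by case: h => [[/= -> //]|[/negP/negbTE -> //]].
- have -> : (fun t => rnorm (g t - approx n.+1 t)) =
     (fun t => Num.min (rnorm (g t - x_ n.+1)) (rnorm (g t - approx n t))).
    by apply/funext => t; rewrite E /Num.min; case: ifP.
  exact: measurable_minr.
Qed.

Let approx0 n t : ~ D t -> approx n t = 0.
Proof.
move=> nD; have g0 : g t = 0 by rewrite /g ext0E memNset.
apply: rnorm_eq0; apply/eqP; rewrite eq_le rnorm_ge0 andbT.
by have := approx_dom n t; rewrite g0 sub0r rnormN rnorm0.
Qed.

(** Where the approximation equals [x], [approx_dom] gives rnorm x <= 2 rnorm (g t), so Markov's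
    inequality bounds the measure of that set. *)
Let approx_bochner_simple n : bochner_simple D (approx n).
Proof.
have [fin ms _] := approx_simple n; split => // x xn0.
have x_gt0 : 0 < rnorm x.
  by rewrite lt_neqAle rnorm_ge0 andbT eq_sym; apply/eqP => /rnorm_eq0 h; rewrite h eqxx in xn0.
set L := D `&` _.
have mL : measurable L by apply: measurableI => //; exact: ms.
have ig : integrableR (fun t => 2 * rnorm (g t)) by apply: integrableRZ; case: vf.
have : (\int[mu]_(t in L) (rnorm x)%:E < +oo)%E.
  apply: (@le_lt_trans _ _ (\int[mu]_(t in L) (2 * rnorm (g t))%:E)%E).
    apply: ge0_le_integral => //.
    - by move=> t _; rewrite lee_fin ltW.
    - by apply: measurable_funTS; apply/measurable_EFinP; exact: integrableR_measurable ig.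
    - move=> t [_ /= <-]; rewrite lee_fin.
      have := ler_rnormB (g t) (g t - approx n t); rewrite subKr.
      by have := approx_dom n t; lra.
  apply: (@le_lt_trans _ _ (\int[mu]_t (2 * rnorm (g t))%:E)%E).
    apply: ge0_subset_integral => //.
      by apply/measurable_EFinP; exact: integrableR_measurable ig.
    by move=> t _; rewrite lee_fin mulr_ge0 // rnorm_ge0.
  by rewrite integral_EFinR // ltry.
rewrite integral_cst // => h; rewrite ltNge leye_eq; apply/negP => /eqP e.
have {h} : ((rnorm x)%:E * mu L < +oo)%E := h.
by rewrite e gt0_muley ?ltxx // lte_fin.
Qed.

Let err n := \int[mu]_t rnorm (g t - approx n t).

Let cvg_approx t : (fun n => approx n t) @ \oo --> g t.
Proof.
apply/cvg_rnormP => e e0; have [k hk] := xd t e0.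
by exists k => // n /= kn; apply: le_trans (approx_le t kn) (ltW hk).
Qed.

Let cvg_err : err @ \oo --> (0 : R).
Proof.
have md n : measurable_fun setT (fun t => rnorm (g t - approx n t)) by have [] := approx_simple n.
have [] := @Rint_dominated R (fun n t => rnorm (g t - approx n t)) (fun=> 0) (fun t => rnorm (g t)) md.
- exact: measurable_cst.
- by apply: aeW => t; apply/cvg_rnorm0P; exact: cvg_approx.
- by case: vf.
- by move=> n t; rewrite ger0_norm ?rnorm_ge0 // approx_dom.
by move=> _ _; rewrite Rintegral_cst // mul0r.
Qed.

Let integrable_err n : integrableR (fun t => rnorm (g t - approx n t)).
Proof.
have [_ _ md] := approx_simple n; apply: (integrableR_le md vf.2) => t.
by rewrite ger0_norm ?rnorm_ge0 // approx_dom.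
Qed.

Let err_functional l n : bounded_real_linear l -> (forall y, `|l y| <= rnorm y) ->
  `|l (simple_integral D (approx n)) - \int[mu]_t l (g t)| <= err n.
Proof.
move=> bl lb; have il := vintegrable_functional vf bl.
have [i1 ->] := simple_integral_functional mD (approx_bochner_simple n) bl.
have E t : ext0 D (approx n) t = approx n t.
  by rewrite ext0E; case: ifPn => // /negP; rewrite inE => /(@approx0 n) ->.
rewrite -RintB //; apply: le_trans (Rint_norm_le (integrableRB i1 il)) _.
apply: Rint_le => //; first exact/integrableR_norm/integrableRB.
move=> t; rewrite E distrC; apply: le_trans (lb _).
have [lD _ _] := bl.
by have := lD (g t - approx n t) (approx n t); rewrite subrK => ->; rewrite addrK.
Qed.

(** The simple integrals are Cauchy: under any functional of norm at most 1, the n-th one lies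
    within [err n] of one and the same real integral. *)
Lemma bochner_exists : exists v, is_bochner D f v.
Proof.
have cauchy_sum n m : rnorm (simple_integral D (approx n) - simple_integral D (approx m)) <= err n + err m.
  apply: rnorm_le_functional => l bl lb.
  have h1 := err_functional n bl lb; have h2 := err_functional m bl lb.
  have [lD _ _] := bl.
  have := lD (simple_integral D (approx n) - simple_integral D (approx m)) (simple_integral D (approx m)).
  rewrite subrK; move: h1 h2; rewrite !ler_norml => /andP[a1 a2] /andP[b1 b2]; lra.
have : cvg ((fun n => simple_integral D (approx n)) @ \oo).
  apply/cauchy_cvgP; apply: cauchy_exP => e e0.
  have [e1 e2] : e = (complex.Re e)%:C /\ 0 < complex.Re e.
    by move: e0; case: e => u v; rewrite ltcE /= => /andP[/eqP -> ?].
  have /cvgrPdist_lt /(_ (complex.Re e / 2) (divr_gt0 e2 (ltr0n _ 2))) [N _ hN] := cvg_err.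
  exists (simple_integral D (approx N)), N => // n /= nN.
  rewrite -ball_normE /= e1 rnormE ltcR.
  apply: (le_lt_trans (cauchy_sum N n)).
  have := hN n nN; have := hN N (leqnn N); rewrite /= !sub0r !normrN.
  have := ler_norm (err n); have := ler_norm (err N); lra.
move=> /cvg_ex[v hv]; exists v; exists approx; split => //.
- exists set0; split; [exact: measurable0|exact: measure0|move=> t /=; apply => Dt].
  by have := @cvg_approx t; rewrite /g ext0E mem_set.
- have -> : (fun n => (\int[mu]_(t in D) (rnorm (f t - approx n t))%:E)%E) = EFin \o err.
    apply/funext => n /=; rewrite /err -integral_EFinR //.
    rewrite integral_mkcond; apply: eq_integral => t _.
    rewrite patchE /g ext0E; case: ifPn => // /negP; rewrite inE => nD.
    by rewrite approx0 // subrr rnorm0.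
  by apply/fine_cvgP; split; [exact: nearW|exact: cvg_err].
Qed.

End Approximation.

(** With [functional_separation], this is how the integral is handled from here on: an identity of
    vector integrals is checked under each real functional. *)
Lemma bochner_functional D f l : measurable D -> vintegrable (ext0 D f) ->
  bounded_real_linear l -> l (bochner D f) = \int[mu]_t l (ext0 D f t).
Proof.
move=> mD vf bl; apply: is_bochner_functional => //.
by have [v hv] := bochner_exists mD vf; rewrite /bochner; exact: (@xgetI _ _ _ v hv).
Qed.

End Bochner.

(** * Averages *)

Section Average.
Context {R : realType} {X : completeNormedModType R[i]}.
Notation mu := (@lebesgue_measure R).
Implicit Types (f h : R -> X) (x : X) (D : set R) (l : X -> R) (a b c : R -> R).

Definition bounded_by h (M : R) := forall t, rnorm (h t) <= M.

Definition bounded_measurable h := strongly_measurable h /\ exists M, bounded_by h M.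

(* Locked, since unification would otherwise compare averages by unfolding them. *)
Fact avg_key : unit. Proof. exact: tt. Qed.
Definition avg : (R -> R) -> (R -> X) -> R -> X := locked_with avg_key
  (fun a h t => bochner setT (fun s => (a s)%:C *: h (t + s))).

Lemma avgE a h t : avg a h t = bochner setT (fun s => (a s)%:C *: h (t + s)).
Proof. by rewrite /avg unlock. Qed.

Lemma ext0T f : ext0 setT f = f.
Proof. by apply/funext => t; rewrite ext0E in_setT. Qed.

Lemma functionalN l x : bounded_real_linear l -> l (- x) = - l x.
Proof.
move=> bl; have [lD _ _] := bl.
by have := lD x (- x); rewrite subrr functional0 //; lra.
Qed.

Lemma functionalB l x y : bounded_real_linear l -> l (x - y) = l x - l y.
Proof. by move=> bl; have [lD _ _] := bl; rewrite lD functionalN. Qed.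

Lemma bounded_by_ge0 h M : bounded_by h M -> 0 <= M.
Proof. by move=> /(_ 0); apply: le_trans; exact: rnorm_ge0. Qed.

Lemma strongly_measurable_translate h t : strongly_measurable h ->
  strongly_measurable (fun s => h (t + s)).
Proof.
move=> mh; have := strongly_measurable_affine 1 t mh.
by under eq_fun do rewrite mul1r addrC.
Qed.

Lemma bounded_measurable_translate h t : bounded_measurable h ->
  bounded_measurable (fun s => h (t + s)).
Proof.
move=> [mh [M hM]]; split; first exact: strongly_measurable_translate.
by exists M => s; exact: hM.
Qed.

Lemma vintegrable_kernel a h : integrableR a -> bounded_measurable h ->
  vintegrable (fun s => (a s)%:C *: h s).
Proof.
move=> ia [mh [M hM]].
have ma := integrableR_measurable ia.
have mah : strongly_measurable (fun s => (a s)%:C *: h s) by exact: strongly_measurableZ.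
split => //; apply: (integrableR_le _ (integrableRZ M (integrableR_norm ia))).
  exact: measurable_rnorm.
move=> s; rewrite ger0_norm ?rnorm_ge0 // rnormZr mulrC ler_wpM2r //.
Qed.

Lemma avg_functional a h l t : integrableR a -> bounded_measurable h ->
  bounded_real_linear l -> l (avg a h t) = \int[mu]_s (a s * l (h (t + s))).
Proof.
move=> ia bh bl.
have vi := vintegrable_kernel ia (bounded_measurable_translate t bh).
rewrite avgE (bochner_functional measurableT _ bl) ext0T //.
by apply: eq_Rintegral => s _; have [_ lZ _] := bl; rewrite lZ.
Qed.

Lemma eq_avg_support a h1 h2 t : (forall s, a s != 0 -> h1 (t + s) = h2 (t + s)) ->
  avg a h1 t = avg a h2 t.
Proof.
move=> e; rewrite !avgE; congr bochner; apply/funext => s.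
by have [->|/e ->//] := eqVneq (a s) 0; rewrite !scale0r.
Qed.

Lemma integrableR_functional a h l t : integrableR a -> bounded_measurable h ->
  bounded_real_linear l -> integrableR (fun s => a s * l (h (t + s))).
Proof.
move=> ia bh bl.
have vi := vintegrable_kernel ia (bounded_measurable_translate t bh).
have := vintegrable_functional vi bl; have [_ lZ _] := bl.
by under eq_fun do rewrite lZ.
Qed.

Lemma bochner_avg D f a h t : measurable D -> integrableR a -> bounded_measurable h ->
  ext0 D f = (fun s => (a (s - t))%:C *: h s) -> bochner D f = avg a h t.
Proof.
move=> mD ia bh E.
have ia' := integrable_translate (- t) ia.
have vi : vintegrable (ext0 D f) by rewrite E; exact: vintegrable_kernel.
apply: functional_separation => l bl.
rewrite (bochner_functional mD vi bl) (avg_functional t ia bh bl) E.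
have [_ lZ _] := bl.
have := Rintegral_translate t (integrableR_functional 0 ia' bh bl).
under eq_Rintegral => s _ do rewrite add0r addrK (addrC s).
by move=> ->; apply: eq_Rintegral => s _; rewrite lZ add0r.
Qed.

Lemma complexrealE (c : R[i]) : c = (complex.Re c)%:C + 'i%C * (complex.Im c)%:C.
Proof. by case: c => x y; apply/eqP; rewrite eq_complex /=; apply/andP; split; apply/eqP; ring. Qed.

Lemma strongly_measurable_cscale (c : R -> R[i]) h :
  measurable_fun setT (fun t => complex.Re (c t)) ->
  measurable_fun setT (fun t => complex.Im (c t)) -> strongly_measurable h ->
  strongly_measurable (fun t => c t *: h t).
Proof.
move=> m1 m2 mh; have -> : (fun t => c t *: h t) =
    (fun t => (complex.Re (c t))%:C *: h t + 'i%C *: ((complex.Im (c t))%:C *: h t)).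
  by apply/funext => t; rewrite scalerA -scalerDl -complexrealE.
apply: strongly_measurableD; first exact: strongly_measurableZ.
by apply: strongly_measurableZc; exact: strongly_measurableZ.
Qed.

Lemma functional_mulI l : bounded_real_linear l -> bounded_real_linear (fun x => l ('i%C *: x)).
Proof.
move=> bl; have [lD lZ _] := bl; have [K K0 lK] := functional_dom bl.
split=> [x y|t x|]; first by rewrite scalerDr lD.
  by rewrite scalerA mulrC -scalerA lZ.
exists (K * cabs 'i%C) => x; apply: (le_trans (lK _)).
by rewrite rnormZ mulrA.
Qed.

(** A complex kernel is carried as two real ones, and testing the second with x |-> l (i x) keeps
    every integral real. *)
Lemma bochner_cavg D f a b h t : measurable D -> integrableR a -> integrableR b ->
  bounded_measurable h -> ext0 D f = (fun s => (a (s - t) +i* b (s - t)) *: h s) ->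
  bochner D f = avg a h t + 'i%C *: avg b h t.
Proof.
move=> mD ia ib bh E.
have ia' := integrable_translate (- t) ia; have ib' := integrable_translate (- t) ib.
have va := vintegrable_kernel ia' bh; have vb := vintegrable_kernel ib' bh.
have vE s : ext0 D f s = (a (s - t))%:C *: h s + 'i%C *: ((b (s - t))%:C *: h s).
  by rewrite E scalerA -scalerDl -[LHS]/(_ *: _) [in LHS](complexrealE (_ +i* _)).
have vi : vintegrable (ext0 D f).
  rewrite (funext vE); split.
    by apply: strongly_measurableD; [case: va|apply: strongly_measurableZc; case: vb].
  apply: (integrableR_le _ (integrableRD va.2 (integrableRZ (cabs 'i%C) vb.2))).
    apply: measurable_rnorm.
    by apply: strongly_measurableD; [case: va|apply: strongly_measurableZc; case: vb].
  by move=> s; rewrite ger0_norm ?rnorm_ge0 // -rnormZ; exact: ler_rnormD.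
apply: functional_separation => l bl; have bli := functional_mulI bl.
have [lD lZ _] := bl; have [_ liZ _] := bli.
rewrite (bochner_functional mD vi bl) lD (avg_functional t ia bh bl).
have -> : l ('i%C *: avg b h t) = \int[mu]_s (b s * l ('i%C *: h (t + s))).
  exact: (avg_functional t ib bh bli).
have j1 := integrableR_functional 0 ia' bh bl; have j2 := integrableR_functional 0 ib' bh bli.
have j := integrableRD j1 j2.
under eq_Rintegral => s _ do rewrite vE lD lZ liZ.
have := Rintegral_translate t j.
under eq_Rintegral => s _ do rewrite !add0r addrK (addrC s).
under [X in _ = X -> _]eq_Rintegral => s _ do rewrite !add0r.
move=> <-; rewrite RintD //.
  exact: (integrableR_functional t ia bh bl).
exact: (integrableR_functional t ib bh bli).
Qed.

Lemma avg_le a h M t : integrableR a -> strongly_measurable h -> bounded_by h M ->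
  rnorm (avg a h t) <= norm1 a * M.
Proof.
move=> ia mh hM; have bh : bounded_measurable h by split=> //; exists M.
apply: rnorm_le_functional => l bl lb.
rewrite (avg_functional t ia bh bl).
have ii := integrableR_functional t ia bh bl.
apply: (le_trans (ler_norm _)); apply: (le_trans (Rint_norm_le ii)).
rewrite mulrC -RintZ; last exact: integrableR_norm.
apply: Rint_le; [exact: integrableR_norm|exact/integrableRZ/integrableR_norm|].
move=> s; rewrite normrM mulrC ler_wpM2r //.
by apply: (le_trans (lb _)); exact: hM.
Qed.

Lemma avgD a b h t : integrableR a -> integrableR b -> bounded_measurable h ->
  avg (fun s => a s + b s) h t = avg a h t + avg b h t.
Proof.
move=> ia ib bh; apply: functional_separation => l bl.
have [lD _ _] := bl; rewrite lD.
have e1 := avg_functional t ia bh bl; have e2 := avg_functional t ib bh bl.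
apply: etrans (esym (f_equal2 +%R e1 e2)).
apply: (etrans (avg_functional t (integrableRD ia ib) bh bl)).
have i1 := integrableR_functional t ia bh bl; have i2 := integrableR_functional t ib bh bl.
by rewrite -RintD //; apply: eq_Rintegral => s _; rewrite mulrDl.
Qed.

Lemma avgZ (k : R) a h t : integrableR a -> bounded_measurable h ->
  avg (fun s => k * a s) h t = k%:C *: avg a h t.
Proof.
move=> ia bh; apply: functional_separation => l bl.
have [_ lZ _] := bl.
rewrite lZ (avg_functional t (integrableRZ k ia) bh bl) (avg_functional t ia bh bl).
have i1 := integrableR_functional t ia bh bl.
by rewrite -RintZ //; apply: eq_Rintegral => s _; rewrite mulrA.
Qed.

Lemma avgN a h t : integrableR a -> bounded_measurable h ->
  avg (fun s => - a s) h t = - avg a h t.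
Proof.
move=> ia bh; have := avgZ (-1) t ia bh; rewrite rmorphN1 scaleN1r => <-.
by congr avg; apply/funext => s; rewrite mulN1r.
Qed.

Lemma avgB a b h t : integrableR a -> integrableR b -> bounded_measurable h ->
  avg (fun s => a s - b s) h t = avg a h t - avg b h t.
Proof. by move=> ia ib bh; rewrite avgD ?avgN //; exact: integrableRN. Qed.

Lemma eq_avg a h1 h2 t : (forall s, h1 s = h2 s) -> avg a h1 t = avg a h2 t.
Proof. by move=> e; congr avg; apply/funext. Qed.

Lemma bounded_measurableD h1 h2 : bounded_measurable h1 -> bounded_measurable h2 ->
  bounded_measurable (fun t => h1 t + h2 t).
Proof.
move=> [m1 [M1 hM1]] [m2 [M2 hM2]]; split; first exact: strongly_measurableD.
by exists (M1 + M2) => t; apply: (le_trans (ler_rnormD _ _)); apply: lerD; [exact: hM1|exact: hM2].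
Qed.

Lemma avg_addr a h1 h2 t : integrableR a -> bounded_measurable h1 -> bounded_measurable h2 ->
  avg a (fun s => h1 s + h2 s) t = avg a h1 t + avg a h2 t.
Proof.
move=> ia b1 b2; apply: functional_separation => l bl.
have [lD _ _] := bl; rewrite lD.
have e1 := avg_functional t ia b1 bl; have e2 := avg_functional t ia b2 bl.
apply: etrans (esym (f_equal2 +%R e1 e2)).
apply: (etrans (avg_functional t ia (bounded_measurableD b1 b2) bl)).
have i1 := integrableR_functional t ia b1 bl; have i2 := integrableR_functional t ia b2 bl.
by rewrite -RintD //; apply: eq_Rintegral => s _; rewrite lD mulrDr.
Qed.

Definition bounded_real_map (T : X -> X) :=
  [/\ forall x y, T (x + y) = T x + T y, forall (t : R) x, T (t%:C *: x) = t%:C *: T x &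
   exists M, forall x, rnorm (T x) <= M * rnorm x].

Lemma bounded_real_map_functional T l : bounded_real_map T -> bounded_real_linear l ->
  bounded_real_linear (l \o T).
Proof.
move=> [TD TZ [M TM]] bl; have [lD lZ _] := bl; have [K K0 lK] := functional_dom bl.
split => /= [x y|t x|]; first by rewrite TD lD.
  by rewrite TZ lZ.
exists (K * M) => x; apply: (le_trans (lK _)); rewrite -mulrA ler_wpM2l //.
Qed.

Lemma bounded_real_map_continuous T : bounded_real_map T -> continuous T.
Proof.
move=> [TD TZ [M TM]] x; apply/cvg_rnormP => e e0.
have M0 : 0 < `|M| + 1 by rewrite ltr_wpDl.
have h : (id : X -> X) @ x --> x by exact: cvg_id.
have /cvg_rnormP/(_ (e / (`|M| + 1)) (divr_gt0 e0 M0)) := h.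
apply: filterS => y; rewrite /= ler_pdivlMr // => h1.
have -> : T x - T y = T (x - y) by have := TD (x - y) y; rewrite subrK => ->; rewrite addrK.
apply: (le_trans (TM _)); apply: le_trans h1; rewrite mulrC ler_wpM2l ?rnorm_ge0 //.
by rewrite (le_trans (ler_norm _)) // lerDl.
Qed.

Lemma bounded_measurable_map T h : bounded_real_map T -> bounded_measurable h ->
  bounded_measurable (fun t => T (h t)).
Proof.
move=> bT [mh [M hM]]; split.
  by apply: (strongly_measurable_comp mh); exact: bounded_real_map_continuous.
have [_ _ [K TK]] := bT; exists (`|K| * M) => t.
apply: (le_trans (TK _)); apply: (@le_trans _ _ (`|K| * rnorm (h t))).
  by rewrite ler_wpM2r ?rnorm_ge0 ?ler_norm.
by rewrite ler_wpM2l.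
Qed.

Lemma avg_map T a h t : bounded_real_map T -> integrableR a -> bounded_measurable h ->
  avg a (fun s => T (h s)) t = T (avg a h t).
Proof.
move=> bT ia bh; apply: functional_separation => l bl.
rewrite (avg_functional t ia (bounded_measurable_map bT bh) bl).
by rewrite -(avg_functional t ia bh (bounded_real_map_functional bT bl)).
Qed.

Lemma bounded_real_map_scale (c : R[i]) : bounded_real_map (fun x => c *: x).
Proof.
split=> [x y|t x|]; first exact: scalerDr.
  by rewrite !scalerA mulrC.
by exists (cabs c) => x; rewrite rnormZ.
Qed.

Lemma bounded_measurableZ (c : R[i]) h : bounded_measurable h ->
  bounded_measurable (fun t => c *: h t).
Proof. exact: bounded_measurable_map (bounded_real_map_scale c). Qed.

Lemma avg_scaler (c : R[i]) a h t : integrableR a -> bounded_measurable h ->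
  avg a (fun s => c *: h s) t = c *: avg a h t.
Proof. exact: avg_map (bounded_real_map_scale c). Qed.

Lemma bounded_measurableB h1 h2 : bounded_measurable h1 -> bounded_measurable h2 ->
  bounded_measurable (fun t => h1 t - h2 t).
Proof.
move=> b1 b2; under eq_fun do rewrite -scaleN1r.
exact/bounded_measurableD/bounded_measurableZ.
Qed.

Lemma avg_subr a h1 h2 t : integrableR a -> bounded_measurable h1 -> bounded_measurable h2 ->
  avg a (fun s => h1 s - h2 s) t = avg a h1 t - avg a h2 t.
Proof.
move=> ia b1 b2; rewrite -scaleN1r -(avg_scaler _ t ia b2) -(avg_addr t ia b1 (bounded_measurableZ _ b2)).
by apply: eq_avg => s; rewrite scaleN1r.
Qed.

Lemma avg_translate a h t r : integrableR a -> bounded_measurable h ->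
  avg a h (t + r) = avg (fun s => a (s - r)) h t.
Proof.
move=> ia bh; apply: functional_separation => l bl.
have ia' := integrable_translate (- r) ia.
rewrite (avg_functional (t + r) ia bh bl) (avg_functional t ia' bh bl).
rewrite -(Rintegral_translate r (integrableR_functional t ia' bh bl)).
by apply: eq_Rintegral => s _; rewrite addrK addrA addrAC.
Qed.

(** Moving [t] amounts to moving the kernel, so an average is as regular as its kernel is in L1,
    whatever the regularity of [h]. *)
Lemma avg_dist_translate a h M t r : integrableR a -> strongly_measurable h -> bounded_by h M ->
  rnorm (avg a h (t + r) - avg a h t) <= omega1 a (- r) * M.
Proof.
move=> ia mh hM; have bh : bounded_measurable h by split=> //; exists M.
rewrite avg_translate // -avgB //; last exact: integrable_translate.
by apply: avg_le => //; exact: integrableR_omega.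
Qed.

Lemma avg_continuous a h : integrableR a -> bounded_measurable h -> continuous (avg a h).
Proof.
move=> ia [mh [M hM]] t; apply/cvg_rnormP => e e0.
have M0 := bounded_by_ge0 hM.
have M1 : 0 < M + 1 by rewrite ltr_wpDl.
have [d d0 hd] := omega1_small ia (divr_gt0 e0 M1).
near=> s.
have ts : `|t - s| <= d by near: s; apply: cvgr_dist_le.
have := avg_dist_translate s (t - s) ia mh hM; rewrite [s + _]addrC subrK => h1.
apply: (le_trans h1); apply: (@le_trans _ _ (e / (M + 1) * M)).
  by rewrite ler_wpM2r // hd // normrN.
by rewrite mulrAC ler_pdivrMr // ler_pM2l // lerDl.
Unshelve. all: by end_near.
Qed.

Lemma strongly_measurable_continuous h : continuous h -> strongly_measurable h.
Proof.
move=> ch.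
exists int, (fun n t => Num.floor (n.+1%:R * t)), (fun n m => h (m%:~R / n.+1%:R)); split.
  by move=> n m; exact: (@measurable_floor_fiber R id).
move=> t.
apply: (@cvg_comp _ _ _ (fun n => (Num.floor (n.+1%:R * t))%:~R / n.+1%:R) h _ (nbhs t)); last exact: ch.
exact: cvg_floor.
Qed.

Lemma bounded_measurable_avg a h : integrableR a -> bounded_measurable h ->
  bounded_measurable (avg a h).
Proof.
move=> ia bh; split; first exact/strongly_measurable_continuous/avg_continuous.
have [mh [M hM]] := bh.
by exists (norm1 a * M) => t; exact: avg_le.
Qed.

Lemma functional_bounded h l : bounded_measurable h -> bounded_real_linear l ->
  exists2 K, 0 <= K & forall t, `|l (h t)| <= K.
Proof.
move=> [mh [M hM]] bl; have [K K0 lK] := functional_dom bl.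
exists (K * M); first by rewrite mulr_ge0 //; exact: bounded_by_ge0 hM.
by move=> t; apply: (le_trans (lK _)); rewrite ler_wpM2l.
Qed.

Lemma avg_comm a b h t : integrableR a -> integrableR b -> bounded_measurable h ->
  avg a (avg b h) t = avg b (avg a h) t.
Proof.
move=> ia ib bh; apply: functional_separation => l bl.
have [K K0 lK] := functional_bounded bh bl.
have ml : measurable_fun setT (fun t => l (h t)) by apply: measurable_functional => //; case: bh.
have bb := bounded_measurable_avg ib bh; have ba := bounded_measurable_avg ia bh.
pose f (z : R * R) := a z.1 * (b z.2 * l (h (t + z.1 + z.2))).
have mf : measurable_fun setT f.
  apply: measurable_funM; first by apply: (measurableT_comp (integrableR_measurable ia)).
  apply: measurable_funM; first by apply: (measurableT_comp (integrableR_measurable ib)).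
  apply: (measurableT_comp ml); apply: measurable_funD => //.
  by apply: measurable_funD => //; exact: measurable_cst.
have i0 (x : R) : integrableR (fun y => b y * l (h (t + x + y))) by exact: (integrableR_functional
    (t + x) ib bh bl).
have i1 (x : R) : integrableR (fun y => f (x, y)) by exact: (integrableRZ (a x) (i0 x)).
have i2 y : integrableR (fun x : R => f (x, y)).
  have := integrableRZ (b y) (integrableR_functional (t + y) ia bh bl).
  congr (integrableR _); apply/funext => x; rewrite /f /= addrAC; ring.
have ig : integrableR (fun x : R => norm1 b * K * `|a x|) by exact/integrableRZ/integrableR_norm.
have gf (x : R) : norm1 (fun y => f (x, y)) <= norm1 b * K * `|a x|.
  apply: (@le_trans _ _ (\int[mu]_y (`|a x| * K * `|b y|))).
    apply: Rint_le; [exact: integrableR_norm|exact/integrableRZ/integrableR_norm|].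
    move=> y; rewrite /f /= !normrM -mulrA ler_wpM2l // mulrC ler_wpM2r //.
  rewrite RintZ; last exact: integrableR_norm.
  rewrite -/(norm1 _) le_eqVlt; apply/orP; left; apply/eqP.
  ring.
have [E _ _] := Rint_fubini mf i1 i2 ig gf.
transitivity (\int[mu]_x \int[mu]_y f (x, y)).
  apply: (etrans (avg_functional t ia bb bl)).
  by apply: eq_Rintegral => s _; rewrite (avg_functional (t + s) ib bh bl) -RintZ.
rewrite E; apply/esym; apply: (etrans (avg_functional t ib ba bl)).
apply: eq_Rintegral => s _; rewrite (avg_functional (t + s) ia bh bl).
have i3 := integrableR_functional (t + s) ia bh bl; rewrite -RintZ //.
by apply: eq_Rintegral => r _; rewrite /f /= [t + r + s]addrAC; ring.
Qed.

(** Fubini. Boundedness of [b] makes a s * b (q - s) integrable in s for every q rather than almost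
    every q, as [Rint_fubini] asks. *)
Lemma avg_conv a b (M : R) h t l : integrableR a -> integrableR b -> (forall y, `|b y| <= M) ->
  bounded_measurable h -> bounded_real_linear l ->
  l (avg a (avg b h) t) = \int[mu]_q ((\int[mu]_s (a s * b (q - s))) * l (h (t + q))).
Proof.
move=> ia ib bM bh bl.
have [K K0 lK] := functional_bounded bh bl.
have ml : measurable_fun setT (fun t => l (h t)) by apply: measurable_functional => //; case: bh.
have bb := bounded_measurable_avg ib bh.
rewrite (avg_functional t ia bb bl).
pose f (z : R * R) := a z.1 * (b (z.2 - z.1) * l (h (t + z.2))).
have mf : measurable_fun setT f.
  apply: measurable_funM; first by apply: (measurableT_comp (integrableR_measurable ia)).
  apply: measurable_funM.
    by apply: (measurableT_comp (integrableR_measurable ib)); exact: measurable_funB.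
  by apply: (measurableT_comp ml); apply: measurable_funD => //; exact: measurable_cst.
have ibx (x : R) : integrableR (fun y => b (y - x) * l (h (t + y))).
  exact: (integrableR_functional t (integrable_translate (- x) ib) bh bl).
have ib' (x : R) := integrable_translate (- x) ib.
have i1 (x : R) : integrableR (fun y => f (x, y)) by exact: (integrableRZ (a x) (ibx x)).
have i2 y : integrableR (fun x : R => f (x, y)).
  have := integrableRZ (l (h (t + y))) (integrableR_conv y ia (integrableR_measurable ib) bM).
  congr (integrableR _); apply/funext => x; rewrite /f /=; ring.
have ig : integrableR (fun x : R => norm1 b * K * `|a x|) by exact/integrableRZ/integrableR_norm.
have gf (x : R) : norm1 (fun y => f (x, y)) <= norm1 b * K * `|a x|.
  apply: (@le_trans _ _ (\int[mu]_y (`|a x| * K * `|b (y - x)|))).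
    apply: Rint_le; [exact: (integrableR_norm (i1 x))|exact: (integrableRZ _ (integrableR_norm (ib' x)))|].
    move=> y; rewrite /f /= !normrM -mulrA ler_wpM2l // mulrC ler_wpM2r //.
  rewrite RintZ; last exact: (integrableR_norm (ib' x)).
  rewrite -/(norm1 _) le_eqVlt; apply/orP; left; apply/eqP.
  rewrite (norm1_translate (- x) ib); ring.
have [E _ _] := Rint_fubini mf i1 i2 ig gf.
transitivity (\int[mu]_x \int[mu]_y f (x, y)).
  apply: eq_Rintegral => s _; rewrite (avg_functional (t + s) ib bh bl).
  have := Rintegral_translate s (ibx s).
  under eq_Rintegral => r _ do rewrite addrK [r + s]addrC addrA.
  by move=> ->; rewrite -RintZ.
rewrite E; apply: eq_Rintegral => q _; rewrite mulrC -RintZ; last first.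
  exact: integrableR_conv (integrableR_measurable ib) bM.
by apply: eq_Rintegral => s _; rewrite /f /=; ring.
Qed.

Lemma avg_avg a b c (M : R) h t : integrableR a -> integrableR b -> (forall y, `|b y| <= M) ->
  integrableR c -> (forall y, \int[mu]_s (a s * b (y - s)) = c y) ->
  bounded_measurable h -> avg a (avg b h) t = avg c h t.
Proof.
move=> ia ib bM ic abc bh; apply: functional_separation => l bl.
rewrite (avg_conv t ia ib bM bh bl) (avg_functional t ic bh bl).
by apply: eq_Rintegral => s _; rewrite abc.
Qed.

End Average.

(** * Averaging preserves F *)

Section Modulation.
Context {R : realType} {X : completeNormedModType R[i]}.
Notation mu := (@lebesgue_measure R).
Implicit Types (h : R -> X) (xi t : R).

Definition cis (x : R) : R[i] := cos x +i* sin x.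

Lemma cexp_i xi t : cexp ('i%C * xi%:C * t%:C) = cis (xi * t).
Proof.
have e1 : complex.Re ('i%C * xi%:C * t%:C) = 0 by rewrite /=; ring.
have e2 : complex.Im ('i%C * xi%:C * t%:C) = xi * t by rewrite /=; ring.
by rewrite /cexp e1 e2 expR0 !mul1r.
Qed.

Lemma cisD (x y : R) : cis (x + y) = cis x * cis y.
Proof.
by apply/eqP; rewrite /cis cosD sinD eq_complex /= eqxx /=; apply/eqP; ring.
Qed.

Lemma cis0 : cis 0 = 1.
Proof. by rewrite /cis cos0 sin0. Qed.

Lemma cisNK (x : R) : cis (- x) * cis x = 1.
Proof. by rewrite -cisD addNr cis0. Qed.

Lemma cisKN (x : R) : cis x * cis (- x) = 1.
Proof. by rewrite mulrC cisNK. Qed.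

Lemma cabs_cis (x : R) : cabs (cis x) = 1.
Proof. by rewrite /cabs /cis /= cos2Dsin2 sqrtr1. Qed.

Definition modul xi h t : X := cis (xi * t) *: h t.

Lemma rnorm_modul xi h t : rnorm (modul xi h t) = rnorm (h t).
Proof. by rewrite rnormZ cabs_cis mul1r. Qed.

Lemma modulK xi h : modul (- xi) (modul xi h) = h.
Proof. by apply/funext => t; rewrite /modul scalerA mulNr cisNK scale1r. Qed.

Lemma modulNK xi h : modul xi (modul (- xi) h) = h.
Proof. by apply/funext => t; rewrite /modul scalerA mulNr cisKN scale1r. Qed.

Lemma modulD xi eta h : modul xi (modul eta h) = modul (xi + eta) h.
Proof. by apply/funext => t; rewrite /modul scalerA mulrDl cisD. Qed.

Lemma bounded_measurable_modul xi h : bounded_measurable h -> bounded_measurable (modul xi h).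
Proof.
move=> [mh [M hM]]; split; last by exists M => t; rewrite rnorm_modul.
by apply: strongly_measurable_cscale => //; [exact: measurable_cos_lin|exact: measurable_sin_lin].
Qed.

End Modulation.

(** * Closure properties of F under averaging *)

Section FunctionSpace.
Context {R : realType} {X : completeNormedModType R[i]}.
Context (F : set (R -> X)) (hF : condition_Fpp F).
Notation mu := (@lebesgue_measure R).
Implicit Types (f g h : R -> X) (a b : R -> R) (t : R).

(** Membership of the restriction to the half-line. It ignores negative times, so averages and
    modulations can be taken on the whole line without truncating them. *)
Definition memF h := F (ext0 Rplus h).

Lemma in_Rplus t : (t \in Rplus) = (0 <= t).
Proof. by apply/idP/idP => [/set_mem|h]; [|apply/mem_set]; rewrite /Rplus /= in_itv /= andbT. Qed.

Lemma ext0_pos h t : 0 <= t -> ext0 Rplus h t = h t.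
Proof. by move=> t0; rewrite ext0E in_Rplus t0. Qed.

Lemma ext0_neg h t : t < 0 -> ext0 Rplus h t = 0.
Proof. by move=> t0; rewrite ext0E in_Rplus leNgt t0. Qed.

Lemma eq_ext0 g h : (forall t, 0 <= t -> g t = h t) -> ext0 Rplus g = ext0 Rplus h.
Proof. by move=> e; apply/funext => t; rewrite !ext0E in_Rplus; case: ifP => // /e. Qed.

Lemma eq_memF g h : (forall t, 0 <= t -> g t = h t) -> memF g -> memF h.
Proof. by move=> /eq_ext0; rewrite /memF => ->. Qed.

Lemma memF_F h : F h -> memF h.
Proof.
move=> Fh; rewrite /memF; have [_ _ h0] := Fpp_BC hF Fh.
suff -> : ext0 Rplus h = h by [].
by apply/funext => t; have [t0|t0] := leP 0 t; [rewrite ext0_pos|rewrite ext0_neg // h0].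
Qed.

Lemma memF_lin (c : R[i]) g h : memF g -> memF h -> memF (fun t => c *: g t + h t).
Proof.
move=> Fg Fh; have := memF_F (Fpp_linear hF c Fg Fh).
by apply: eq_memF => t t0; rewrite !ext0_pos.
Qed.

Lemma memF0 : memF (fun=> 0).
Proof. exact: memF_F (Fpp_zero hF). Qed.

Lemma memFZ (c : R[i]) h : memF h -> memF (fun t => c *: h t).
Proof. by move=> Fh; apply: eq_memF (memF_lin c Fh memF0) => t _; rewrite addr0. Qed.

Lemma memFD g h : memF g -> memF h -> memF (fun t => g t + h t).
Proof. by move=> Fg /(memF_lin 1 Fg); apply: eq_memF => t _; rewrite scale1r. Qed.

Lemma memFB g h : memF g -> memF h -> memF (fun t => g t - h t).
Proof. by move=> Fg /(memFZ (-1)) /(memFD Fg); apply: eq_memF => t _; rewrite scaleN1r. Qed.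

Lemma BC_ext0 h : continuous h -> (exists M, forall t, 0 <= t -> rnorm (h t) <= M) ->
  BC (ext0 Rplus h).
Proof.
move=> ch [M hM]; split; last by move=> t; exact: ext0_neg.
  apply: (@subspace_eq_continuous _ _ _ h); last exact: continuous_subspaceT.
  by move=> t tR; rewrite -[RHS]/(ext0 Rplus h t) ext0E tR.
by exists M => t t0; rewrite ext0_pos // hM.
Qed.

Lemma memF_lim h : continuous h -> (exists M, forall t, 0 <= t -> rnorm (h t) <= M) ->
  (forall e : R, 0 < e -> exists2 g, memF g & forall t, 0 <= t -> rnorm (h t - g t) <= e) ->
  memF h.
Proof.
move=> ch bh H; apply: (Fpp_closed hF); first exact: BC_ext0.
move=> e /H[g Fg ge]; exists (ext0 Rplus g) => // t t0.
by rewrite !ext0_pos // ge.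
Qed.

Lemma memF_C0 h : continuous h -> (exists M, forall t, 0 <= t -> rnorm (h t) <= M) ->
  h t @[t --> +oo] --> (0 : X) -> memF h.
Proof.
move=> ch bh h0; apply: (Fpp_C0 hF); split; first exact: BC_ext0.
apply: cvg_trans h0; apply: near_eq_cvg.
by near=> t; rewrite ext0_pos.
Unshelve. all: by end_near.
Qed.

Lemma memF_modul xi h : memF h -> memF (modul xi h).
Proof.
move=> /(Fpp_mod hF xi) /memF_F; apply: eq_memF => t t0.
by rewrite ext0_pos // cexp_i.
Qed.

Lemma memF_map (B : {linear X -> X}) h : bounded_operator B -> memF h -> memF (fun t => B (h t)).
Proof.
move=> bB /(Fpp_op hF bB) /memF_F; apply: eq_memF => t t0.
by rewrite ext0_pos.
Qed.

Lemma bounded_measurable_BC f : BC f -> bounded_measurable f.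
Proof.
move=> [cf [M fM] f0]; split; first exact: strongly_measurable_halfline.
exists `|M| => t; have [t0|/f0 ->] := leP 0 t; last by rewrite rnorm0.
exact: le_trans (fM _ t0) (ler_norm _).
Qed.

Lemma bounded_measurableF f : F f -> bounded_measurable f.
Proof. by move=> /(Fpp_BC hF); exact: bounded_measurable_BC. Qed.

Lemma restrictE a (D : set R) t : (a \_ D) t = if t \in D then a t else 0.
Proof. by rewrite /patch. Qed.

(** Condition (v) with [psi] the reflection of [a], so that psi (t - s) = a (s - t). *)
Lemma memF_avg_future f a : F f -> integrableR a -> memF (avg (a \_ Rplus) f).
Proof.
move=> Ff ia; have bf := bounded_measurableF Ff.
have ia' : integrableR (a \_ Rplus) by apply: integrableR_restrict => //; exact: measurable_itv.
have Lpsi : L1 Rminus (fun x => (a (- x))%:C : R[i]).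
  split => /=; apply: (@integrableS _ _ _ _ setT) => //; try exact: measurable_itv.
    by have := integrable_opp 0 ia; under eq_fun do rewrite /= sub0r.
  exact: integrable0.
have := Fpp_conv hF Lpsi Ff; apply: eq_memF => t t0.
apply: (bochner_avg _ ia' bf); first exact: measurable_itv.
apply/funext => s; rewrite ext0E restrictE in_Rplus subr_ge0.
have -> : (s \in `[t, +oo[%classic) = (t <= s).
  by apply/idP/idP => [/set_mem|h]; [|apply/mem_set]; rewrite /= in_itv /= andbT.
by case: ifP; rewrite ?scale0r // opprB.
Qed.

Lemma memF_avg_lim f a (a_ : nat -> R -> R) : F f -> integrableR a ->
  (forall n, integrableR (a_ n)) -> (fun n => norm1 (fun x => a_ n x - a x)) @ \oo --> (0 : R) ->
  (forall n, memF (avg (a_ n) f)) -> memF (avg a f).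
Proof.
move=> Ff ia ian a0 Fa; have bf := bounded_measurableF Ff; have [mf [M fM]] := bf.
have M0 := bounded_by_ge0 fM.
apply: memF_lim; first exact: avg_continuous.
  by exists (norm1 a * M) => t _; exact: avg_le.
move=> e e0; have M1 : 0 < M + 1 by rewrite ltr_wpDl.
have [n _ hn] : \forall n \near \oo, norm1 (fun x => a_ n x - a x) < e / (M + 1).
  by apply: (cvgr_lt _ a0); rewrite divr_gt0.
exists (avg (a_ n) f) => // t _; rewrite rnormB -avgB //.
apply: (le_trans (avg_le t (integrableRB (ian n) ia) mf fM)).
apply: (@le_trans _ _ (e / (M + 1) * M)).
  by rewrite ler_wpM2r // ltW //; apply: hn => /=.
by rewrite mulrAC ler_pdivrMr // ler_pM2l // lerDl.
Qed.

(* Condition (iii) gives the kernels [rho * cos] and [rho * sin]; every kernel supported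
   on the negative half-line is an L1-limit of combinations of them. *)
Definition rho : R -> R := expR \_ Rminus.

Lemma in_Rminus t : (t \in Rminus) = (t <= 0).
Proof. by apply/idP/idP => [/set_mem|h]; [|apply/mem_set]; rewrite /Rminus /= in_itv. Qed.

Lemma rhoE t : rho t = if t <= 0 then expR t else 0.
Proof. by rewrite /rho restrictE in_Rminus. Qed.

Lemma rho_ge0 t : 0 <= rho t.
Proof. by rewrite rhoE; case: ifP => // _; exact: expR_ge0. Qed.

Lemma rho_le1 t : rho t <= 1.
Proof. by rewrite rhoE; case: ifP => // t0; rewrite -expR0 ler_expR. Qed.

Lemma measurable_rho : measurable_fun setT rho.
Proof.
apply/(measurable_restrictT _ _).1; first exact: measurable_itv.
by apply: measurable_funTS; exact: measurable_expR.
Qed.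

Lemma integrableR_rho : integrableR rho.
Proof.
apply: (integrableR_le measurable_rho (integrableRZ 4 integrable_oneDsqrV)) => t.
rewrite ger0_norm ?rho_ge0 // rhoE; case: ifP => t0; last first.
  by rewrite mulr_ge0 // invr_ge0 addr_ge0 // sqr_ge0.
have h1 : 1 - t / 2 <= expR (- t / 2) by have := expR_ge1Dx (- t / 2); lra.
have h2 : expR (- t / 2) ^+ 2 * expR t = 1.
  by rewrite expr2 -!expRD -[RHS]expR0; congr expR; field.
rewrite ler_pdivlMr; last by have := sqr_ge0 t; lra.
have h3 : (1 + t ^+ 2) / 4 <= expR (- t / 2) ^+ 2 by nra.
have := expR_gt0 t; nra.
Qed.

Lemma integrableR_rho_cos xi : integrableR (fun r => rho r * cos (xi * r)).
Proof. exact: integrableR_cos integrableR_rho. Qed.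

Lemma integrableR_rho_sin xi : integrableR (fun r => rho r * sin (xi * r)).
Proof. exact: integrableR_sin integrableR_rho. Qed.

(** Condition (iii) at eta = -1 + i xi: with r = s - t its kernel is e^r e^(- i xi r) for r <= 0.
    Since [f] vanishes at negative times, the integral over [0, t] is one over all r <= 0. *)
Lemma memF_avg_past_cexp f xi : F f ->
  memF (fun t => avg (fun r => rho r * cos (xi * r)) f t -
                 'i%C *: avg (fun r => rho r * sin (xi * r)) f t).
Proof.
move=> Ff; have bf := bounded_measurableF Ff; have [_ _ f0] := Fpp_BC hF Ff.
have eta0 : complex.Re ((-1 +i* xi) : R[i]) < 0 by rewrite /= oppr_lt0.
have := Fpp_exp_left hF Ff eta0; apply: eq_memF => t t0.
have i1 := integrableR_rho_cos xi; have i2 := integrableR_rho_sin (- xi).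
have -> : - ('i%C *: avg (fun r => rho r * sin (xi * r)) f t) =
    'i%C *: avg (fun r => rho r * sin (- xi * r)) f t.
  rewrite -scalerN -(avgN t (integrableR_rho_sin xi) bf).
  by congr (_ *: avg _ _ _); apply/funext => r; rewrite [- xi * r]mulNr sinN mulrN.
apply: (bochner_cavg _ i1 i2 bf); first exact: measurable_itv.
apply/funext => s; rewrite ext0E !rhoE subr_le0.
have -> : (s \in `[0, t]%classic) = (0 <= s <= t).
  by apply/idP/idP => [/set_mem|h]; [|apply/mem_set]; rewrite /= in_itv.
have [s0|s0] := leP 0 s; last by rewrite /= f0 // scaler0.
rewrite /=; case: ifP => // _; last by rewrite !mul0r -[_ +i* _]/(0 : R[i]) scale0r.
congr (_ *: _).
have e1 : complex.Re ((-1 +i* xi) * (t - s)%:C : R[i]) = s - t by rewrite /=; ring.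
have e2 : complex.Im ((-1 +i* xi) * (t - s)%:C : R[i]) = xi * (t - s) by rewrite /=; ring.
rewrite /cexp e1 e2 mulNr -mulrN opprB -(opprB t s) mulrN cosN.
by congr (_ +i* _).
Qed.

Lemma half_add_conj (x y : X) : (2^-1)%:C *: (x - 'i%C *: y + (x - 'i%C *: - y)) = x.
Proof.
rewrite scalerN opprK addrACA addNr addr0 -{1 2}[x]scale1r -scalerDl scalerA -[RHS]scale1r.
congr (_ *: _); apply/eqP; rewrite eq_complex /=.
by apply/andP; split; apply/eqP; field.
Qed.

Lemma half_sub_conj (x y : X) : (0 +i* 2^-1) *: (x - 'i%C *: y - (x - 'i%C *: - y)) = y.
Proof.
rewrite scalerN opprK opprD addrACA subrr add0r -scaleNr -scalerDl scalerA -[RHS]scale1r.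
congr (_ *: _); apply/eqP; rewrite eq_complex /=.
by apply/andP; split; apply/eqP; field.
Qed.

Lemma memF_avg_past_cos_sin f xi : F f ->
  memF (avg (fun r => rho r * cos (xi * r)) f) /\ memF (avg (fun r => rho r * sin (xi * r)) f).
Proof.
move=> Ff; have bf := bounded_measurableF Ff.
have h1 := memF_avg_past_cexp xi Ff; have h2 := memF_avg_past_cexp (- xi) Ff.
have ec : (fun r => rho r * cos (- xi * r)) = (fun r => rho r * cos (xi * r)).
  by apply/funext => r; rewrite mulNr cosN.
have es t : avg (fun r => rho r * sin (- xi * r)) f t = - avg (fun r => rho r * sin (xi * r)) f t.
  rewrite -(avgN t (integrableR_rho_sin xi) bf).
  by congr (avg _ _ _); apply/funext => r; rewrite [- xi * r]mulNr sinN mulrN.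
rewrite ec in h2; split.
  by apply: eq_memF (memFZ (2^-1)%:C (memFD h1 h2)) => t _; rewrite es half_add_conj.
by apply: eq_memF (memFZ (0 +i* 2^-1) (memFB h1 h2)) => t _; rewrite es half_sub_conj.
Qed.

Lemma memF_avg_past_trigpoly f r p : F f -> trigpoly r p ->
  integrableR (fun t => rho t * p t) /\ memF (avg (fun t => rho t * p t) f).
Proof.
move=> Ff [s [_ ->]]; have bf := bounded_measurableF Ff.
elim: s => [|z s [IH1 IH2]].
  have -> : (fun t => rho t * \sum_(z <- [::]) (z.1.1 * cos (z.2 * t) + z.1.2 * sin (z.2 * t))) =
    (fun t => 0 * rho t) :> (R -> R) by apply/funext => t; rewrite big_nil mulr0 mul0r.
  split; first exact/integrableRZ/integrableR_rho.
  by apply: eq_memF memF0 => t _; rewrite avgZ ?scale0r //; exact: integrableR_rho.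
have [h1 h2] := memF_avg_past_cos_sin z.2 Ff.
have i1 := integrableRZ z.1.1 (integrableR_rho_cos z.2).
have i2 := integrableRZ z.1.2 (integrableR_rho_sin z.2).
have -> : (fun t => rho t * \sum_(z <- z :: s) (z.1.1 * cos (z.2 * t) + z.1.2 * sin (z.2 * t))) =
  (fun t => (z.1.1 * (rho t * cos (z.2 * t)) + z.1.2 * (rho t * sin (z.2 * t))) +
    rho t * \sum_(z <- s) (z.1.1 * cos (z.2 * t) + z.1.2 * sin (z.2 * t))) :> (R -> R).
  by apply/funext => t; rewrite big_cons; ring.
split; first exact: integrableRD (integrableRD i1 i2) IH1.
apply: eq_memF (memFD (memFD (memFZ z.1.1%:C h1) (memFZ z.1.2%:C h2)) IH2) => t _.
rewrite (avgD t (integrableRD i1 i2) IH1 bf) (avgD t i1 i2 bf).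
by rewrite (avgZ _ t (integrableR_rho_cos _) bf) (avgZ _ t (integrableR_rho_sin _) bf).
Qed.

(** Two limits. Convolving [a] with [fejer_sum] gives bounded trigonometric polynomials that
    converge pointwise to a Fejer mean of [a], and the integrable factor [rho] turns this into L1
    convergence. The Fejer means then tend to [fejerC] times [a] in L1. *)
Lemma memF_avg_rhoM f a : F f -> integrableR a ->
  integrableR (fun t => rho t * a t) /\ memF (avg (fun t => rho t * a t) f).
Proof.
move=> Ff ia.
have ira : integrableR (fun t => rho t * a t).
  have := integrableRM ia measurable_rho (M := 1).
  under eq_fun do rewrite mulrC.
  by apply=> t; rewrite ger0_norm ?rho_ge0 // rho_le1.
split => //.
pose c n t := \int[mu]_s (a s * fejer n.+1%:R (t - s)).
have n0 n : 0 < n.+1%:R :> R by [].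
have icn n : integrableR (c n).
  have [i1 _] := fejer_conv_norm1_le ia (n0 n).
  have := integrableRD i1 (integrableRZ fejerC ia).
  by congr integrableR; apply/funext => t; rewrite subrK.
have irc n : integrableR (fun t => rho t * c n t).
  have := integrableRM (icn n) measurable_rho (M := 1).
  under eq_fun do rewrite mulrC.
  by apply=> t; rewrite ger0_norm ?rho_ge0 // rho_le1.
have step1 n : memF (avg (fun t => rho t * c n t) f).
  pose p k t := \int[mu]_s (a s * fejer_sum k.+1 n.+1%:R (t - s)).
  have tfs k : trigpoly n.+1%:R (fejer_sum k.+1 n.+1%:R : R -> R).
    have [] := @trigpoly_fejer_sum R k.+1 n.+1%:R 0 n.+1%:R (n0 n); first by rewrite normr0 add0r.
    by under eq_fun do rewrite mul0r cos0 mul1r.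
  have tp k : trigpoly n.+1%:R (p k) by exact: (conv_trigpoly ia).
  have pl k t : `|p k t| <= norm1 a * (n.+1%:R / 2).
    have ip := integrableR_trigpoly ia (tfs k) t.
    apply: (le_trans (Rint_norm_le ip)); rewrite mulrC -RintZ; last exact: integrableR_norm.
    apply: Rint_le; [exact: integrableR_norm|exact/integrableRZ/integrableR_norm|].
    by move=> s; rewrite normrM mulrC ler_wpM2r // fejer_sum_le.
  apply: (memF_avg_lim Ff (irc n) (a_ := fun k t => rho t * p k t)).
  - by move=> k; have [] := memF_avg_past_trigpoly Ff (tp k).
  - have dom := Rint_dominated (a_ := fun k t => rho t * p k t) (a := fun t => rho t * c n t)
      (g := fun t => norm1 a * (n.+1%:R / 2) * rho t).
    have [] // := dom.
    + by move=> k; exact: (integrableR_measurable (memF_avg_past_trigpoly Ff (tp k)).1).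
    + exact: (integrableR_measurable (irc n)).
    + apply: aeW => x; apply: cvgM; first exact: cvg_cst.
      have := @cvg_conv_fejer_sum R a n.+1%:R (fun=> 1) x ia (n0 n) (measurable_cst _).
      have e (q : R -> R) : \int[mu]_s (a s * (1 * q (x - s))) = \int[mu]_s (a s * q (x - s)).
        by apply: eq_Rintegral => s _; rewrite mul1r.
      rewrite e; under eq_fun do rewrite e.
      by apply=> _; rewrite normr1.
    + exact/integrableRZ/integrableR_rho.
    + by move=> k t; rewrite normrM mulrC (ger0_norm (rho_ge0 _)) ler_wpM2r // rho_ge0.
  - by move=> k; have [] := memF_avg_past_trigpoly Ff (tp k).
have step2 : memF (avg (fun t => fejerC * (rho t * a t)) f).
  have ifa := integrableRZ fejerC ira.
  apply: (memF_avg_lim Ff ifa irc _ step1).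
  apply: (@squeeze_cvgr _ _ _ _ (fun=> 0) (fun n => norm1 (fun t => c n t - fejerC * a t))).
  - near=> n; rewrite norm1_ge0 /=.
    apply: Rint_le.
    + exact/integrableR_norm/integrableRB.
    + exact/integrableR_norm/integrableRB/integrableRZ.
    + move=> t; rewrite mulrCA -mulrBr normrM ger0_norm ?rho_ge0 //.
      by rewrite ler_piMl ?rho_le1.
  - exact: cvg_cst.
  - exact: fejer_conv_norm1.
apply: eq_memF (memFZ fejerC^-1%:C step2) => t _.
rewrite (avgZ _ t ira (bounded_measurableF Ff)) scalerA -rmorphM mulVf ?scale1r //.
by rewrite gt_eqF // fejerC_gt0.
Unshelve. all: by end_near.
Qed.

Lemma memF_avg_past f a : F f -> integrableR a -> memF (avg (a \_ Rminus) f).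
Proof.
move=> Ff ia; have bf := bounded_measurableF Ff.
have mm : measurable (Rminus : set R) by exact: measurable_itv.
have ian n : integrableR (a \_ `[- n%:R, n%:R]) by apply: integrableR_restrict.
have bnd n : memF (avg ((a \_ `[- n%:R, n%:R]) \_ Rminus) f).
  (* The factor [expR (- t)] undoes [rho] on the negative half-line; truncation to [-n, n] keeps it
     bounded. *)
  pose b := fun t => (a \_ `[- n%:R, n%:R]) t * (expR (- t) * \1_(`[- n%:R, n%:R] : set R) t).
  have ib : integrableR b.
    apply: (integrableRM (M := expR n%:R) (ian n)).
      apply: measurable_funM; last exact: measurable_indic.
      apply: (measurableT_comp (@measurable_expR R)).
      by have := measurable_affine (-1 : R) 0; under eq_fun do rewrite mulN1r addr0.
    move=> t; rewrite indicE; case: (boolP (t \in _)) => [/set_mem|_]; last by rewrite mulr0 normr0 expR_ge0.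
    rewrite /= in_itv /= mulr1 ger0_norm ?expR_ge0 // ler_expR => /andP[h _]; lra.
  have [_] := memF_avg_rhoM Ff ib; apply: eq_memF => t _.
  congr (avg _ _ _); apply/funext => r; rewrite restrictE in_Rminus rhoE /b restrictE indicE.
  case: ifP => _; last by rewrite mul0r.
  case: ifP => _; last by rewrite !mulr0.
  by rewrite mulr1 mulrCA -expRD subrr expR0 mulr1.
have [N hN] : exists N : nat -> nat, forall k,
    norm1 (fun t => a t - (a \_ `[- (N k)%:R, (N k)%:R]) t) <= k.+1%:R^-1.
  have /choice[N hN] : forall k : nat, exists n : nat,
    norm1 (fun t => a t - (a \_ `[- n%:R, n%:R]) t) <= k.+1%:R^-1.
    by move=> k; apply: truncate_norm1.
  by exists N.
have im := integrableR_restrict mm ia.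
have imn k := integrableR_restrict mm (ian (N k)).
apply: (memF_avg_lim Ff im imn _ (fun k => bnd (N k))).
apply: (@squeeze_cvgr _ _ _ _ (fun=> 0) (fun k => k.+1%:R^-1)); last 2 first.
- exact: cvg_cst.
- exact: cvg_harmonic.
near=> k; rewrite norm1_ge0 /=; apply: le_trans (hN k).
apply: Rint_le.
- exact: (integrableR_norm (integrableRB (imn k) im)).
- exact: (integrableR_norm (integrableRB ia (ian (N k)))).
- by move=> t; rewrite distrC !restrictE; case: (t \in Rminus); rewrite ?subrr ?normr0.
Unshelve. all: by end_near.
Qed.

Lemma memF_avg_F f a : F f -> integrableR a -> memF (avg a f).
Proof.
move=> Ff ia; have bf := bounded_measurableF Ff.
have mp : measurable (Rplus : set R) by exact: measurable_itv.
have mm : measurable (Rminus : set R) by exact: measurable_itv.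
(* Both half-lines contain 0. Removing the part on [Rplus] before restricting to [Rminus] makes the
   two pieces add up to [a] at 0 as well. *)
have ip := integrableR_restrict mp ia; have ir := integrableRB ia ip.
apply: eq_memF (memFD (memF_avg_future Ff ia) (memF_avg_past Ff ir)) => t _.
rewrite -(avgD t ip (integrableR_restrict mm ir) bf).
congr (avg _ _ _); apply/funext => s; rewrite !restrictE in_Rplus in_Rminus.
by case: ltgtP => _; rewrite ?(addr0, add0r, subr0, subrr).
Qed.

(** Changing [h] at negative times changes the average by a function tending to 0, which is in F by
    (i): at a large time t only the tail of the kernel reaches negative times. *)
Lemma memF_avg h a : bounded_measurable h -> memF h -> integrableR a -> memF (avg a h).
Proof.
move=> bh Fh ia; have bf := bounded_measurableF Fh.
set f := ext0 Rplus h in Fh bf.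
have bd := bounded_measurableB bh bf; have [md [M dM]] := bd.
apply: eq_memF (memFD (memF_avg_F Fh ia) (_ : memF (avg a (fun t => h t - f t)))).
  by move=> t _; rewrite avg_subr // addrC subrK.
apply: memF_C0; first exact: avg_continuous.
  by exists (norm1 a * M) => t _; exact: avg_le.
have M0 := bounded_by_ge0 dM; have M1 : 0 < M + 1 by rewrite ltr_wpDl.
apply/cvg_rnormP => e e0.
have [n hn] := truncate_norm1 ia (divr_gt0 e0 M1).
have ian : integrableR (a \_ `[- n%:R, n%:R]) by apply: integrableR_restrict.
near=> t; rewrite sub0r rnormN.
have -> : avg a (fun t => h t - f t) t =
    avg (fun s => a s - (a \_ `[- n%:R, n%:R]) s) (fun t => h t - f t) t.
  rewrite avgB // (_ : avg (a \_ _) _ t = 0) ?subr0 //.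
  transitivity (avg (a \_ `[- n%:R, n%:R]) (fun=> 0 : X) t).
    apply: eq_avg_support => s; rewrite restrictE; case: ifP; last by rewrite eqxx.
    move=> /set_mem; rewrite /= in_itv /= => /andP[s1 _] _.
    rewrite /f ext0_pos ?subrr // -lerBlDr sub0r; apply: (le_trans (_ : _ <= n%:R)); first by lra.
    by near: t; apply: nbhs_pinfty_ge.
  apply: functional_separation => l bl; have b0 : bounded_measurable (fun=> 0 : X).
    by split; [exact: strongly_measurable_cst|exists 0 => ?; rewrite rnorm0].
  rewrite (avg_functional t ian b0 bl) functional0 //.
  under eq_Rintegral do rewrite mulr0.
  by rewrite /Rintegral integral0.
apply: (le_trans (avg_le t (integrableRB ia ian) md dM)).
apply: (@le_trans _ _ (e / (M + 1) * M)); first by rewrite ler_wpM2r.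
by rewrite mulrAC ler_pdivrMr // ler_pM2l // lerDl.
Unshelve. all: by end_near.
Qed.

End FunctionSpace.

(** * Mild solutions and the resolvent *)

Section Resolvent.
Context {R : realType}.
Notation mu := (@lebesgue_measure R).

Lemma primitive_is_derive (Y G : R -> R) (c t : R) : continuous G ->
  (forall s : R, 0 <= s -> Y s = c + \int[mu]_(r in `[0, s]) G r) -> 0 < t ->
  is_derive t 1 Y (G t).
Proof.
move=> cG hY t0.
have iG : mu.-integrable `[0, t + 1] (EFin \o G).
  apply: continuous_compact_integrable; first exact: segment_compact.
  exact: continuous_subspaceT.
pose I (s : R) := \int[mu]_(r in `[0, s]) G r.
have [dI eI] : derivable I t 1 /\ derive1 I t = G t := @continuous_FTC1_closed R G 0 t (t + 1)
    (ltr_pwDr ltr01 (lexx t)) iG t0 (cG t).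
have dJ : is_derive t 1 I (G t) by apply: (DeriveDef dI); rewrite -derive1E.
have dZ : is_derive t 1 (cst c + I) (0 + G t) by exact: is_deriveD.
rewrite add0r in dZ; apply: near_eq_is_derive dZ.
near=> s; rewrite hY ?ltW //; near: s; exact: lt_nbhsr.
Unshelve. all: by end_near.
Qed.

(** For Y1 = l (y s) and Y2 = l (i y s), the function cos (xi s) Y1 + sin (xi s) Y2 is l (e^(i xi s)
    y s). Its derivative is used only inside the interval, so a = 0 is allowed. *)
Lemma rotate_FTC (Y1 Y2 G1 G2 : R -> R) (c1 c2 xi a b : R) :
  continuous Y1 -> continuous Y2 -> continuous G1 -> continuous G2 ->
  (forall s : R, 0 <= s -> Y1 s = c1 + \int[mu]_(r in `[0, s]) G1 r) ->
  (forall s : R, 0 <= s -> Y2 s = c2 + \int[mu]_(r in `[0, s]) G2 r) ->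
  0 <= a -> a < b ->
  \int[mu]_(s in `[a, b]) (cos (xi * s) * (G1 s + xi * Y2 s) + sin (xi * s) * (G2 s - xi * Y1 s)) =
  (cos (xi * b) * Y1 b + sin (xi * b) * Y2 b) - (cos (xi * a) * Y1 a + sin (xi * a) * Y2 a).
Proof.
move=> cY1 cY2 cG1 cG2 h1 h2 a0 ab.
have cl : continuous (fun s : R => xi * s) by move=> s; apply: cvgM; [exact: cvg_cst|exact: cvg_id].
have cc : continuous (fun s : R => cos (xi * s)).
  by move=> s; apply: (@continuous_comp _ _ _ (fun s => xi * s) cos); [exact: cl|exact: continuous_cos].
have cs : continuous (fun s : R => sin (xi * s)).
  by move=> s; apply: (@continuous_comp _ _ _ (fun s => xi * s) sin); [exact: cl|exact: continuous_sin].
pose Z s := cos (xi * s) * Y1 s + sin (xi * s) * Y2 s.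
have cZ : continuous Z.
  by move=> s; apply: cvgD; apply: cvgM; [exact: cc|exact: cY1|exact: cs|exact: cY2].
have dZ (s : R) : 0 < s -> is_derive s 1 Z
    (cos (xi * s) * (G1 s + xi * Y2 s) + sin (xi * s) * (G2 s - xi * Y1 s)).
  move=> s0.
  have d1 := primitive_is_derive cG1 h1 s0; have d2 := primitive_is_derive cG2 h2 s0.
  rewrite /Z; apply: is_derive_eq; rewrite /GRing.scale /=; ring.
have := @continuous_FTC2 R (fun s => cos (xi * s) * (G1 s + xi * Y2 s) + sin (xi * s) * (G2 s - xi * Y1 s))
  Z a b ab.
rewrite /Rintegral => -> //.
- apply: continuous_subspaceT => s.
  apply: cvgD; apply: cvgM; [exact: cc| |exact: cs|].
    by apply: cvgD; [exact: cG1|apply: cvgM; [exact: cvg_cst|exact: cY2]].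
  by apply: cvgB; [exact: cG2|apply: cvgM; [exact: cvg_cst|exact: cY1]].
- split.
  + move=> s; rewrite in_itv /= => /andP[sa _].
    by have [] := dZ s (le_lt_trans a0 sa).
  + exact: cvg_at_right_filter (cZ a).
  + exact: cvg_at_left_filter (cZ b).
- move=> s; rewrite in_itv /= => /andP[sa _].
  by have [? e] := dZ s (le_lt_trans a0 sa); rewrite derive1E.
Qed.

End Resolvent.

(** * Increments of modulated primitives *)

Section Increment.
Context {R : realType} {X : completeNormedModType R[i]}.
Notation mu := (@lebesgue_measure R).
Implicit Types (h y v : R -> X) (l : X -> R) (xi t : R).

(** Composing with it turns a function continuous on the half-line into one continuous on the line
    with the same values at nonnegative times, as the fundamental theorem of calculus above
    expects. *)
Definition clamp t : R := Num.max 0 t.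

Lemma clamp_ge0 t : 0 <= clamp t.
Proof. by rewrite le_max lexx. Qed.

Lemma clampE t : 0 <= t -> clamp t = t.
Proof. by move=> t0; rewrite /clamp max_r. Qed.

Lemma clamp_continuous y : {within Rplus, continuous y} -> continuous (fun t => y (clamp t)).
Proof.
move=> cy t.
have cw : y @ within Rplus (nbhs (clamp t)) --> y (clamp t).
  have := cy (clamp t); rewrite /prop_for /continuous_at.
  by rewrite nbhs_subspace_in // /Rplus /= in_itv /= clamp_ge0.
apply: (@cvg_comp _ _ _ clamp y _ (within Rplus (nbhs (clamp t)))) => //.
move=> U; rewrite /within /= => wU.
have cv : clamp @ t --> clamp t.
  apply/cvgrPdist_le => e e0; near=> s.
  have ts : `|t - s| <= e by near: s; exact: cvgr_dist_le.
  apply: le_trans ts; rewrite /clamp /Num.max.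
  by case: (ltP 0 t) => ?; case: (ltP 0 s) => ?; rewrite ?subr0 ?sub0r ?subrr ?normrN ?normr0 // ler_norml;
     have := ler_norm (t - s); have := ler_norm (s - t); rewrite (distrC s t); lra.
have h : \forall s \near t, Rplus (clamp s) -> U (clamp s) by exact: cv _ wU.
rewrite -[nbhs _ _]/(\forall s \near t, U (clamp s)); apply: filterS h => s; apply.
by rewrite /Rplus /= in_itv /= clamp_ge0.
Unshelve. all: by end_near.
Qed.

Lemma integrableR_indic_itv (a b : R) : integrableR (\1_(`[a, b] : set R)).
Proof.
apply: integrableR_indic; first exact: measurable_itv.
rewrite /= lebesgue_measure_itv /=; case: ifP => _; last exact: ltry.
by rewrite -EFinB ltry.
Qed.

Lemma Rint_indicM (D : set R) (g : R -> R) :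
  \int[mu]_s (\1_D s * g s) = \int[mu]_(s in D) g s.
Proof.
rewrite [RHS]Rintegral_mkcond; apply: eq_Rintegral => s _.
by rewrite indicE restrictE; case: (s \in D); rewrite ?mul1r ?mul0r.
Qed.

Lemma avg_indic_functional (a b : R) h l : bounded_measurable h -> bounded_real_linear l ->
  l (avg (\1_(`[a, b] : set R)) h 0) = \int[mu]_(s in `[a, b]) l (h s).
Proof.
move=> bh bl; rewrite (avg_functional 0 (integrableR_indic_itv a b) bh bl) -[RHS]Rint_indicM.
by apply: eq_Rintegral => s _; rewrite add0r.
Qed.

Lemma avg_unit_functional h l t : bounded_measurable h -> bounded_real_linear l ->
  l (avg (\1_(`[0, 1] : set R)) h t) = \int[mu]_(s in `[t, t + 1]) l (h s).
Proof.
move=> bh bl; have i01 := integrableR_indic_itv 0 1.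
rewrite (avg_functional t i01 bh bl) -[RHS]Rint_indicM.
have ii := integrableR_functional 0 (integrableR_indic_itv t (t + 1)) bh bl.
have := Rintegral_translate t ii.
under [X in _ = X -> _]eq_Rintegral => s _ do rewrite add0r.
move=> <-; apply: eq_Rintegral => s _; rewrite add0r [s + t]addrC; congr (_ * _).
rewrite !indicE; congr (_%:R); congr nat_of_bool.
by apply/idP/idP => /set_mem /=; rewrite in_itv /= => h1; apply/mem_set; rewrite /= in_itv /=; lra.
Qed.

Lemma bochner_avg_indic (a b : R) h : bounded_measurable h ->
  bochner `[a, b] h = avg (\1_(`[a, b] : set R)) h 0.
Proof.
move=> bh; apply: (bochner_avg _ (integrableR_indic_itv a b) bh); first exact: measurable_itv.
apply/funext => s; rewrite ext0E subr0 indicE.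
by case: (s \in _); rewrite ?scale1r ?scale0r.
Qed.

Lemma functional_cis l (x : R) (z : X) : bounded_real_linear l ->
  l (cis x *: z) = cos x * l z + sin x * l ('i%C *: z).
Proof.
move=> [lD lZ _]; rewrite [cis x]complexrealE scalerDl lD lZ; congr (_ + _).
by rewrite mulrC -scalerA lZ.
Qed.

(** The integrated product rule (e^(i xi s) y)' = e^(i xi s) (v + i xi y) for a primitive [y] of
    [v], obtained from [rotate_FTC] under each functional. *)
Lemma modul_increment y v xi t : bounded_measurable y -> bounded_measurable v ->
  {within Rplus, continuous y} -> {within Rplus, continuous v} ->
  (forall s, 0 <= s -> y s = y 0 + avg (\1_(`[0, s] : set R)) v 0) -> 0 <= t ->
  modul xi y (t + 1) - modul xi y t =
  avg (\1_(`[0, 1] : set R)) (modul xi (fun s => v s + ('i%C * xi%:C) *: y s)) t.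
Proof.
move=> by_ bv cy cv hy t0; apply: functional_separation => l bl.
have bli := functional_mulI bl; have [lD lZ _] := bl.
have cl := real_linear_continuous bl; have cli := real_linear_continuous bli.
have cpy := clamp_continuous cy; have cpv := clamp_continuous cv.
have cc (g : X -> R) (h : R -> X) : continuous g -> continuous h -> continuous (fun s => g (h s)).
  by move=> cg ch s; apply: (@continuous_comp _ _ _ h g); [exact: ch|exact: cg].
have prim g : bounded_real_linear g -> forall s : R, 0 <= s ->
    g (y (clamp s)) = g (y 0) + \int[mu]_(r in `[0, s]) g (v (clamp r)).
  move=> bg s s0; have [gD _ _] := bg.
  rewrite clampE // hy // gD avg_indic_functional //; congr (_ + _).
  apply: eq_Rintegral => r /set_mem; rewrite /= in_itv /= => /andP[r0 _].
  by rewrite clampE.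
have t01 : t < t + 1 by rewrite ltrDl.
have := rotate_FTC xi (cc _ _ cl cpy) (cc _ _ cli cpy) (cc _ _ cl cpv) (cc _ _ cli cpv)
  (prim _ bl) (prim _ bli) t0 t01.
rewrite functionalB // /modul !functional_cis //.
rewrite (clampE t0) (clampE (addr_ge0 t0 ler01)) => <-.
rewrite avg_unit_functional //; last first.
  exact/bounded_measurable_modul/bounded_measurableD/bounded_measurableZ.
apply: eq_Rintegral => s /set_mem; rewrite /= in_itv /= => /andP[ts _].
have s0 : 0 <= s by apply: le_trans ts.
rewrite clampE // functional_cis // scalerDr !lD !scalerA.
have e1 : ('i%C * xi%:C) *: y s = xi%:C *: ('i%C *: y s) by rewrite scalerA mulrC.
have e2 : ('i%C * ('i%C * xi%:C)) *: y s = (- xi)%:C *: y s.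
  by congr (_ *: _); apply/eqP; rewrite eq_complex /=; apply/andP; split; apply/eqP; ring.
by rewrite e1 e2 !lZ; ring.
Qed.

End Increment.

(** * The unit-step form of the equation *)

Section UnitDifference.
Context {R : realType} {X : completeNormedModType R[i]}.
Notation mu := (@lebesgue_measure R).
Implicit Types (f h u v z : R -> X) (l : X -> R) (xi t : R) (a : R -> R).
Notation unit_avg := (avg (\1_(`[0, 1] : set R))).

Lemma bounded_operator_map (B : {linear X -> X}) : bounded_operator B -> bounded_real_map B.
Proof. by move=> [M BM]; split=> [x y|t x|]; [exact: linearD|exact: linearZ|exists M]. Qed.

Lemma within_continuous_map (T : X -> X) h : bounded_real_map T ->
  {within Rplus, continuous h} -> {within Rplus, continuous (fun t => T (h t))}.
Proof.
move=> bT ch s; apply: (@continuous_comp (subspace Rplus) X X h T s); first exact: ch.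
exact: bounded_real_map_continuous.
Qed.

Lemma avg_shift a h t (r : R) : integrableR a -> bounded_measurable h ->
  avg a h (t + r) = avg a (fun s => h (s + r)) t.
Proof.
move=> ia bh; apply: functional_separation => l bl.
have br : bounded_measurable (fun s => h (s + r)).
  by have := bounded_measurable_translate r bh; under eq_fun do rewrite addrC.
rewrite (avg_functional (t + r) ia bh bl) (avg_functional t ia br bl).
by apply: eq_Rintegral => s _; rewrite addrAC.
Qed.

(** For U in the domain, B A U = lambda B U - U. Applied to the integral of [u], this removes [A]
    from the mild equation and exhibits B u as a primitive, although [u] need not be one. *)
Lemma resolvent_mild (D : set X) (A : X -> X) (B : {linear X -> X}) (lambda : R[i]) f u :
  bounded_operator B -> (forall x, D x -> B (lambda *: x - A x) = x) ->
  bounded_measurable f -> bounded_measurable u -> mild_solution D A f u ->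
  forall t, 0 <= t -> B (u t) =
    B (u 0) + avg (\1_(`[0, t] : set R)) (fun s => lambda *: B (u s) - u s + B (f s)) 0.
Proof.
move=> bB BA bf bu [_ hu] t t0; have bT := bounded_operator_map bB.
have bBu := bounded_measurable_map bT bu; have bBf := bounded_measurable_map bT bf.
have blu := bounded_measurableZ lambda bBu.
have i1 := integrableR_indic_itv 0 t.
rewrite (avg_addr 0 i1 (bounded_measurableB blu bu) bBf) (avg_subr 0 i1 blu bu).
rewrite (avg_scaler lambda 0 i1 bBu) (avg_map 0 bT i1 bu) (avg_map 0 bT i1 bf).
have [DU] := hu t t0; rewrite !bochner_avg_indic // in DU * => eU.
have := BA _ DU; have -> : A (avg (\1_(`[0, t] : set R)) u 0) =
    u t - u 0 - avg (\1_(`[0, t] : set R)) f 0 by rewrite eU addrK.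
rewrite !linearB linearZ /= => e; rewrite -[in X in _ - X]e.
have aux (p q : X) : p - (p + q) = - q by rewrite opprD addrA subrr sub0r.
by rewrite aux !opprD !opprK subrK addrC subrK.
Qed.

Definition unit_diff (B : X -> X) h t : X := unit_avg h t + (B (h (t + 1)) - B (h t)).

(** At lambda = - i xi the terms in B u cancel in the product rule, leaving e^(i xi s) (B f - u):
    the increment of B v is the mean of B k minus the mean of v. *)
Lemma unit_diff_modul (D : set X) (A : X -> X) (B : {linear X -> X}) f u xi t :
  bounded_operator B ->
  (forall x, D x -> B (- ('i%C * xi%:C) *: x - A x) = x) ->
  BC f -> BC u -> mild_solution D A f u -> 0 <= t ->
  unit_diff B (modul xi u) t = unit_avg (modul xi (fun s => B (f s))) t.
Proof.
move=> bB BA Cf Cu hu t0; have bT := bounded_operator_map bB.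
have bf := bounded_measurable_BC Cf; have bu := bounded_measurable_BC Cu.
have [cf _ _] := Cf; have [cu _ _] := Cu.
have bBu := bounded_measurable_map bT bu; have bBf := bounded_measurable_map bT bf.
have cBu := within_continuous_map bT cu; have cBf := within_continuous_map bT cf.
pose lambda : R[i] := - ('i%C * xi%:C).
pose v s := lambda *: B (u s) - u s + B (f s).
have bv : bounded_measurable v.
  exact/bounded_measurableD/bBf/bounded_measurableB/bu/bounded_measurableZ.
have cv : {within Rplus, continuous v}.
  have cl := within_continuous_map (bounded_real_map_scale lambda) cBu.
  by move=> s; apply: cvgD; [apply: cvgB; [exact: cl|exact: cu]|exact: cBf].
have := modul_increment xi bBu bv cBu cv (resolvent_mild bB BA bf bu hu) t0.
have -> : (fun s => v s + ('i%C * xi%:C) *: B (u s)) = (fun s => B (f s) - u s).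
  apply/funext => s; rewrite /v /lambda scaleNr addrC !addrA subrr sub0r addrC; done.
have e : modul xi (fun s => B (f s) - u s) =
    (fun s => modul xi (fun s => B (f s)) s - modul xi u s).
  by apply/funext => s; rewrite /modul scalerBr.
rewrite e (avg_subr t (integrableR_indic_itv 0 1)); last 2 first.
- exact: bounded_measurable_modul.
- exact: bounded_measurable_modul.
have mB s : B (modul xi u s) = modul xi (fun s => B (u s)) s by rewrite /modul linearZ.
by rewrite /unit_diff !mB => ->; rewrite addrC subrK.
Qed.

Lemma bounded_measurable_unit_diff (B : {linear X -> X}) h : bounded_operator B ->
  bounded_measurable h -> bounded_measurable (unit_diff B h).
Proof.
move=> bB bh; have bT := bounded_operator_map bB.
have b1 : bounded_measurable (fun s => h (s + 1)).
  by have := bounded_measurable_translate 1 bh; under eq_fun do rewrite addrC.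
apply: bounded_measurableD; first exact: bounded_measurable_avg (integrableR_indic_itv 0 1) bh.
by apply: bounded_measurableB; exact: bounded_measurable_map.
Qed.

Lemma unit_diff_avg (B : {linear X -> X}) a h t : bounded_operator B -> integrableR a ->
  bounded_measurable h -> unit_diff B (avg a h) t = avg a (unit_diff B h) t.
Proof.
move=> bB ia bh; have bT := bounded_operator_map bB.
have i1 := integrableR_indic_itv (0 : R) 1.
have b1 : bounded_measurable (fun s => h (s + 1)).
  by have := bounded_measurable_translate 1 bh; under eq_fun do rewrite addrC.
have bB1 := bounded_measurable_map bT b1; have bBh := bounded_measurable_map bT bh.
rewrite /unit_diff (avg_comm t i1 ia bh) (avg_shift t 1 ia bh).
apply: etrans (esym (avg_addr t ia (bounded_measurable_avg i1 bh) (bounded_measurableB bB1 bBh))).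
congr (_ + _); apply: etrans (esym (avg_subr t ia bB1 bBh)).
exact: (f_equal2 (fun x y => x - y) (esym (avg_map t bT ia b1)) (esym (avg_map t bT ia bh))).
Qed.

Lemma unit_diff_sub (B : {linear X -> X}) h1 h2 t : bounded_measurable h1 -> bounded_measurable h2 ->
  unit_diff B (fun s => h1 s - h2 s) t = unit_diff B h1 t - unit_diff B h2 t.
Proof.
move=> b1 b2; rewrite /unit_diff (avg_subr t (integrableR_indic_itv 0 1) b1 b2) !linearB /=.
by rewrite !opprD !opprK [RHS]addrACA; congr (_ + _); rewrite [RHS]addrACA.
Qed.

(** Dilation invariance of the L1 norm: for small [r] a shift of the kernel by at most 1 acts like a
    small shift of [vallee 1]. *)
Lemma omega1_vallee r (s : R) : 0 < r -> omega1 (vallee r) s = omega1 (vallee 1) (r * s).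
Proof.
move=> r0; have iV := @integrableR_vallee R 1.
have iw := integrableR_norm (integrableR_omega (r * s) iV).
have := Rintegral_affine 0 (lt0r_neq0 r0) iw; rewrite /omega1 /norm1 => <-.
rewrite (gtr0_norm r0) -RintZ; last exact: (integrable_affine 0 (lt0r_neq0 r0) iw).
apply: eq_Rintegral => t _; rewrite !(vallee_scale _ r0) -mulrBr normrM (gtr0_norm r0).
by rewrite addr0 mulrDr.
Qed.

(** Within unit time the average varies by at most e M. Its distance to its unit mean is thus at
    most e M, and [B] applied to its unit increment is at most K e M. *)
Lemma unit_diff_small (B : {linear X -> X}) a h t (K e M : R) : (forall x, rnorm (B x) <= K * rnorm x) ->
  0 <= K -> integrableR a -> strongly_measurable h -> bounded_by h M ->
  (forall s, `|s| <= 1 -> omega1 a s <= e) ->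
  rnorm (avg a h t - unit_diff B (avg a h) t) <= (1 + K) * (e * M).
Proof.
move=> BK K0 ia mh hM ae; have bh : bounded_measurable h by split => //; exists M.
have M0 := bounded_by_ge0 hM.
have i1 := integrableR_indic_itv (0 : R) 1.
have dist (s : R) : `|s| <= 1 -> rnorm (avg a h t - avg a h (t + s)) <= e * M.
  move=> s1; rewrite rnormB; apply: (le_trans (avg_dist_translate t s ia mh hM)).
  by rewrite ler_wpM2r // ae // normrN.
have ba := bounded_measurable_avg ia bh.
rewrite /unit_diff opprD addrA mulrDl mul1r; apply: (le_trans (ler_rnormB _ _)); apply: lerD; last first.
  rewrite -linearB; apply: (le_trans (BK _)); rewrite ler_wpM2l // rnormB dist //.
  by rewrite normr1.
apply: rnorm_le_functional => l bl lb; rewrite functionalB // avg_unit_functional //.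
have m1 : fine (mu `[t, t + 1]) = 1 :> R.
  by rewrite lebesgue_measure_itv /= lte_fin ltrDl ltr01 -EFinB /= addrAC subrr add0r.
have cla : continuous (fun s => l (avg a h s)).
  move=> s; apply: (@continuous_comp _ _ _ (avg a h) l); first exact: avg_continuous.
  exact: real_linear_continuous.
have ii : mu.-integrable `[t, t + 1] (EFin \o (fun s => l (avg a h s))).
  apply: continuous_compact_integrable; first exact: segment_compact.
  exact: continuous_subspaceT.
have mi : measurable (`[t, t + 1] : set R) by exact: measurable_itv.
have ic (k : R) : mu.-integrable `[t, t + 1] (EFin \o (fun=> k)).
  apply: continuous_compact_integrable; first exact: segment_compact.
  by apply: continuous_subspaceT => s; exact: cvg_cst.
have ec (k : R) : \int[mu]_(s in `[t, t + 1]) k = k by rewrite Rintegral_cst // m1 mulr1.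
rewrite -[X in X - _]ec -RintegralB // -[X in _ <= X]ec.
apply: le_Rintegral => //.
  apply: continuous_compact_integrable; first exact: segment_compact.
  by apply: continuous_subspaceT => s; apply: cvgB; [exact: cvg_cst|exact: cla].
move=> s; rewrite /= in_itv /= => /andP[ts st].
apply: (le_trans (ler_norm _)); rewrite -functionalB //; apply: (le_trans (lb _)).
have := dist (s - t); have -> : t + (s - t) = s by rewrite addrC subrK.
apply.
by rewrite ger0_norm; lra.
Qed.

End UnitDifference.

(** * Band-limited components *)

Section LocalMembership.
Context {R : realType} {X : completeNormedModType R[i]}.
Context (F : set (R -> X)) (hF : condition_Fpp F).
Notation mu := (@lebesgue_measure R).
Implicit Types (f h u x z : R -> X) (a : R -> R) (t xi theta d r : R).
Notation unit_avg := (avg (\1_(`[0, 1] : set R))).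

Lemma memF_unit_diff_avg (B : {linear X -> X}) a z : bounded_operator B -> integrableR a ->
  bounded_measurable z -> memF F z -> memF F (unit_diff B (avg a z)).
Proof.
move=> bB ia bz Fz; have baz := bounded_measurable_avg ia bz.
have Faz := memF_avg hF bz Fz ia.
have F1 := memF_avg hF baz Faz (integrableR_indic_itv 0 1).
have Fs : memF F (fun t => avg a z (t + 1)).
  apply: eq_memF (memF_avg hF bz Fz (integrable_translate (-1) ia)) => t _.
  by rewrite avg_translate.
have F2 := memFB hF (memF_map hF bB Fs) (memF_map hF bB Faz).
exact: (memFD hF F1 F2).
Qed.

(* [h] is the sum of the geometric series of the contraction
   [z |-> avg a z - unit_diff B (avg a z)] applied to [unit_diff B h]. *)
Lemma memF_contraction (B : {linear X -> X}) (K e : R) a h : bounded_operator B ->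
  (forall y, rnorm (B y) <= K * rnorm y) -> 0 <= K -> integrableR a ->
  (forall s, `|s| <= 1 -> omega1 a s <= e) -> (1 + K) * e <= 2^-1 ->
  bounded_measurable h -> (forall t, avg a h t = h t) -> memF F (unit_diff B h) ->
  memF F h.
Proof.
move=> bB BK K0 ia ae Ke bh ah Fdh.
have ahE : avg a h = h by exact/funext.
have [mh [M hM]] := bh; have M0 := bounded_by_ge0 hM.
pose T z t := avg a z t - unit_diff B (avg a z) t.
have bT z : bounded_measurable z -> bounded_measurable (T z).
  move=> bz; have ba := bounded_measurable_avg ia bz.
  exact: (bounded_measurableB ba (bounded_measurable_unit_diff bB ba)).
have FT z : bounded_measurable z -> memF F z -> memF F (T z).
  by move=> bz Fz; exact: (memFB hF (memF_avg hF bz Fz ia) (memF_unit_diff_avg bB ia bz Fz)).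
have bdh := bounded_measurable_unit_diff bB bh.
pose S := fix S (n : nat) : R -> X :=
  if n is n'.+1 then fun t => unit_diff B h t + T (S n') t else fun=> 0.
have bS n : bounded_measurable (S n) /\ memF F (S n).
  elim: n => [|n [IH1 IH2]] /=.
    split; last exact: memF0.
    by split; [exact: strongly_measurable_cst|exists 0 => t; rewrite rnorm0].
  split; first exact: (bounded_measurableD bdh (bT _ IH1)).
  exact: (memFD hF Fdh (FT _ IH1 IH2)).
have err n : bounded_by (fun t => h t - S n t) (M * 2^-1 ^+ n).
  elim: n => [|n IH] t; first by rewrite expr0 mulr1 /= subr0; exact: hM.
  have [bSn _] := bS n; have bSh := bounded_measurableB bh bSn.
  have baS := bounded_measurable_avg ia bSn.
  (* Since [avg a h] is [h], also h = unit_diff B h + T h; so [h] is fixed by the recursion, and [T]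
     at least halves the error. *)
  have -> : h t - S n.+1 t = T (fun t => h t - S n t) t.
    have eA : avg a (fun t => h t - S n t) = (fun t => h t - avg a (S n) t).
      by apply/funext => s; rewrite avg_subr // ah.
    have aux (p q c b : X) : p - (c + (q - b)) = p - q - (c - b).
      by rewrite !opprD !opprK addrA [RHS]addrACA.
    rewrite -[S n.+1 t]/(unit_diff B h t + T (S n) t) /T eA (unit_diff_sub B t bh baS).
    exact: aux.
  have [mSh _] := bSh.
  apply: (le_trans (unit_diff_small t BK K0 ia mSh IH ae)).
  rewrite exprS [M * (2^-1 * _)]mulrCA mulrA ler_wpM2r //.
  by rewrite mulr_ge0 // exprn_ge0 // invr_ge0.
apply: memF_lim; first exact: hF.
- by rewrite -ahE; exact: avg_continuous.
- by exists M => t _; exact: hM.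
move=> eps eps0.
have cv : (fun n => M * 2^-1 ^+ n) @ \oo --> (0 : R).
  rewrite -[X in _ --> X](mulr0 M); apply: cvgM; first exact: cvg_cst.
  by apply: cvg_expr; rewrite ger0_norm ?invr_ge0 // invf_lt1 // ltr1n.
have [n _ hn] : \forall n \near \oo, M * 2^-1 ^+ n < eps by exact: (cvgr_lt _ cv).
exists (S n); first by case: (bS n).
by move=> t _; apply: (le_trans (err n t)); apply/ltW/hn => /=.
Qed.

Definition kcos theta d (s : R) : R := cos (theta * s) * fejer d s.
Definition ksin theta d (s : R) : R := sin (theta * s) * fejer d s.

Lemma integrableR_kcos theta d : integrableR (kcos theta d).
Proof.
have := integrableR_cos theta (@integrableR_fejer R d).
by congr integrableR; apply/funext => s; rewrite /kcos mulrC.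
Qed.

Lemma integrableR_ksin theta d : integrableR (ksin theta d).
Proof.
have := integrableR_sin theta (@integrableR_fejer R d).
by congr integrableR; apply/funext => s; rewrite /ksin mulrC.
Qed.

Lemma kcos_le theta d (s : R) : 0 < d -> `|kcos theta d s| <= d / 2.
Proof.
move=> d0; rewrite normrM; apply: le_trans (fejer_le s d0).
by rewrite ler_piMl // ler_norml cos_geN1 cos_le1.
Qed.

Lemma ksin_le theta d (s : R) : 0 < d -> `|ksin theta d s| <= d / 2.
Proof.
move=> d0; rewrite normrM; apply: le_trans (fejer_le s d0).
by rewrite ler_piMl // ler_norml sin_geN1 sin_le1.
Qed.

(* Averaging by [kcos theta d] and [ksin theta d] keeps only the frequencies of [h]
   within [d] of [theta] or [- theta]. *)
Definition band_mem theta d h := memF F (avg (kcos theta d) h) /\ memF F (avg (ksin theta d) h).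

(** Used with [kappa] = 1 for the kernel [vallee], and with [kappa] = 0 for a kernel whose transform
    vanishes on the band. *)
Lemma avg_band a r (kappa : R) theta d h t : integrableR a -> 0 < d -> `|theta| + d <= r ->
  (forall xi, `|xi| <= r -> \int[mu]_s (a s * cos (xi * s)) = kappa) ->
  (forall xi, `|xi| <= r -> \int[mu]_s (a s * sin (xi * s)) = 0) -> bounded_measurable h ->
  avg a (avg (kcos theta d) h) t = kappa%:C *: avg (kcos theta d) h t /\
  avg a (avg (ksin theta d) h) t = kappa%:C *: avg (ksin theta d) h t.
Proof.
move=> ia d0 hr hc hs bh.
have ic := integrableR_kcos theta d; have is_ := integrableR_ksin theta d.
split.
  rewrite -(avgZ _ t ic bh); apply: (avg_avg t ia ic (fun y => kcos_le theta y d0) _ _ bh).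
    exact: integrableRZ.
  by move=> y; have [] := conv_fejer ia d0 hr hc hs y.
rewrite -(avgZ _ t is_ bh); apply: (avg_avg t ia is_ (fun y => ksin_le theta y d0) _ _ bh).
  exact: integrableRZ.
by move=> y; have [] := conv_fejer ia d0 hr hc hs y.
Qed.

Lemma band_memD theta d h1 h2 : bounded_measurable h1 -> bounded_measurable h2 ->
  band_mem theta d h1 -> band_mem theta d h2 -> band_mem theta d (fun t => h1 t + h2 t).
Proof.
move=> b1 b2 [c1 s1] [c2 s2]; split.
  by apply: eq_memF (memFD hF c1 c2) => t _; rewrite avg_addr //; exact: integrableR_kcos.
by apply: eq_memF (memFD hF s1 s2) => t _; rewrite avg_addr //; exact: integrableR_ksin.
Qed.

Lemma band_memZ (c : R[i]) theta d h : bounded_measurable h ->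
  band_mem theta d h -> band_mem theta d (fun t => c *: h t).
Proof.
move=> bh [hc hs]; split.
  by apply: eq_memF (memFZ hF c hc) => t _; rewrite avg_scaler //; exact: integrableR_kcos.
by apply: eq_memF (memFZ hF c hs) => t _; rewrite avg_scaler //; exact: integrableR_ksin.
Qed.

(** In e^(i theta (t + s)) the factor depending on t comes out, and the factor depending on s joins
    the kernel as [kcos] + i [ksin]. *)
Lemma avg_fejer_modul theta d h t : bounded_measurable h ->
  avg (fejer d) (modul theta h) t =
  modul theta (fun t => avg (kcos theta d) h t + 'i%C *: avg (ksin theta d) h t) t.
Proof.
move=> bh; apply/esym.
have ic := integrableR_kcos theta d; have is_ := integrableR_ksin theta d.
apply: functional_separation => l bl; have bli := functional_mulI bl.
have [lD lZ _] := bl.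
have ll (v : X) : l ('i%C *: ('i%C *: v)) = - l v.
  have -> : 'i%C *: ('i%C *: v) = (-1)%:C *: v.
    by rewrite scalerA; congr (_ *: _); apply/eqP; rewrite eq_complex /=; apply/andP; split; apply/eqP; ring.
  by rewrite lZ mulN1r.
have ik := @integrableR_fejer R d; have bm := bounded_measurable_modul theta bh.
have e1 := avg_functional t ic bh bl; have e2 := avg_functional t is_ bh bl.
have e3 : l ('i%C *: avg (kcos theta d) h t) = _ := avg_functional t ic bh bli.
have e4 : l ('i%C *: avg (ksin theta d) h t) = _ := avg_functional t is_ bh bli.
have i1 := integrableR_functional t ic bh bl; have i2 := integrableR_functional t is_ bh bl.
have i3 := integrableR_functional t ic bh bli; have i4 := integrableR_functional t is_ bh bli.
rewrite [modul theta _ t]/(_ *: _).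
move: e1 e2 e3 e4; move: (avg (kcos theta d) h t) (avg (ksin theta d) h t) => x y e1 e2 e3 e4.
rewrite functional_cis // scalerDr !lD ll e1 e2 e3 e4.
rewrite (avg_functional t ik bm bl) -RintD // -RintB // -!RintZ; last 2 first.
- exact: integrableRB.
- exact: integrableRD.
rewrite -RintD; last 2 first.
- exact/integrableRZ/integrableRD.
- exact/integrableRZ/integrableRB.
apply: eq_Rintegral => s _; rewrite /modul functional_cis // [theta * (_ + _)]mulrDr cosD sinD
    /kcos /ksin; ring.
Qed.

Lemma band_mem_modul theta d h : bounded_measurable h -> band_mem theta d h ->
  memF F (avg (fejer d) (modul theta h)).
Proof.
move=> bh [hc hs].
apply: eq_memF (memF_modul hF theta (memFD hF hc (memFZ hF 'i%C hs))) => t _.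
by rewrite avg_fejer_modul.
Qed.

Lemma band_mem_avg theta d a h : 0 < d -> integrableR a -> bounded_measurable h ->
  band_mem theta d h -> band_mem theta d (avg a h).
Proof.
move=> d0 ia bh [hc hs].
have ic := integrableR_kcos theta d; have is_ := integrableR_ksin theta d; split.
  apply: eq_memF (memF_avg hF (bounded_measurable_avg ic bh) hc ia) => t _.
  by rewrite avg_comm.
apply: eq_memF (memF_avg hF (bounded_measurable_avg is_ bh) hs ia) => t _.
by rewrite avg_comm.
Qed.

Lemma band_mem_vanish a r theta d h : integrableR a -> 0 < d -> `|theta| + d <= r ->
  (forall xi, `|xi| <= r -> \int[mu]_s (a s * cos (xi * s)) = 0) ->
  (forall xi, `|xi| <= r -> \int[mu]_s (a s * sin (xi * s)) = 0) -> bounded_measurable h ->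
  band_mem theta d (avg a h).
Proof.
move=> ia d0 hr hc hs bh.
have ic := integrableR_kcos theta d; have is_ := integrableR_ksin theta d.
split; apply: eq_memF (memF0 hF) => t _.
  by rewrite avg_comm //; have [-> _] := avg_band t ia d0 hr hc hs bh; rewrite scale0r.
by rewrite avg_comm //; have [_ ->] := avg_band t ia d0 hr hc hs bh; rewrite scale0r.
Qed.

Lemma band_mem_unit_diff (B : {linear X -> X}) h : bounded_operator B -> bounded_measurable h ->
  memF F (unit_diff B h) ->
  exists2 r, 0 < r & forall theta d, 0 < d -> `|theta| + d <= r -> band_mem theta d h.
Proof.
move=> bB bh Fh; have [M BM] := bB.
pose K := `|M|; have K0 : 0 <= K by exact: normr_ge0.
have BK y : rnorm (B y) <= K * rnorm y.
  by apply: (le_trans (BM y)); rewrite ler_wpM2r ?rnorm_ge0 ?ler_norm.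
have K1 : 0 < 1 + K by rewrite ltr_pwDl.
(* If unit shifts move [vallee r] by at most 1 / (2 (1 + K)) in L1, the contraction factor in
   [unit_diff_small] is at most 1/2. *)
have e0 : 0 < (2 * (1 + K))^-1 by rewrite invr_gt0 mulr_gt0.
have [r r0 hr] := omega1_small (@integrableR_vallee R 1) e0.
exists r => // theta d d0 hd.
have iV := @integrableR_vallee R r.
have Ve (s : R) : `|s| <= 1 -> omega1 (vallee r) s <= (2 * (1 + K))^-1.
  by move=> s1; rewrite omega1_vallee // hr // normrM (gtr0_norm r0) ler_piMr // ltW.
have Ke : (1 + K) * (2 * (1 + K))^-1 <= 2^-1.
  by rewrite invfM mulrCA mulfV ?mulr1 // gt_eqF.
have ic := integrableR_kcos theta d; have is_ := integrableR_ksin theta d.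
have hV t := avg_band t iV d0 hd (fun xi => Rint_vallee_cos r0 (xi := xi))
  (fun xi _ => Rint_vallee_sin r xi) bh.
have bdh := bounded_measurable_unit_diff bB bh.
split.
  apply: (memF_contraction bB BK K0 iV Ve Ke (bounded_measurable_avg ic bh)).
    by move=> t; have [-> _] := hV t; rewrite scale1r.
  by apply: eq_memF (memF_avg hF bdh Fh ic) => t _; rewrite unit_diff_avg.
apply: (memF_contraction bB BK K0 iV Ve Ke (bounded_measurable_avg is_ bh)).
  by move=> t; have [_ ->] := hV t; rewrite scale1r.
by apply: eq_memF (memF_avg hF bdh Fh is_) => t _; rewrite unit_diff_avg.
Qed.

End LocalMembership.

(** * Complex kernels *)

Section ComplexKernel.
Context {R : realType} {X : completeNormedModType R[i]}.
Notation mu := (@lebesgue_measure R).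
Implicit Types (h u : R -> X) (a b : R -> R) (t xi eta : R).

Definition cavg a b h t : X := avg a h t + 'i%C *: avg b h t.

(** With [rot_im]: the real and imaginary parts of (a + i b) e^(- i xi s). *)
Definition rot_re a b xi (s : R) : R := a s * cos (xi * s) + b s * sin (xi * s).
Definition rot_im a b xi (s : R) : R := b s * cos (xi * s) - a s * sin (xi * s).

Lemma integrableR_rot_re a b xi : integrableR a -> integrableR b -> integrableR (rot_re a b xi).
Proof. by move=> ia ib; apply: integrableRD; [exact: integrableR_cos|exact: integrableR_sin]. Qed.

Lemma integrableR_rot_im a b xi : integrableR a -> integrableR b -> integrableR (rot_im a b xi).
Proof. by move=> ia ib; apply: integrableRB; [exact: integrableR_cos|exact: integrableR_sin]. Qed.

Lemma mulII (v : X) : 'i%C *: ('i%C *: v) = - v.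
Proof.
rewrite -scaleN1r scalerA; congr (_ *: _); apply/eqP; rewrite eq_complex /=.
by apply/andP; split; apply/eqP; ring.
Qed.

Lemma cavg_functional a b h l t : integrableR a -> integrableR b -> bounded_measurable h ->
  bounded_real_linear l ->
  l (cavg a b h t) = \int[mu]_s (a s * l (h (t + s)) + b s * l ('i%C *: h (t + s))).
Proof.
move=> ia ib bh bl; have bli := functional_mulI bl; have [lD _ _] := bl.
have e1 := avg_functional t ia bh bl.
have e2 : l ('i%C *: avg b h t) = _ := avg_functional t ib bh bli.
have i1 := integrableR_functional t ia bh bl; have i2 := integrableR_functional t ib bh bli.
by rewrite /cavg lD e1 e2 -RintD.
Qed.

(** Writing e^(i xi t) = e^(- i xi s) e^(i xi (t + s)) moves the modulation into the averaged
    function and the inverse rotation into the kernel. *)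
Lemma modul_cavg a b h xi t : integrableR a -> integrableR b -> bounded_measurable h ->
  modul xi (cavg a b h) t = cavg (rot_re a b xi) (rot_im a b xi) (modul xi h) t.
Proof.
move=> ia ib bh; apply: functional_separation => l bl; have bli := functional_mulI bl.
have bm := bounded_measurable_modul xi bh.
have ire := integrableR_rot_re xi ia ib; have iim := integrableR_rot_im xi ia ib.
have i1 := integrableR_functional t ia bh bl; have i2 := integrableR_functional t ib bh bli.
have i3 := integrableR_functional t ia bh bli; have i4 := integrableR_functional t ib bh bl.
rewrite (cavg_functional t ire iim bm bl).
rewrite [modul xi _ t]/(_ *: _) functional_cis // (cavg_functional t ia ib bh bl).
have -> : l ('i%C *: cavg a b h t) = _ := cavg_functional t ia ib bh bli.
have ee (s : R) : l ('i%C *: ('i%C *: h (t + s))) = - l (h (t + s)).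
  by rewrite mulII functionalN.
have i5 : integrableR (fun s => a s * l ('i%C *: h (t + s)) + b s * l ('i%C *: ('i%C *: h (t + s)))).
  have := integrableRB i3 i4; congr integrableR; apply/funext => s.
  by rewrite ee mulrN.
have i6 := integrableRD i1 i2.
rewrite -(RintZ _ i6) -(RintZ _ i5) -RintD; [|exact: integrableRZ|exact: integrableRZ].
apply: eq_Rintegral => s _.
have e1 : l (modul xi h (t + s)) =
    cos (xi * (t + s)) * l (h (t + s)) + sin (xi * (t + s)) * l ('i%C *: h (t + s)).
  exact: functional_cis.
have e2 : l ('i%C *: modul xi h (t + s)) =
    cos (xi * (t + s)) * l ('i%C *: h (t + s)) - sin (xi * (t + s)) * l (h (t + s)).
  have := functional_cis (xi * (t + s)) (h (t + s)) bli; rewrite ee mulrN; exact.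
rewrite e1 e2 ee /rot_re /rot_im [xi * (t + s)]mulrDr cosD sinD -[LHS]mulr1.
rewrite -(cos2Dsin2 (xi * s)); ring.
Qed.

Lemma rot_re_cos a b xi eta (s : R) :
  rot_re a b xi s * cos (eta * s) = (rot_re a b (xi + eta) s + rot_re a b (xi - eta) s) / 2.
Proof. by rewrite /rot_re [(xi + eta) * s]mulrDl [(xi - eta) * s]mulrDl [- eta * s]mulNr !(cosD,
    sinD) cosN sinN; field. Qed.

Lemma rot_im_cos a b xi eta (s : R) :
  rot_im a b xi s * cos (eta * s) = (rot_im a b (xi + eta) s + rot_im a b (xi - eta) s) / 2.
Proof. by rewrite /rot_im [(xi + eta) * s]mulrDl [(xi - eta) * s]mulrDl [- eta * s]mulNr !(cosD,
    sinD) cosN sinN; field. Qed.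

Lemma rot_im_sin a b xi eta (s : R) :
  rot_im a b xi s * sin (eta * s) = (rot_re a b (xi + eta) s - rot_re a b (xi - eta) s) / 2.
Proof. by rewrite /rot_im /rot_re [(xi + eta) * s]mulrDl [(xi - eta) * s]mulrDl [- eta * s]mulNr
    !(cosD, sinD) cosN sinN; field. Qed.

Lemma rot_re_sin a b xi eta (s : R) :
  rot_re a b xi s * sin (eta * s) = (rot_im a b (xi - eta) s - rot_im a b (xi + eta) s) / 2.
Proof. by rewrite /rot_im /rot_re [(xi + eta) * s]mulrDl [(xi - eta) * s]mulrDl [- eta * s]mulNr
    !(cosD, sinD) cosN sinN; field. Qed.

Lemma fourier_rot (g : R -> R[i]) xi : fourier g xi =
  (\int[mu]_s rot_re (fun s => complex.Re (g s)) (fun s => complex.Im (g s)) xi s) +i*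
  (\int[mu]_s rot_im (fun s => complex.Re (g s)) (fun s => complex.Im (g s)) xi s).
Proof.
rewrite /fourier /cintegral.
have e (t : R) : cexp (- ('i%C * xi%:C * t%:C)) = cos (xi * t) +i* (- sin (xi * t)).
  have e1 : complex.Re (- ('i%C * xi%:C * t%:C)) = 0 by rewrite /=; ring.
  have e2 : complex.Im (- ('i%C * xi%:C * t%:C)) = - (xi * t) by rewrite /=; ring.
  by rewrite /cexp e1 e2 expR0 !mul1r cosN sinN.
congr (_ +i* _); apply: eq_Rintegral => s _; rewrite e /rot_re /rot_im;
  case: (g s) => x y /=; ring.
Qed.

(** Vanishing of the complex transform at one point says nothing about the two real kernels
    separately. The band is symmetric, so both xi + eta and xi - eta are available, and the product
    formulas combine them. *)
Lemma rot_vanish a b xi r : integrableR a -> integrableR b ->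
  (forall eta, `|eta| <= r -> \int[mu]_s rot_re a b (xi + eta) s = 0 /\
                              \int[mu]_s rot_im a b (xi + eta) s = 0) ->
  forall eta, `|eta| <= r ->
  [/\ \int[mu]_s (rot_re a b xi s * cos (eta * s)) = 0,
      \int[mu]_s (rot_re a b xi s * sin (eta * s)) = 0,
      \int[mu]_s (rot_im a b xi s * cos (eta * s)) = 0 &
      \int[mu]_s (rot_im a b xi s * sin (eta * s)) = 0].
Proof.
move=> ia ib h eta hr.
have [re1 im1] := h eta hr; have [re2 im2] := h (- eta) (eq_ind_r (fun z => z <= r) hr (normrN eta)).
have ire x := integrableR_rot_re x ia ib; have iim x := integrableR_rot_im x ia ib.
have half (p q k : R -> R) : integrableR p -> integrableR q -> \int[mu]_s p s = 0 ->
    \int[mu]_s q s = 0 -> (forall s, k s = (p s + q s) / 2) -> \int[mu]_s k s = 0.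
  move=> ip iq p0 q0 e.
  transitivity (\int[mu]_s (2^-1 * (p s + q s))).
    by apply: eq_Rintegral => s _; rewrite e mulrC.
  rewrite RintZ; last exact: integrableRD.
  by rewrite RintD // p0 q0 addr0 mulr0.
have halfB (p q k : R -> R) : integrableR p -> integrableR q -> \int[mu]_s p s = 0 ->
    \int[mu]_s q s = 0 -> (forall s, k s = (p s - q s) / 2) -> \int[mu]_s k s = 0.
  move=> ip iq p0 q0 e; apply: (half p (fun s => - q s)) => //; first exact: integrableRN.
  transitivity (\int[mu]_s (-1 * q s)); first by apply: eq_Rintegral => s _; rewrite mulN1r.
  by rewrite RintZ // q0 mulr0.
split.
- exact: (half _ _ _ (ire _) (ire _) re1 re2 (rot_re_cos a b xi eta)).
- exact: (halfB _ _ _ (iim _) (iim _) im2 im1 (rot_re_sin a b xi eta)).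
- exact: (half _ _ _ (iim _) (iim _) im1 im2 (rot_im_cos a b xi eta)).
- exact: (halfB _ _ _ (ire _) (ire _) re1 re2 (rot_im_sin a b xi eta)).
Qed.

Lemma cabs_i : cabs ('i%C : R[i]) = 1.
Proof. by rewrite /cabs /= expr0n /= add0r expr1n sqrtr1. Qed.

Lemma bounded_measurable_cavg a b h : integrableR a -> integrableR b -> bounded_measurable h ->
  bounded_measurable (cavg a b h).
Proof.
move=> ia ib bh; apply: bounded_measurableD; first exact: bounded_measurable_avg.
exact/bounded_measurableZ/bounded_measurable_avg.
Qed.

Lemma cavg_continuous a b h : integrableR a -> integrableR b -> bounded_measurable h ->
  continuous (cavg a b h).
Proof.
move=> ia ib bh t; apply: cvgD; first exact: avg_continuous.
apply: (@continuous_comp _ _ _ (avg b h) (fun x => 'i%C *: x)); first exact: avg_continuous.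
exact: bounded_real_map_continuous (bounded_real_map_scale _) _.
Qed.

Lemma cavg_le a b h M t : integrableR a -> integrableR b -> strongly_measurable h ->
  bounded_by h M -> rnorm (cavg a b h t) <= (norm1 a + norm1 b) * M.
Proof.
move=> ia ib mh hM; apply: (le_trans (ler_rnormD _ _)).
by rewrite rnormZ cabs_i mul1r mulrDl; apply: lerD; exact: avg_le.
Qed.

Lemma cavg_dist_translate a b h M t (r : R) : integrableR a -> integrableR b ->
  strongly_measurable h -> bounded_by h M ->
  rnorm (cavg a b h (t + r) - cavg a b h t) <= (omega1 a (- r) + omega1 b (- r)) * M.
Proof.
move=> ia ib mh hM; rewrite /cavg opprD addrACA -scalerBr.
apply: (le_trans (ler_rnormD _ _)); rewrite rnormZ cabs_i mul1r mulrDl.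
by apply: lerD; exact: avg_dist_translate.
Qed.

(** The bound is free of [t], since translating an average costs only the L1 moduli of its kernels.
    Fejer means therefore converge uniformly even if [h] is not uniformly continuous. *)
Lemma fejer_approx_le a b h M t d : integrableR a -> integrableR b ->
  strongly_measurable h -> bounded_by h M -> 0 < d ->
  rnorm (fejerC%:C *: cavg a b h t - avg (fejer d) (cavg a b h) t) <=
  \int[mu]_s (fejer d s * ((omega1 a (- s) + omega1 b (- s)) * M)).
Proof.
move=> ia ib mh hM d0; have bh : bounded_measurable h by split => //; exists M.
have M0 := bounded_by_ge0 hM.
have bw := bounded_measurable_cavg ia ib bh; have ik := @integrableR_fejer R d.
set w := cavg a b h in bw *.
have iC : \int[mu]_s fejer d s = fejerC.
  have := @Rint_fejer_cos R 0 d d0; rewrite normr0 mul0r subr0 mulr1 => /(_ (ltW d0)) <-.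
  by apply: eq_Rintegral => s _; rewrite mul0r cos0 mulr1.
have mo (c : R -> R) : integrableR c -> measurable_fun setT (fun s : R => omega1 c (- s)).
  move=> ic; apply: measurableT_comp => //.
  by apply: continuous_measurable_fun; exact: omega1_continuous.
have iW : integrableR (fun s => fejer d s * ((omega1 a (- s) + omega1 b (- s)) * M)).
  apply: (integrableRM (M := (2 * norm1 a + 2 * norm1 b) * M) ik).
    by apply: measurable_funM => //; apply: measurable_funD; exact: mo.
  move=> s; rewrite ger0_norm; last by rewrite mulr_ge0 // addr_ge0 // norm1_ge0.
  by rewrite ler_wpM2r // lerD // omega1_le.
apply: rnorm_le_functional => l bl lb; rewrite functionalB //.
have [_ lZ _] := bl; have ii := integrableR_functional t ik bw bl.
rewrite lZ (avg_functional t ik bw bl) -iC mulrC -RintZ // -RintB //; last exact: integrableRZ.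
apply: Rint_le => //; first by apply: integrableRB => //; exact: integrableRZ.
move=> s; rewrite [l _ * _]mulrC -mulrBr ler_wpM2l ?fejer_ge0 ?(ltW d0) //.
rewrite -functionalB //; apply: (le_trans (ler_norm _)); apply: (le_trans (lb _)).
by rewrite rnormB; exact: cavg_dist_translate.
Qed.

Lemma cvg_fejer_approx a b h e : integrableR a -> integrableR b -> bounded_measurable h ->
  0 < e -> exists n : nat, forall t,
  rnorm (fejerC%:C *: cavg a b h t - avg (fejer n.+1%:R) (cavg a b h) t) <= e.
Proof.
move=> ia ib [mh [M hM]] e0; have M0 := bounded_by_ge0 hM.
pose W (s : R) := (omega1 a (- s) + omega1 b (- s)) * M.
have co (c : R -> R) : integrableR c -> continuous (fun s : R => omega1 c (- s)).
  move=> ic s; apply: (@continuous_comp _ _ _ (fun s : R => - s) (omega1 c)).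
    exact: opp_continuous.
  exact: omega1_continuous.
have cW : continuous W.
  by move=> s; apply: cvgM; [apply: cvgD; exact: co|exact: cvg_cst].
have W0 : W 0 = 0 by rewrite /W oppr0 !omega1_0 addr0 mul0r.
have := @cvg_fejer_identity R W ((2 * norm1 a + 2 * norm1 b) * M).
move=> /(_ (continuous_measurable_fun cW)) cv.
have {}cv : (fun n => \int[mu]_s (fejer n.+1%:R s * W s)) @ \oo --> (0 : R).
  apply: cv => [s|].
    rewrite ger0_norm; last by rewrite mulr_ge0 // addr_ge0 // norm1_ge0.
    by rewrite ler_wpM2r // lerD // omega1_le.
  by rewrite -[X in _ --> X]W0; exact: cW.
have [n _ hn] : \forall n \near \oo, \int[mu]_s (fejer n.+1%:R s * W s) < e.
  exact: (cvgr_lt _ cv).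
exists n => t; apply: (le_trans (fejer_approx_le t ia ib mh hM (ltr0Sn _ n))).
exact/ltW/hn/leqnn.
Qed.

End ComplexKernel.

(** * Synthesis of the components *)

Section GlobalMembership.
Context {R : realType} {X : completeNormedModType R[i]}.
Context (F : set (R -> X)) (hF : condition_Fpp F).
Notation mu := (@lebesgue_measure R).
Implicit Types (h u w : R -> X) (a b : R -> R) (t xi eta theta d r : R).

Lemma band_mem_cavg theta d a b h : 0 < d -> integrableR a -> integrableR b ->
  bounded_measurable h -> band_mem F theta d (avg a h) -> band_mem F theta d (avg b h) ->
  band_mem F theta d (cavg a b h).
Proof.
move=> d0 ia ib bh Fa Fb.
have ba := bounded_measurable_avg ia bh; have bb := bounded_measurable_avg ib bh.
apply: (band_memD hF ba (bounded_measurableZ 'i%C bb) Fa).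
exact: (band_memZ hF 'i%C bb Fb).
Qed.

(** A cosine is the half sum of two opposite modulations. Once demodulated, the two hypotheses give
    the averages by [kcos] + i [ksin] and [kcos] - i [ksin]. *)
Lemma memF_kcos xi d w : 0 < d -> bounded_measurable w ->
  memF F (avg (fejer d) (modul xi w)) -> memF F (avg (fejer d) (modul (- xi) w)) ->
  memF F (avg (kcos xi d) w).
Proof.
move=> d0 bw F1 F2.
have ic := integrableR_kcos xi d; have is_ := integrableR_ksin xi d.
have ek t : avg (kcos (- xi) d) w t = avg (kcos xi d) w t.
  by congr (avg _ _ _); apply/funext => s; rewrite /kcos mulNr cosN.
have es t : avg (ksin (- xi) d) w t = - avg (ksin xi d) w t.
  rewrite -(avgN t is_ bw); congr (avg _ _ _).
  by apply/funext => s; rewrite /ksin mulNr sinN mulNr.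
have G1 : memF F (fun t => avg (kcos xi d) w t + 'i%C *: avg (ksin xi d) w t).
  apply: eq_memF (memF_modul hF (- xi) F1) => t _.
  by rewrite (funext (fun t => avg_fejer_modul xi d t bw)) modulK.
have G2 : memF F (fun t => avg (kcos xi d) w t - 'i%C *: avg (ksin xi d) w t).
  apply: eq_memF (memF_modul hF xi F2) => t _.
  by rewrite (funext (fun t => avg_fejer_modul (- xi) d t bw)) modulNK ek es scalerN.
apply: eq_memF (memFZ hF (2^-1)%:C (memFD hF G2 G1)) => t _.
rewrite -[RHS](half_add_conj _ (avg (ksin xi d) w t)); congr (_ *: (_ + _)).
by rewrite scalerN opprK.
Qed.

Lemma memF_avg_sum (I : Type) (s : seq I) (k : I -> R -> R) w : bounded_measurable w ->
  (forall i, integrableR (k i) /\ memF F (avg (k i) w)) ->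
  integrableR (fun t => \sum_(i <- s) k i t) /\ memF F (avg (fun t => \sum_(i <- s) k i t) w).
Proof.
move=> bw hk; elim: s => [|i s [IH1 IH2]].
  have ik := @integrableR_fejer R 1.
  have -> : (fun t => \sum_(i <- [::]) k i t) = (fun t => 0 * fejer 1 t) :> (R -> R).
    by apply/funext => t; rewrite big_nil mul0r.
  split; first exact: integrableRZ.
  by apply: eq_memF (memF0 hF) => t _; rewrite avgZ // scale0r.
have -> : (fun t => \sum_(i <- i :: s) k i t) = (fun t => k i t + \sum_(i <- s) k i t).
  by apply/funext => t; rewrite big_cons.
have [ik Fk] := hk i; split; first exact: integrableRD.
by apply: eq_memF (memFD hF Fk IH2) => t _; rewrite avgD.
Qed.

Lemma memF_fejer_multiple N d w : (0 < N)%N -> 0 < d -> bounded_measurable w ->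
  (forall xi, `|xi| <= N%:R * d -> memF F (avg (fejer d) (modul xi w))) ->
  memF F (avg (fejer (N%:R * d)) w).
Proof.
move=> N0 d0 bw Fw.
have -> : fejer (N%:R * d) = (fun t => \sum_(k < N) \sum_(l < N)
    N%:R^-1 * kcos ((k%:R - l%:R) * d) d t).
  apply/funext => t; rewrite fejer_trigsum // /trigsum big_distrr /= big_distrl /=.
  apply: eq_bigr => k _; rewrite big_distrr /= big_distrl /=.
  by apply: eq_bigr => l _; rewrite /kcos -[_ * d * t]mulrA -mulrA.
apply: (memF_avg_sum _ bw _).2 => k; apply: (memF_avg_sum _ bw _) => l.
have ic := integrableR_kcos ((k%:R - l%:R) * d) d.
split; first exact: integrableRZ.
have kl : `|(k%:R - l%:R) * d| <= N%:R * d.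
  have /ltnW hk := ltn_ord k; have /ltnW hl := ltn_ord l.
  rewrite normrM (gtr0_norm d0) ler_pM2r // ler_norml.
  move: hk hl; rewrite -!(ler_nat R) => hk hl.
  have k0 : 0 <= (k : nat)%:R :> R by []; have l0 : 0 <= (l : nat)%:R :> R by [].
  by apply/andP; split; lra.
apply: eq_memF (memFZ hF N%:R^-1%:C (memF_kcos d0 bw (Fw _ kl) (Fw _ _))).
  by move=> t _; rewrite avgZ.
by rewrite normrN.
Qed.

Lemma memF_fejer_compact w : bounded_measurable w ->
  (forall xi, exists2 r, 0 < r & forall theta d, 0 < d -> `|theta| + d <= r ->
     band_mem F theta d (modul xi w)) ->
  forall n : nat, memF F (avg (fejer n.+1%:R) w).
Proof.
move=> bw hloc n.
(* The widths tend to 0, and N + 1 of them add up to exactly n + 1, as [memF_fejer_multiple]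
   requires. *)
pose d (N : nat) : R := n.+1%:R / N.+1%:R.
have d0 N : 0 < d N by rewrite divr_gt0 // ltr0n.
have cd : d @ \oo --> (0 : R).
  rewrite -[X in _ --> X](mulr0 (n.+1%:R : R)); apply: cvgM; first exact: cvg_cst.
  exact: cvg_harmonic.
have cK : compact (`[- n.+1%:R, n.+1%:R] : set R) by exact: segment_compact.
(* Near each [xi], all frequencies at distance below r/2 are good once [d N] is below r/2;
   compactness yields one N for the whole interval. *)
have [|N _ hN] := (compact_near_coveringP _).1 cK nat \oo
  (fun N xi => memF F (avg (fejer (d N)) (modul xi w))) _.
  move=> xi _; have [r r0 hr] := hloc xi; have r2 : 0 < r / 2 by rewrite divr_gt0.
  have nx : \forall xi' \near xi, `|xi - xi'| < r / 2.
    have cx : (id : R -> R) @ xi --> xi by exact: cvg_id.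
    by move/cvgrPdist_lt : cx => /(_ _ r2).
  have nN : \forall N \near \oo, d N < r / 2 by exact: (cvgr_lt _ cd).
  near=> xi' N => /=.
  have h1 : `|xi - xi'| < r / 2 by near: xi'.
  have h2 : d N < r / 2 by near: N.
  have bx := bounded_measurable_modul xi bw.
  have -> : modul xi' w = modul (xi' - xi) (modul xi w) by rewrite modulD subrK.
  apply: (band_mem_modul hF bx); apply: hr => //; rewrite distrC; lra.
have e : n.+1%:R = N.+1%:R * d N by rewrite /d mulrC divfK // lt0r_neq0 // ltr0n.
rewrite e; apply: memF_fejer_multiple => // xi; rewrite -e => hxi.
by apply: (hN N (leqnn N)); rewrite /= in_itv /=; rewrite ler_norml in hxi.
Unshelve. all: by end_near.
Qed.

Lemma memF_cavg_local a b h : integrableR a -> integrableR b -> bounded_measurable h ->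
  (forall xi, exists2 r, 0 < r & forall theta d, 0 < d -> `|theta| + d <= r ->
     band_mem F theta d (modul xi (cavg a b h))) ->
  memF F (cavg a b h).
Proof.
move=> ia ib bh hloc; have [mh [M hM]] := bh.
have bw := bounded_measurable_cavg ia ib bh; have C0 := @fejerC_gt0 R.
apply: (memF_lim hF); first exact: cavg_continuous.
  by exists ((norm1 a + norm1 b) * M) => t _; exact: cavg_le.
move=> e e0; have [n hn] := cvg_fejer_approx ia ib bh (mulr_gt0 C0 e0).
exists (fun t => fejerC^-1%:C *: avg (fejer n.+1%:R) (cavg a b h) t).
  exact/(memFZ hF)/memF_fejer_compact.
move=> t _; have -> : cavg a b h t - fejerC^-1%:C *: avg (fejer n.+1%:R) (cavg a b h) t =
    fejerC^-1%:C *: (fejerC%:C *: cavg a b h t - avg (fejer n.+1%:R) (cavg a b h) t).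
  by rewrite scalerBr scalerA -rmorphM mulVf ?scale1r // gt_eqF.
by rewrite rnormZr gtr0_norm ?invr_gt0 // ler_pdivrMl.
Qed.

Lemma memF_cavg_mild (D : set X) (A : X -> X) f u (g : R -> R[i]) (U : set R) :
  F f -> BC u -> mild_solution D A f u -> L1 setT g -> open U ->
  real_i_spectrum D A `<=` U -> (forall xi, U xi -> fourier g xi = 0) ->
  memF F (cavg (fun s => complex.Re (g s)) (fun s => complex.Im (g s)) u).
Proof.
move=> Ff Cu hu [ig1 ig2] oU EU gU; have bu := bounded_measurable_BC Cu.
pose a (s : R) := complex.Re (g s); pose b (s : R) := complex.Im (g s).
have ia : integrableR a by [].
have ib : integrableR b by [].
apply: (memF_cavg_local ia ib bu) => xi.
have bm := bounded_measurable_modul xi bu.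
have -> : modul xi (cavg a b u) = cavg (rot_re a b xi) (rot_im a b xi) (modul xi u).
  by apply/funext => t; exact: modul_cavg.
have ire := integrableR_rot_re xi ia ib; have iim := integrableR_rot_im xi ia ib.
have [Exi|nE] := pselect (real_i_spectrum D A xi).
  have : nbhs xi U by exact: open_nbhs_nbhs (conj oU (EU _ Exi)).
  move=> /nbhs_ballP[e /= e0 eU].
  (* The closed interval of radius e/2 lies in the open ball of radius e contained in [U]. *)
  have van : forall eta, `|eta| <= e / 2 -> \int[mu]_s rot_re a b (xi + eta) s = 0 /\
      \int[mu]_s rot_im a b (xi + eta) s = 0.
    move=> eta he; have Ueta : U (xi + eta).
      by apply: eU; rewrite /ball /= opprD addrA subrr sub0r normrN; lra.
    by have := gU _ Ueta; rewrite fourier_rot => -[].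
  exists (e / 2) => [|theta d d0 hd]; first by rewrite divr_gt0.
  have hv := rot_vanish ia ib van.
  apply: (band_mem_cavg d0 ire iim bm).
    by apply: (band_mem_vanish hF ire d0 hd _ _ bm) => eta /hv[].
  by apply: (band_mem_vanish hF iim d0 hd _ _ bm) => eta /hv[].
(* A real xi lies in i sigma(A) exactly when - i xi lies in sigma(A). *)
have [B [bB _ BA]] : resolvent_set D A (- ('i%C * xi%:C)).
  apply: contrapT => nr; apply: nE; exists (- ('i%C * xi%:C)) => //.
  by apply/eqP; rewrite eq_complex /=; apply/andP; split; apply/eqP; ring.
have bT := bounded_operator_map bB; have bf := bounded_measurableF hF Ff.
have Fd : memF F (unit_diff B (modul xi u)).
  have FB := memF_modul hF xi (memF_map hF bB (memF_F hF Ff)).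
  have bBf := bounded_measurable_modul xi (bounded_measurable_map bT bf).
  apply: eq_memF (memF_avg hF bBf FB (integrableR_indic_itv 0 1)) => t t0.
  by rewrite (unit_diff_modul bB BA (Fpp_BC hF Ff) Cu hu t0).
have [r r0 hr] := band_mem_unit_diff hF bB bm Fd.
exists r; first exact: r0.
move=> theta d d0 hd; have Fb := hr theta d d0 hd.
apply: (band_mem_cavg d0 ire iim bm).
  exact: (band_mem_avg hF d0 ire bm Fb).
exact: (band_mem_avg hF d0 iim bm Fb).
Qed.

Lemma memF_cavg_lim a b (gn : nat -> R -> R[i]) u : integrableR a -> integrableR b ->
  bounded_measurable u -> (forall n, L1 setT (gn n)) ->
  (fun n => (\int[mu]_t (cabs ((a t +i* b t) - gn n t))%:E)%E) @ \oo --> 0%E ->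
  (forall n, memF F (cavg (fun s => complex.Re (gn n s)) (fun s => complex.Im (gn n s)) u)) ->
  memF F (cavg a b u).
Proof.
move=> ia ib bu Lg cg Fg; have [mu_ [M uM]] := bu; have M0 := bounded_by_ge0 uM.
(* The real and imaginary kernels each contribute an error of at most e / (2 M + 1) times M, and [M]
   may be 0. *)
have M1 : 0 < 2 * M + 1 by rewrite ltr_wpDl // mulr_ge0.
apply: (memF_lim hF); first exact: cavg_continuous.
  by exists ((norm1 a + norm1 b) * M) => t _; exact: cavg_le.
move=> e e0; have ee : 0 < e / (2 * M + 1) by rewrite divr_gt0.
have [n _ hn] : \forall n \near \oo,
    ((\int[mu]_t (cabs ((a t +i* b t) - gn n t))%:E) < (e / (2 * M + 1))%:E)%E.
  have o : nbhs 0%E [set y : \bar R | (y < (e / (2 * M + 1))%:E)%E].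
    by apply: open_nbhs_nbhs; split; [exact: open_ereal_lt_ereal|rewrite /= lte_fin].
  exact: cg _ o.
have {}hn := hn n (leqnn n).
have [ig1 ig2] := Lg n.
pose an (s : R) := complex.Re (gn n s); pose bn (s : R) := complex.Im (gn n s).
have ian : integrableR an by [].
have ibn : integrableR bn by [].
exists (cavg an bn u); first exact: Fg.
have ida := integrableRB ia ian; have idb := integrableRB ib ibn.
have small (c : R -> R) : integrableR c -> (forall t, `|c t| <= cabs ((a t +i* b t) - gn n t)) ->
    norm1 c <= e / (2 * M + 1).
  move=> ic hc; rewrite -lee_fin -norm1_EFin //; apply: le_trans (ltW hn).
  have mc := integrableR_measurable ic.
  apply: ge0_le_integral => //.
  - by apply/measurable_EFinP; exact: measurableT_comp.
  - apply/measurable_EFinP.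
    have -> : (fun t => cabs ((a t +i* b t) - gn n t)) =
        (fun t => Num.sqrt ((a t - an t) ^+ 2 + (b t - bn t) ^+ 2)).
      by apply/funext => t; rewrite /an /bn; case: (gn n t).
    apply: (measurableT_comp (continuous_measurable_fun (@sqrt_continuous R))).
    apply: measurable_funD; apply: measurable_funX; exact: (integrableR_measurable _).
  - by move=> t _; rewrite lee_fin.
move=> t _; have -> : cavg a b u t - cavg an bn u t =
    cavg (fun s => a s - an s) (fun s => b s - bn s) u t.
  by rewrite /cavg !avgB // opprD addrACA -scalerBr.
apply: (le_trans (cavg_le t ida idb mu_ uM)).
have sa := small _ ida; have sb := small _ idb.
have nc (z : R[i]) : `|complex.Re z| <= cabs z /\ `|complex.Im z| <= cabs z.
  case: z => x y; rewrite /cabs /= -!sqrtr_sqr.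
  by split; apply: ler_wsqrtr; rewrite ?lerDl ?lerDr sqr_ge0.
have {}sa : norm1 (fun s => a s - an s) <= e / (2 * M + 1).
  apply: sa => s; have [h _] := nc ((a s +i* b s) - gn n s); apply: le_trans h.
  by rewrite raddfB.
have {}sb : norm1 (fun s => b s - bn s) <= e / (2 * M + 1).
  apply: sb => s; have [_ h] := nc ((a s +i* b s) - gn n s); apply: le_trans h.
  by rewrite raddfB.
apply: (@le_trans _ _ ((e / (2 * M + 1)) * (2 * M))).
  by rewrite mulrA ler_wpM2r // mulrDr mulr1 lerD.
by rewrite mulrAC ler_pdivrMr // ler_pM2l // lerDl.
Qed.

End GlobalMembership.

Theorem theorem1p2 (R : realType) (X : completeNormedModType R[i])
    (F : set (R -> X)) (hF : condition_Fpp F)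
    (D : set X) (A : X -> X) (hA : closed_linear_operator D A)
    (f : R -> X) (hf : F f)
    (u : R -> X) (huBC : BC u) (hu : mild_solution D A f u)
    (phi : R -> R[i]) (hphi : L1 Rplus phi)
    (hsynth : spectral_synthesis (ext0 Rplus phi) (real_i_spectrum D A)) :
  F (ext0 Rplus (fun t : R =>
       bochner Rplus (fun s : R => phi s *: u (t + s)))).
Proof.
have bu := bounded_measurable_BC huBC.
have [gn [Lg cg hg]] := hsynth; have [i1 i2] := hphi.
have mp : measurable (Rplus : set R) by exact: measurable_itv.
pose a := (fun s => complex.Re (phi s)) \_ Rplus; pose b := (fun s => complex.Im (phi s)) \_ Rplus.
have ia : integrableR a.
  rewrite /integrableR -restrict_EFin; apply/integrable_restrict => //.
  by rewrite setTI.
have ib : integrableR b.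
  rewrite /integrableR -restrict_EFin; apply/integrable_restrict => //.
  by rewrite setTI.
have ab s : ext0 Rplus phi s = a s +i* b s.
  by rewrite /a /b !restrictE /ext0 /patch; case: ifP => // _; case: (phi s).
have cg' : (fun n => (\int[lebesgue_measure]_t (cabs ((a t +i* b t) - gn n t))%:E)%E) @ \oo --> 0%E.
  by under eq_fun => n do under eq_integral => t _ do rewrite -ab.
have Fg n : memF F (cavg (fun s => complex.Re (gn n s)) (fun s => complex.Im (gn n s)) u).
  by have [U [oU EU gU]] := hg n; exact: (memF_cavg_mild hF hf huBC hu (Lg n) oU EU gU).
apply: eq_memF (memF_cavg_lim hF ia ib bu Lg cg' Fg) => t _.
have bt := bounded_measurable_translate t bu.
(* The kernel identity for Bochner integrals places the kernel at the base point, so [u] is first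
   translated by t and averaged at 0; [sh] then moves t back. *)
apply/esym; transitivity (avg a (fun s => u (t + s)) 0 + 'i%C *: avg b (fun s => u (t + s)) 0).
  apply: (bochner_cavg mp ia ib bt); apply/funext => s.
  by rewrite subr0 -ab /ext0 /patch; case: ifP; rewrite ?scale0r.
have sh c : integrableR c -> avg c (fun s => u (t + s)) 0 = avg c u t.
  move=> ic; rewrite -[in RHS](add0r t) (avg_shift 0 t ic bu).
  by apply: eq_avg => s; rewrite addrC.
by rewrite !sh.
Qed.
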